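(* Assume $\mathcal V\equiv\mathcal V^m$. (i) If $\mathcal V$ is continuous in $Dom(\mathcal V)$ and $\lim_{x\to\bar x}\mathcal V(x)=+\infty$ for all $\bar x\in\partial Dom(\mathcal V)$, then there is a unique continuous, nonnegative viscosity solution $W$ to (BVP$\mathcal K$). Moreover, $\mathcal V\equiv-\log(1-W)$ and $Dom(\mathcal V)=\{x: W(x)<1\}$. (ii) If for each $x\in\mathbb R^n$ the set $\{(\mu,\gamma)\in\mathbb R^{n+1}:\ \exists a\in A \text{ such that } \mu=f(x,a),\ l(x,a)\le\gamma\}$ is convex and $\mathcal V$ is continuous on $\partial\mathcal T$, then there is a unique nonnegative viscosity solution $W$ to (BVP$\mathcal K$), which turns out to be continuous. Moreover, $\mathcal V\equiv-\log(1-W)$ and $Dom(\mathcal V)=\{x: W(x)<1\}$.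
   Context: Standing setting. $A\subset\mathbb R^m$ is compact; the target $\mathcal T\subset\mathbb R^n$ is closed with compact boundary; $\mathcal T^c=\mathbb R^n\setminus\mathcal T$, $\overset{\circ}{\mathcal T}$ is the interior of $\mathcal T$, $\mathbb R_+=[0,+\infty[$. The functions $f:\mathbb R^n\times A\to\mathbb R^n$ and $l:\mathbb R^n\times A\to\mathbb R_+$ are continuous; there is $M>0$ with $|f(x,a)|\le M(1+|x|)$ for all $(x,a)$, and for every $R>0$ there is $L_R>0$ with $|f(x_1,a)-f(x_2,a)|\le L_R|x_1-x_2|$ and $|l(x_1,a)-l(x_2,a)|\le L_R|x_1-x_2|$ whenever $|x_1|,|x_2|\le R$, $a\in A$. $\mathcal A$ is the set of measurable controls $\alpha:\mathbb R_+\to A$, and $y_x(\cdot,\alpha)$ is the solution on $\mathbb R_+$ of $\dot y(t)=f(y(t),\alpha(t))$, $y(0)=x$. Put $t_x(\alpha)=\inf\{t\ge0: y_x(t,\alpha)\in\mathcal T\}\le+\infty$, $\mathcal J(t,x,\alpha)=\int_0^t l(y_x(s,\alpha),\alpha(s))\,ds$, and $\mathcal A(x)=\{\alpha\in\mathcal A:\ \liminf_{t\to t_x(\alpha)^-}\mathrm{dist}(y_x(t,\alpha),\mathcal T)=0\}$. For $x\in\mathcal T^c$: $\mathcal V(x)=\inf_{\alpha\in\mathcal A(x)}\mathcal J(t_x(\alpha),x,\alpha)$ and $\mathcal V^m(x)=\inf_{\alpha\in\mathcal A}\mathcal J(t_x(\alpha),x,\alpha)$ (with $\inf\emptyset=+\infty$);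 both functions are $0$ on $\mathcal T$. ''Continuous on $\partial\mathcal T$'' means continuous at each point of $\partial\mathcal T$ as a function on $\mathbb R^n\setminus\overset{\circ}{\mathcal T}$. $Dom(\mathcal V)=\{x\in\mathbb R^n\setminus\overset{\circ}{\mathcal T}:\mathcal V(x)<+\infty\}$, and $\partial Dom(\mathcal V)$ is its boundary relative to $\mathbb R^n\setminus\overset{\circ}{\mathcal T}$. (BVP$\mathcal K$). Let $\mathcal K(x,u,p)=\sup_{a\in A}\{-\langle p,f(x,a)\rangle-l(x,a)+l(x,a)u\}$. This is the equation satisfied by the Kruzkov transform $W=\Psi(u)=1-e^{-u}$ (with $\Psi(+\infty)=1$, $-\log 0=+\infty$) of solutions $u$, with values in $\mathbb R\cup\{+\infty\}$, of $\sup_{a\in A}\{-\langle Du,f(x,a)\rangle-l(x,a)\}=0$. The problem (BVP$\mathcal K$) is $\mathcal K(x,W(x),DW(x))=0$ in $\mathbb R^n\setminus\mathcal T$, $W=0$ on $\partial\mathcal T$. A solution is a locally bounded function $W:\mathbb R^n\setminus\overset{\circ}{\mathcal T}\to\,]-\infty,1]$ whose lower semicontinuous envelope $W_*$ satisfies $W_*\ge0$ on $\partial\mathcal T$ and is a viscosity supersolution of $\mathcal K=0$ in $\mathbb R^n\setminus\mathcal T$, and whose upper semicontinuous envelope $W^*$ satisfies $W^*\le0$ on $\partial\mathcal T$ and is a viscosity subsolution of $\mathcal K=0$ in $\mathbb R^n\setminus\mathcal T$. *)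

(* Defs.v *)
From HB Require Import structures.
From mathcomp Require Import all_boot all_order all_algebra.
From mathcomp Require Import all_classical all_reals all_analysis.

Set Implicit Arguments.
Unset Strict Implicit.
Unset Printing Implicit Defensive.

Import Order.TTheory GRing.Theory Num.Theory.
Import numFieldNormedType.Exports.

Local Open Scope classical_set_scope.
Local Open Scope ring_scope.

(* Vectors of R^n are row vectors.  The library norm on 'rV[R]_n is the
   sup-norm; it induces the usual topology, but |x| in the growth and Lipschitz
   conditions and in the distance to the target is the Euclidean norm. *)
Section Euclidean.
Context {R : realType} {n : nat}.
Implicit Types (x y p : 'rV[R]_n) (S D : set 'rV[R]_n).

Definition dotp p x : R := (p *m x^T) 0 0.

Definition enorm x : R := Num.sqrt (dotp x x).

(* +oo when S is empty *)
Definition dist x S : \bar R := ereal_inf [set (enorm (x - y))%:E | y in S].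

(* boundary of a subset S of D, relative to D *)
Definition boundary D S : set 'rV[R]_n := D `&` closure S `&` closure (D `\` S).

Definition ext_domain S : set 'rV[R]_n := ~` S°.

(* continuity at the point x of D of a function on D *)
Definition continuous_at_in {U : topologicalType} D (u : 'rV[R]_n -> U) x :=
  u @ within D (nbhs x) --> u x.

Definition continuous_on D (W : 'rV[R]_n -> R) :=
  forall x, D x -> continuous_at_in D W x.

Definition nonneg_on D (W : 'rV[R]_n -> R) := forall x, D x -> 0 <= W x.

Definition gradient (phi : 'rV[R]_n -> R) x : 'rV[R]_n :=
  \row_i 'D_(delta_mx 0 i) phi x.

Definition C1_on (O : set 'rV[R]_n) (phi : 'rV[R]_n -> R) :=
  forall x, O x -> differentiable phi x /\ continuous_at x (gradient phi).

End Euclidean.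

Section Control.
Context {R : realType} {n m : nat}.
Implicit Types (f : 'rV[R]_n -> 'rV[R]_m -> 'rV[R]_n)
  (l : 'rV[R]_n -> 'rV[R]_m -> R) (A : set 'rV[R]_m) (T : set 'rV[R]_n)
  (x : 'rV[R]_n) (alpha : R -> 'rV[R]_m) (y : R -> 'rV[R]_n).

(* A is nonempty, as implicit in the suprema over A and in the existence of
   controls. *)
Definition standing_assumptions A T f l :=
  [/\ compact A /\ A !=set0,
      closed T /\ compact (boundary setT T),
      {within [set: 'rV[R]_n] `*` A, continuous (fun z => f z.1 z.2)} /\
      {within [set: 'rV[R]_n] `*` A, continuous (fun z => l z.1 z.2)},
      forall x a, A a -> 0 <= l x a &
      (exists2 M, 0 < M &
         forall x a, A a -> enorm (f x a) <= M * (1 + enorm x)) /\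
      (forall r, 0 < r -> exists2 L, 0 < L &
         forall x1 x2 a, enorm x1 <= r -> enorm x2 <= r -> A a ->
           enorm (f x1 a - f x2 a) <= L * enorm (x1 - x2) /\
           `|l x1 a - l x2 a| <= L * enorm (x1 - x2))].

(* Values of controls and trajectories at negative times are irrelevant.
   Measurability is Borel; a Lebesgue measurable control agrees almost
   everywhere with a Borel one, with the same trajectory and costs. *)
Definition control A alpha :=
  (forall t, 0 <= t -> A (alpha t)) /\
  (forall j, measurable_fun (`[0, +oo[%classic : set R) (fun t : R => alpha t 0 j)).

(* Caratheodory solution on [0, +oo[ of y' = f(y, alpha), y(0) = x; the
   integrand is bounded on each [0, t] for continuous f and y and compact A. *)
Definition is_trajectory f x alpha y :=
  {within `[0%R, +oo[, continuous y} /\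
  forall t, 0 <= t -> forall i, y t 0 i =
    x 0 i + \int[lebesgue_measure]_(s in `[0%R, t]) f (y s) (alpha s) 0 i.

Definition trajectory f x alpha : R -> 'rV[R]_n :=
  xget (fun=> x) [set y | is_trajectory f x alpha y].

Definition exit_time T f x alpha : \bar R :=
  ereal_inf [set t%:E | t in [set t | 0 <= t /\ T (trajectory f x alpha t)]].

Definition cost f l (t : \bar R) x alpha : \bar R :=
  (\int[lebesgue_measure]_(s in [set s | (0 <= s)%R /\ s%:E <= t])
    (l (trajectory f x alpha s) (alpha s))%:E)%E.

(* the filter t -> tau^-, used for tau in [0, +oo] only *)
Definition left_nbhs (tau : \bar R) : set_system R :=
  if tau is r%:E then r^'- else +oo%R.

Definition reaching A T f x alpha :=
  control A alpha /\
  limf_einf (fun t => dist (trajectory f x alpha t) T)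
            (left_nbhs (exit_time T f x alpha)) = 0%E.

Definition value A T f l x : \bar R :=
  if x \in T then 0%E
  else ereal_inf [set cost f l (exit_time T f x alpha) x alpha
                 | alpha in reaching A T f x].

Definition value_m A T f l x : \bar R :=
  if x \in T then 0%E
  else ereal_inf [set cost f l (exit_time T f x alpha) x alpha
                 | alpha in control A].

Definition Dom A T f l : set 'rV[R]_n :=
  [set x | ext_domain T x /\ (value A T f l x < +oo)%E].

Definition velocity_cost_set A f l x : set (convex_lmodType ('rV[R]_n * R^o)%type) :=
  [set z | exists a, [/\ A a, z.1 = f x a & l x a <= z.2]].

End Control.

Section Viscosity.
Context {R : realType} {n m : nat}.
Implicit Types (f : 'rV[R]_n -> 'rV[R]_m -> 'rV[R]_n)
  (l : 'rV[R]_n -> 'rV[R]_m -> R) (A : set 'rV[R]_m) (T O D : set 'rV[R]_n)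
  (x p : 'rV[R]_n) (W u : 'rV[R]_n -> R).

(* Semicontinuous envelopes of a function W on D.  The filter contains x
   itself; for x in D and W locally bounded on D the limits are finite. *)
Definition lsc_env D W x : R := fine (limf_einf (EFin \o W) (within D (nbhs x))).

Definition usc_env D W x : R := fine (limf_esup (EFin \o W) (within D (nbhs x))).

Definition viscosity_supersolution O
    (F : 'rV[R]_n -> R -> 'rV[R]_n -> \bar R) u :=
  forall phi x, C1_on O phi -> O x ->
    (\forall z \near x, u x - phi x <= u z - phi z) ->
    (0 <= F x (u x) (gradient phi x))%E.

Definition viscosity_subsolution O
    (F : 'rV[R]_n -> R -> 'rV[R]_n -> \bar R) u :=
  forall phi x, C1_on O phi -> O x ->
    (\forall z \near x, u z - phi z <= u x - phi x) ->
    (F x (u x) (gradient phi x) <= 0)%E.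

Definition HamK A f l x (r : R) p : \bar R :=
  ereal_sup [set (- dotp p (f x a) - l x a + l x a * r)%:E | a in A].

(* Only the values of W on ext_domain T matter. *)
Definition BVPK_solution A T f l W :=
  let D := ext_domain T in
  let bd := boundary setT T in
  [/\ forall x, D x -> W x <= 1,
      forall x, D x -> bounded_near W (within D (nbhs x)),
      (forall x, bd x -> 0 <= lsc_env D W x) /\
      viscosity_supersolution (~` T) (HamK A f l) (lsc_env D W) &
      (forall x, bd x -> usc_env D W x <= 0) /\
      viscosity_subsolution (~` T) (HamK A f l) (usc_env D W)].

(* - log (1 - w), equal to +oo at w = 1 *)
Definition inverse_Kruzkov (w : R) : \bar R := (- lne (1 - w)%:E)%E.

End Viscosity.

(* Main.v *)
(* Let Z = exp (- V) and W = 1 - Z.  By the dynamic programming principle W is a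
   nonnegative viscosity solution, so everything follows from L >= W >= U outside
   T for the lower and upper envelopes L and U of any nonnegative solution W'.

   The tool for both inequalities is extremal aiming: along a trajectory y, the
   infimum over x of g x + w |x - y|^2 / 2, discounted by exp (- running cost),
   hardly increases over a short time if the control satisfies the Hamiltonian
   inequality at the minimizing x, where the quadratic penalty is a test function.
   For g = 1 - U every control does, by the subsolution property; letting w tend
   to +oo, exp (- cost) (1 - U (y t)) <= 1 - U (y 0) for all controls, and for
   reaching controls U <= 0 on the compact boundary gives Z <= 1 - U.  For
   g = L - 1 the supersolution property provides some control at each point,
   hence almost optimal trajectories on a short stage, up to a small displacement
   of the end point.  This displacement is harmless if W' is continuous (i);
   under the convexity assumption (ii) a limit of the trajectories is again a
   trajectory, of no larger cost.  Concatenating stages gives controls whose cost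
   up to the exit time is at most - log (1 - L x), up to an arbitrarily small
   error; they need not be reaching, and this is where V = V^m is used.

   Continuity of W follows from the assumptions on V in (i), and in (ii) from
   the comparison applied to W itself, which bounds U by W and W by L. *)
Require Import Defs.
From HB Require Import structures.
From mathcomp Require Import all_boot all_order all_algebra.
From mathcomp Require Import all_classical all_reals all_analysis.
From mathcomp Require Import measurable_realfun ring lra.
Import Order.TTheory GRing.Theory Num.Theory.
Import numFieldNormedType.Exports.
Local Open Scope classical_set_scope.
Local Open Scope ring_scope.

Set Implicit Arguments.
Unset Strict Implicit.
Unset Printing Implicit Defensive.

(** * Integration over intervals *)

Section Integral.
Context {R : realType}.
Implicit Types (g : R -> R) (a b s t : R).
Local Notation mu := (@lebesgue_measure R).

(** The order of the choices shapes the proof. Extremal aiming controls [g] at a point [xh] within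
    [rho] of the end of the trajectory, and lower semicontinuity compares [g xh] with [g] at the end
    only if [rho] is chosen after the end point. For a subsolution the control is given, so the end
    point is fixed and [rho] may tend to 0. For a supersolution the control is built from [rho], the
    end point moves with it, and the pointwise estimate does not apply; uniform continuity, or a
    limit trajectory whose end point is fixed before the approximation is selected, restores the
    order. Discounting has two advantages: infinite values become 0 and all functions are bounded by
    1, and estimates on consecutive stages multiply, because the discount over a concatenation is
    the product of the discounts. The viscosity inequalities hold only outside the target, so the
    length of a stage is adapted to the distance from it. As long as approximate optimality is
    enough, controls are spliced from constant pieces and are clearly measurable; a measurable
    selection occurs only for the limit trajectory. *)

Definition RI g a b : R := \int[mu]_(s in `[a, b]) g s.

(** A class of integrands that, unlike the integrable functions, is stable under products; like
    controls, they are unconstrained at negative times. *)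
Definition locbm g := measurable_fun (`[0, +oo[%classic : set R) g /\
  forall b, exists C : R, forall s, 0 <= s <= b -> `|g s| <= C.

Lemma locbm_integrable g a b : locbm g -> 0 <= a ->
  mu.-integrable `[a, b] (EFin \o g).
Proof.
move=> [mg bg] a0.
apply: measurable_bounded_integrable => //.
- by apply: (@compact_finite_measure _ `[a, b]%classic); exact: segment_compact.
- apply: measurable_funS mg => //= s /=; rewrite !in_itv/= => /andP[+ _].
  by rewrite andbT; exact: le_trans.
- have [C hC] := bg b.
  exists C; split; first exact: num_real.
  move=> D CD s /=; rewrite in_itv/= => /andP[as_ sb].
  by rewrite (le_trans (hC s _)) ?(ltW CD)// (le_trans a0 as_).
Qed.

Lemma RI_add g a b c : locbm g -> 0 <= a -> a <= b -> b <= c ->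
  RI g a c = RI g a b + RI g b c.
Proof.
move=> lg a0 ab bc; rewrite /RI.
have := @Rintegral_itvB _ g (BLeft a) (BRight c) b (locbm_integrable _ lg a0).
rewrite !bnd_simp => /(_ ab bc).
rewrite Rintegral_itv_obnd_cbnd; first by lra.
apply: (integrableS _ _ _ (locbm_integrable c lg (le_trans a0 ab))) => //.
by apply: subset_itvr; rewrite bnd_simp.
Qed.

Lemma RI_xx g a : RI g a a = 0.
Proof. by rewrite /RI set_itv1 Rintegral_set1. Qed.

Lemma RI_eq g g' a b : (forall s, a <= s <= b -> g s = g' s) ->
  RI g a b = RI g' a b.
Proof.
by move=> gg; apply: eq_Rintegral => s; rewrite inE/= in_itv/=; exact: gg.
Qed.

Lemma RI_le g g' a b : locbm g -> locbm g' -> 0 <= a ->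
  (forall s, a <= s <= b -> g s <= g' s) -> RI g a b <= RI g' a b.
Proof.
move=> lg lg' a0 gg; by apply: le_Rintegral => //; exact: locbm_integrable.
Qed.

Lemma RI_cst C a b : a <= b -> RI (fun=> C) a b = C * (b - a).
Proof.
move=> ab; rewrite /RI Rintegral_cst//= lebesgue_measure_itv/= lte_fin.
move: ab; rewrite le_eqVlt => /predU1P[->|->]//.
by rewrite ltxx subrr.
Qed.

Lemma locbm_cst C : locbm (fun=> C).
Proof. by split => // b; exists `|C|. Qed.

Lemma locbmD g g' : locbm g -> locbm g' -> locbm (fun s => g s + g' s).
Proof.
move=> [mg bg] [mg' bg']; split; first exact: measurable_funD.
move=> b; have [C hC] := bg b; have [C' hC'] := bg' b; exists (C + C') => s sb.
by rewrite (le_trans (ler_normD _ _))// lerD// ?hC ?hC'.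
Qed.

Lemma locbmM g g' : locbm g -> locbm g' -> locbm (fun s => g s * g' s).
Proof.
move=> [mg bg] [mg' bg']; split; first exact: measurable_funM.
move=> b; have [C hC] := bg b; have [C' hC'] := bg' b; exists (C * C') => s sb.
by rewrite normrM ler_pM// ?hC ?hC'.
Qed.

Lemma locbmZ C g : locbm g -> locbm (fun s => C * g s).
Proof. by move=> lg; apply: locbmM => //; exact: locbm_cst. Qed.

Lemma locbmN g : locbm g -> locbm (fun s => - g s).
Proof.
move=> lg; have := locbmZ (-1) lg.
by congr locbm; apply/funext => s; rewrite mulN1r.
Qed.

Lemma locbm_norm g : locbm g -> locbm (fun s => `|g s|).
Proof.
move=> [mg bg]; split; first exact: measurableT_comp.
by move=> b; have [C hC] := bg b; exists C => s sb; rewrite normr_id hC.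
Qed.

Lemma locbm_sum (I : finType) (G : I -> R -> R) : (forall i, locbm (G i)) ->
  locbm (fun s => \sum_i G i s).
Proof.
move=> lG; split.
  by apply: measurable_sum => i; exact: (lG i).1.
move=> b; have /choice[C hC] : forall i, exists C, forall s, 0 <= s <= b -> `|G i s| <= C.
  by move=> i; exact: (lG i).2.
exists (\sum_i C i) => s sb; apply: (le_trans (ler_norm_sum _ _ _)).
by apply: ler_sum => i _; exact: hC.
Qed.

Lemma RID g g' a b : locbm g -> locbm g' -> 0 <= a ->
  RI (fun s => g s + g' s) a b = RI g a b + RI g' a b.
Proof. by move=> lg lg' a0; apply: RintegralD => //; exact: locbm_integrable. Qed.

Lemma RIZ C g a b : locbm g -> 0 <= a -> RI (fun s => C * g s) a b = C * RI g a b.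
Proof. by move=> lg a0; apply: RintegralZl => //; exact: locbm_integrable. Qed.

Lemma RIB g g' a b : locbm g -> locbm g' -> 0 <= a ->
  RI (fun s => g s - g' s) a b = RI g a b - RI g' a b.
Proof. by move=> lg lg' a0; apply: RintegralB => //; exact: locbm_integrable. Qed.

Lemma RI_sum (I : finType) (G : I -> R -> R) a b : (forall i, locbm (G i)) -> 0 <= a ->
  RI (fun s => \sum_i G i s) a b = \sum_i RI (G i) a b.
Proof.
move=> lG a0.
suff H : forall r : seq I, locbm (fun s => \sum_(i <- r) G i s) /\
    RI (fun s => \sum_(i <- r) G i s) a b = \sum_(i <- r) RI (G i) a b.
  by have [_] := H (index_enum I).
elim => [|i r [lr IH]].
  under eq_fun do rewrite big_nil; split; first exact: locbm_cst.
  rewrite big_nil; have [ab|ba] := leP a b; first by rewrite RI_cst// mul0r.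
  by rewrite /RI set_itv_ge ?Rintegral_set0// bnd_simp -ltNge.
under eq_fun do rewrite big_cons; split; first exact: locbmD.
by rewrite big_cons RID// IH.
Qed.

Lemma RI_abs g a b : locbm g -> 0 <= a -> `|RI g a b| <= RI (fun s => `|g s|) a b.
Proof. by move=> lg a0; apply: le_normr_Rintegral => //; exact: locbm_integrable. Qed.

Lemma RI_ge0 g a b : (forall s, a <= s <= b -> 0 <= g s) -> 0 <= RI g a b.
Proof. by move=> g0; apply: Rintegral_ge0 => s /=; rewrite in_itv/=; exact: g0. Qed.

(** The pushforward of [mu] under the translation agrees with [mu] on half-open intervals, and these
    determine Lebesgue measure. *)
Lemma lebesgue_measure_translation c (B : set R) : measurable B ->
  mu B = mu ((fun s => s + c) @^-1` B).
Proof.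
pose ph : measurableTypeR R -> measurableTypeR R := fun s => s + c.
have mph : measurable_fun setT ph.
  by apply: measurable_funD => //; exact: measurable_id.
pose phm : {mfun _ >-> _} := HB.pack ph (isMeasurableFun.Build _ _ _ _ _ mph).
move=> mB.
suff /(_ (pushforward mu phm)) : forall nu : {measure set (measurableTypeR R) -> \bar R},
  (forall X, ocitv X -> mu X = nu X) -> mu B = nu B.
  apply => X [[x y] _ <-] /=; rewrite /pushforward.
  have -> : phm @^-1` `]x, y] = `]x - c, y - c]%classic.
    by apply/seteqP; split => s /=; rewrite !in_itv/= /ph lerBrDr ltrBlDr.
  rewrite !lebesgue_measure_itv/= !lte_fin ltrD2r -!EFinB.
  by case: ifP => // _; congr (_%:E); ring.
by move=> nu hnu; exact: lebesgue_measure_unique.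
Qed.


Lemma RI_shift g s t : locbm g -> 0 <= s -> 0 <= t ->
  RI g s (s + t) = RI (fun u => g (s + u)) 0 t.
Proof.
move=> [mg bg] s0 t0.
(* [g] is measurable only on the half line; its extension by 0 is measurable everywhere, as the
   change of variables requires. *)
pose gh : measurableTypeR R -> R := fun u => (g \_ `[0, +oo[) u.
have mgh : measurable_fun setT gh by rewrite /gh -measurable_restrictT.
pose ph : measurableTypeR R -> measurableTypeR R := fun u => u + s.
have mph : measurable_fun setT ph.
  by apply: measurable_funD => //; exact: measurable_id.
have ghE u : 0 <= u -> gh u = g u.
  by move=> u0; rewrite /gh patchE mem_set//= in_itv/= u0.
have lgh : locbm gh.
  split; first exact: measurable_funTS.
  move=> b; have [C hC] := bg b; exists C => u /andP[u0 ub].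
  by rewrite ghE// hC// u0.
have -> : RI g s (s + t) = RI gh s (s + t).
  by apply: RI_eq => u /andP[su _]; rewrite ghE// (le_trans s0).
have -> : RI (fun u => g (s + u)) 0 t = RI (fun u => gh (s + u)) 0 t.
  by apply: RI_eq => u /andP[u0 _]; rewrite ghE// addr_ge0.
have pre : ph @^-1` `[s, s + t] = `[0, t]%classic.
  by apply/seteqP; split => u /=; rewrite !in_itv/= /ph lerDr addrC lerD2l.
rewrite /RI /Rintegral; congr fine.
transitivity (\int[pushforward mu ph]_(x in `[s, (s + t)%R]) (gh x)%:E)%E.
  apply: eq_measure_integral => B mB _.
  exact: lebesgue_measure_translation.
rewrite integral_pushforward//.
- by rewrite pre; apply: eq_integral => u _ /=; rewrite /ph addrC.
- exact/measurable_EFinP.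
- rewrite pre.
  have := @locbm_integrable (fun u => gh (u + s)) 0 t.
  apply => //; split.
    apply: measurable_funTS; exact: (measurableT_comp mgh mph).
  move=> b; have [C hC] := lgh.2 (b + s); exists C => u /andP[u0 ub].
  by rewrite hC// addr_ge0//= lerD2r.
Qed.

Lemma RI_expR (L t : R) : 0 < L -> 0 <= t ->
  RI (fun s => expR (2 * L * s)) 0 t = (expR (2 * L * t) - 1) / (2 * L).
Proof.
move=> L0; rewrite le_eqVlt => /predU1P[<-|t0].
  by rewrite RI_xx mulr0 expR0 subrr mul0r.
pose F (s : R) := expR (2 * L * s) / (2 * L).
have L2 : 2 * L != 0 by rewrite mulf_neq0 ?pnatr_eq0// gt_eqF.
have dF (x : R) : is_derive x 1 F (expR (2 * L * x)).
  apply: is_derive_eq; rewrite !scaler0 !add0r ?addr0.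
  by rewrite /GRing.scale /=; field; rewrite gt_eqF.
have cF : continuous F.
  by move=> x; apply: differentiable_continuous; apply/derivable1_diffP; exact: ex_derive.
rewrite /RI /Rintegral (@continuous_FTC2 _ _ F)//=.
- by rewrite /F mulr0 expR0; field; rewrite gt_eqF.
- apply: continuous_subspaceT => x; apply: continuous_comp; last exact: continuous_expR.
  by apply: cvgM; [exact: cvg_cst|exact: cvg_id].
- split => //.
  + exact/cvg_at_right_filter/cF.
  + exact/cvg_at_left_filter/cF.
- by move=> x _; rewrite derive1E derive_val.
Qed.

(* The supremum of [g s * expR (- 2 * L * s)] is at most [e] plus half of
   itself. *)
Lemma gronwall g (e L b : R) : locbm g -> 0 < L -> 0 <= e ->
  (forall t, 0 <= t <= b -> 0 <= g t /\ g t <= e + L * RI g 0 t) ->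
  forall t, 0 <= t <= b -> g t <= 2 * e * expR (2 * L * t).
Proof.
move=> lg L0 e0 hg t0 t0b.
have [C hC] := lg.2 b.
pose S := [set g s * expR (- (2 * L * s)) | s in `[0, b]].
have ubS : has_ubound S.
  exists C => z [s /=]; rewrite in_itv/= => s0b <-.
  have [gs0 _] := hg _ s0b.
  rewrite (le_trans _ (hC _ s0b))// ger0_norm// ler_piMr//.
  rewrite -expR0 ler_expR oppr_le0 mulr_ge0//; last by case/andP: s0b.
  by rewrite mulr_ge0// ltW.
have SS : has_sup S by split => //; exists (g t0 * expR (- (2 * L * t0))), t0.
pose c := sup S.
have gc s : 0 <= s <= b -> g s <= c * expR (2 * L * s).
  move=> sb; rewrite -ler_pdivrMr ?expR_gt0// -expRN.
  by apply: ub_le_sup => //; exists s.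
have c2 : c <= e + c / 2.
  apply: ge_sup; first by case: SS.
  move=> z [s /=]; rewrite in_itv/= => s0b <-.
  have /andP[s0 sb] := s0b.
  rewrite expRN ler_pdivrMr ?expR_gt0//.
  have [gs0 gs] := hg _ s0b; apply: (le_trans gs).
  have c0 : 0 <= c.
    have := gc _ s0b; move/(le_trans gs0); rewrite pmulr_lge0 ?expR_gt0//.
  have lexp : locbm (fun s => expR (2 * L * s)).
    split.
      by apply: measurable_funTS; apply: measurableT_comp => //.
    move=> b'; exists (expR (2 * L * b')) => u /andP[u0 ub].
    by rewrite ger0_norm ?expR_ge0// ler_expR ler_pM2l// mulr_gt0.
  have : RI g 0 s <= RI (fun s => c * expR (2 * L * s)) 0 s.
    apply: RI_le => //; first exact: locbmZ.
    by move=> u /andP[u0 us]; apply: gc; rewrite u0 (le_trans us).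
  rewrite RIZ// RI_expR//.
  rewrite -(ler_pM2l L0) => /le_trans/(_ (lexx _)) h.
  have -> : (e + c / 2) * expR (2 * L * s) =
    e * expR (2 * L * s) + (c / 2) * expR (2 * L * s) by rewrite mulrDl.
  apply: lerD.
    by rewrite ler_peMr// -expR0 ler_expR mulr_ge0// mulr_ge0// ltW.
  apply: (le_trans h).
  have -> : L * (c * ((expR (2 * L * s) - 1) / (2 * L))) =
     (c / 2) * expR (2 * L * s) - c / 2 by field; rewrite gt_eqF.
  by rewrite gerBl divr_ge0.
have c2e : c <= 2 * e by move: c2; lra.
apply: (le_trans (gc _ t0b)).
by rewrite ler_pM2r ?expR_gt0.
Qed.

End Integral.

(** * Inner product, sup-norm and Euclidean norm *)

Section Vectors.
Context {R : realType} {n : nat}.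
Implicit Types (x y p v : 'rV[R]_n).

Lemma coord_le_norm v i : `|v 0 i| <= `|v|.
Proof.
rewrite [leRHS]/Num.norm/= mx_normrE; apply/bigmax_geP; right => /=.
by exists (0, i).
Qed.

Lemma norm_rV_le v (c : R) : 0 <= c -> (forall i, `|v 0 i| <= c) -> `|v| <= c.
Proof.
move=> c0 vc; rewrite [leLHS]/Num.norm/= mx_normrE; apply/bigmax_leP; split => //.
by move=> [i j] _ /=; rewrite ord1.
Qed.

Lemma dotpE p x : dotp p x = \sum_i p 0 i * x 0 i.
Proof. by rewrite /dotp mxE; apply: eq_bigr => i _; rewrite mxE. Qed.

Lemma dotpC p x : dotp p x = dotp x p.
Proof. by rewrite !dotpE; apply: eq_bigr => i _; rewrite mulrC. Qed.

Lemma dotpDl p q x : dotp (p + q) x = dotp p x + dotp q x.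
Proof. by rewrite /dotp mulmxDl mxE. Qed.

Lemma dotpNl p x : dotp (- p) x = - dotp p x.
Proof. by rewrite /dotp mulNmx mxE. Qed.

Lemma dotpZl c p x : dotp (c *: p) x = c * dotp p x.
Proof. by rewrite /dotp -scalemxAl mxE. Qed.

Lemma dotpDr p x y : dotp p (x + y) = dotp p x + dotp p y.
Proof. by rewrite ![dotp p _]dotpC dotpDl. Qed.

Lemma dotpNr p x : dotp p (- x) = - dotp p x.
Proof. by rewrite ![dotp p _]dotpC dotpNl. Qed.

Lemma dotpZr c p x : dotp p (c *: x) = c * dotp p x.
Proof. by rewrite ![dotp p _]dotpC dotpZl. Qed.

Lemma dotpBr p x y : dotp p (x - y) = dotp p x - dotp p y.
Proof. by rewrite dotpDr dotpNr. Qed.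

Lemma dotp_bound p x : `|dotp p x| <= n%:R * `|p| * `|x|.
Proof.
rewrite dotpE (le_trans (ler_norm_sum _ _ _))//.
rewrite (@le_trans _ _ (\sum_(i < n) `|p| * `|x|))//.
  by apply: ler_sum => i _; rewrite normrM ler_pM// coord_le_norm.
by rewrite sumr_const card_ord -mulrA mulr_natl.
Qed.

Lemma dotp_ge0 x : 0 <= dotp x x.
Proof. by rewrite dotpE sumr_ge0// => i _; rewrite -expr2 sqr_ge0. Qed.

Lemma norm_sqr_le_dotp x : `|x| ^+ 2 <= dotp x x.
Proof.
suff : `|x| <= Num.sqrt (dotp x x).
  move=> h; rewrite -[leRHS]sqr_sqrtr ?dotp_ge0//.
  by rewrite lerXn2r// nnegrE// sqrtr_ge0.
apply: norm_rV_le; first exact: sqrtr_ge0.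
move=> i; rewrite -sqrtr_sqr ler_wsqrtr// dotpE (bigD1 i)//= -expr2 lerDl.
by rewrite sumr_ge0// => j _; rewrite -expr2 sqr_ge0.
Qed.

Lemma norm_le_enorm x : `|x| <= enorm x.
Proof.
rewrite /enorm -[leLHS]ger0_norm// -sqrtr_sqr ler_wsqrtr//.
exact: norm_sqr_le_dotp.
Qed.

Lemma enorm_le_norm x : enorm x <= n.+1%:R * `|x|.
Proof.
rewrite /enorm -[leRHS]ger0_norm ?mulr_ge0// -sqrtr_sqr ler_wsqrtr//.
have := dotp_bound x x; rewrite ger0_norm ?dotp_ge0// => /le_trans; apply.
rewrite exprMn -mulrA -expr2 ler_wpM2r ?sqr_ge0//.
by rewrite -natrX ler_nat (leq_trans (leqnSn n))// -mulnn leq_pmull.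
Qed.

End Vectors.

(** * Minima of lower semicontinuous functions *)

Section Topology.
Context {R : realType}.

(** The sets of points of [K] with [g x < m + e] generate a filter; any cluster point of it in [K]
    is a minimizer. *)
Lemma lsc_min {V : topologicalType} (K : set V) (g : V -> R) (c : R) :
  compact K -> K !=set0 -> (forall x, K x -> c <= g x) ->
  (forall p e, K p -> 0 < e -> \forall z \near p, K z -> g p - e < g z) ->
  exists2 p, K p & forall z, K z -> g p <= g z.
Proof.
move=> cK [x0 Kx0] gc lsc.
pose m := inf (g @` K).
have hm : has_inf (g @` K) by split; [exists (g x0), x0|exists c => _ [z Kz <-]; exact: gc].
have mg z : K z -> m <= g z by move=> Kz; apply: ge_inf; [case: hm|exists z].
pose F : set_system V := [set B | exists2 e : R, 0 < e & [set x | K x /\ g x < m + e] `<=` B].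
have FF : ProperFilter F.
  split.
    move=> [e e0] h.
    have [_ [z Kz <-] ze] := inf_adherent e0 hm.
    exact: (h z).
  split.
  - by exists 1.
  - move=> P Q [e e0 hP] [e' e'0 hQ]; exists (Num.min e e'); first by rewrite lt_min e0.
    move=> z [Kz gz]; split; [apply: hP|apply: hQ]; split => //;
      by rewrite (lt_le_trans gz)// lerD2l ge_min lexx ?orbT.
  - by move=> P Q PQ [e e0 h]; exists e => //; apply: subset_trans PQ.
have FK : F K by exists 1 => // z [].
have [p [Kp clp]] := cK F FF FK.
exists p => // z Kz.
rewrite leNgt; apply/negP => gzp.
have gpm : 0 < (g p - m) / 2 by have := mg _ Kz; lra.
have [w [[Kw gw] hw]] :
    [set x | K x /\ g x < m + (g p - m) / 2] `&` [set z | K z -> g p - (g p - m) / 2 < g z] !=set0.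
  by apply: clp; [exists ((g p - m) / 2)|exact: lsc].
by have := hw Kw; lra.
Qed.

Lemma within_continuous_dist {V W : normedModType R} (D : set V) (F : V -> W) :
  {within D, continuous F} -> forall z e, D z -> 0 < e ->
  \forall z' \near z, D z' -> `|F z - F z'| < e.
Proof.
move=> /subspace_continuousP cF z e Dz e0.
by have /cvgrPdist_lt/(_ e e0) := cF z Dz.
Qed.

End Topology.

(** * Measurability of continuous functions of measurable paths *)

Section MeasurableComposition.
Context {R : realType} {n m : nat}.

(* Over the reals the Borel sets of a product of spaces ['rV_n] are not in the
   library: rational boxes reduce the composition to countable unions. *)
Lemma measurable_comp_continuous (A : set 'rV[R]_m) (F : 'rV[R]_n * 'rV[R]_m -> R)
    (D : set R) (y : R -> 'rV[R]_n) (alpha : R -> 'rV[R]_m) :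
  {within [set: 'rV[R]_n] `*` A, continuous F} ->
  measurable D ->
  (forall i, measurable_fun D (fun s => y s 0 i)) ->
  (forall j, measurable_fun D (fun s => alpha s 0 j)) ->
  (forall s, D s -> A (alpha s)) ->
  measurable_fun D (fun s => F (y s, alpha s)).
Proof.
move=> cF mD my malpha Aalpha _; apply: (measurability _ (RGenOInfty.measurableE R)) => //.
move=> /= _ [_ [a ->] <-]; rewrite preimage_itvoy.
pose box (q : 'rV[rat]_n * 'rV[rat]_m * nat) : set ('rV[R]_n * 'rV[R]_m) :=
  [set z : 'rV[R]_n * 'rV[R]_m | (forall i, `|z.1 0 i - ratr (q.1.1 0 i)| < q.2.+1%:R^-1) /\
           (forall j, `|z.2 0 j - ratr (q.1.2 0 j)| < q.2.+1%:R^-1)].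
(* A box is good if [F] exceeds [a] on its part over [A]; the superlevel set is the union of the
   preimages of the countably many good boxes. *)
pose good := [set q | forall z, box q z -> A z.2 -> a < F z].
pose E q := if q \in good then D `&` [set s | box q (y s, alpha s)] else set0.
have -> : D `&` [set s | a < F (y s, alpha s)] = \bigcup_q E q.
  apply/seteqP; split => [s [Ds /= aF]|s [q _]]; last first.
    rewrite /E; case: ifPn => //; rewrite inE => gq [Ds bs]; split => //=.
    by apply: gq => //; exact: Aalpha.
  have e0 : 0 < F (y s, alpha s) - a by rewrite subr_gt0.
  have Dz : ([set: 'rV[R]_n] `*` A) (y s, alpha s) by split => //=; exact: Aalpha.
  have /nbhs_ballP[d /= d0 hd] := within_continuous_dist cF Dz e0.
  (* Two points of one box differ by less than twice its radius, hence [d / 2]. *)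
  have [k kd] : exists k : nat, k.+1%:R^-1 < d / 2.
    exists (Num.truncn ((d / 2)^-1)).
    by rewrite invf_plt ?posrE ?divr_gt0// truncnS_gt.
  have [del delE] : exists del : R, del = k.+1%:R^-1 by exists (k.+1%:R^-1).
  have k0 : 0 < del by rewrite delE invr_gt0.
  rewrite -delE in kd.
  have ratd (r : R) : exists q : rat, `|r - ratr q| < del.
    have : r - del < r + del by lra.
    move=> /rat_in_itvoo[q]; rewrite in_itv/= => /andP[q1 q2]; exists q.
    by rewrite ltr_norml; apply/andP; split; lra.
  have /choice[q1 hq1] := fun i => ratd (y s 0 i).
  have /choice[q2 hq2] := fun j => ratd (alpha s 0 j).
  exists (\row_i q1 i, \row_j q2 j, k) => //.
  have bs : box (\row_i q1 i, \row_j q2 j, k) (y s, alpha s).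
    by split => i; rewrite mxE -delE.
  rewrite /E mem_set//; move=> z [b1 b2] Az.
  have bz : ball (y s, alpha s) d z.
    split => /=.
      rewrite -ball_normE /ball_/= (@le_lt_trans _ _ (2 * del))//; last by lra.
      apply: norm_rV_le => [|i]; first by rewrite mulr_ge0// ltW.
      rewrite !mxE; have := b1 i; have := hq1 i; rewrite !mxE/= -delE => h1 h2.
      rewrite (_ : _ - _ = (y s 0 i - ratr (q1 i)) - (z.1 0 i - ratr (q1 i))); last by ring.
      by rewrite (le_trans (ler_normB _ _))// mulrDl mul1r lerD// ltW.
    rewrite -ball_normE /ball_/= (@le_lt_trans _ _ (2 * del))//; last by lra.
    apply: norm_rV_le => [|i]; first by rewrite mulr_ge0// ltW.
    rewrite !mxE; have := b2 i; have := hq2 i; rewrite !mxE/= -delE => h1 h2.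
    rewrite (_ : _ - _ = (alpha s 0 i - ratr (q2 i)) - (z.2 0 i - ratr (q2 i))); last by ring.
    by rewrite (le_trans (ler_normB _ _))// mulrDl mul1r lerD// ltW.
  have := hd z bz (conj I Az); rewrite ltr_norml => /andP[_]; lra.
apply: countable_bigcupT_measurable; first exact: countableP.
move=> q; rewrite /E; case: ifPn => // _.
have -> : D `&` [set s | box q (y s, alpha s)] =
   (D `&` \bigcap_(i in [set: 'I_n]) (D `&` [set s | `|y s 0 i - ratr (q.1.1 0 i)| < q.2.+1%:R^-1])) `&`
   (D `&` \bigcap_(j in [set: 'I_m]) (D `&` [set s | `|alpha s 0 j - ratr (q.1.2 0 j)| < q.2.+1%:R^-1])).
  apply/seteqP; split => [s [Ds [b1 b2]]|s [[Ds b1] [_ b2]]].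
    split; (split; first exact: Ds); move=> i _; (split; first exact: Ds);
      [exact: b1|exact: b2].
  by split => //; split => i; [case: (b1 i)|case: (b2 i)].
have mlt (u : R -> R) (c d : R) : measurable_fun D u -> measurable (D `&` [set s | `|u s - c| < d]).
  move=> mu; have mu' : measurable_fun D (fun s => `|u s - c|).
    by apply: measurableT_comp => //; exact: measurable_funB.
  have := mu' mD `]-oo, d[%classic (measurable_itv _).
  by congr measurable; apply/seteqP; split => s [Ds /=]; rewrite in_itv.
by apply: measurableI; (apply: measurableI => //; apply: fin_bigcap_measurable;
  [exact: finite_finset|move=> i _; exact: mlt]).
Qed.

End MeasurableComposition.

(** * Trajectories *)

Section Paths.
Context {R : realType} {n : nat}.
Implicit Types (y z : R -> 'rV[R]_n) (G : R -> 'rV[R]_n) (g : R -> R).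
Local Notation half_line := (`[0%R, +oo[%classic : set R).

(** Spliced controls agree with the first control only strictly before the switching time, so
    nothing can be asked at the right end point. *)
Lemma RI_eqo g g' (a b : R) : locbm g -> locbm g' -> 0 <= a ->
  (forall s, a <= s < b -> g s = g' s) -> RI g a b = RI g' a b.
Proof.
move=> lg lg' a0 gg; rewrite /RI -!Rintegral_itv_bndo_bndc.
- by apply: eq_Rintegral => s; rewrite inE/= in_itv/=; exact: gg.
- apply: integrableS (locbm_integrable b lg' a0) => //.
  by apply: subset_itvl; rewrite bnd_simp.
- apply: integrableS (locbm_integrable b lg a0) => //.
  by apply: subset_itvl; rewrite bnd_simp.
Qed.

Definition loclip y := forall b : R, exists C : R, forall s t, 0 <= s -> s <= t -> t <= b ->
  `|y t - y s| <= C * (t - s).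

Lemma loclip_continuous y : loclip y -> {within half_line, continuous y}.
Proof.
move=> ly; apply/subspace_continuousP => t /=; rewrite in_itv/= andbT => t0.
apply/cvgrPdist_lt => e e0.
have [C hC] := ly (t + 1).
have C0 : 0 < `|C| + 1 by rewrite ltr_pwDr.
have d0 : 0 < Num.min 1 (e / (`|C| + 1)) by rewrite lt_min ltr01 divr_gt0.
rewrite near_withinE; near=> s => /=; rewrite in_itv/= andbT => s0.
have : `|t - s| < Num.min 1 (e / (`|C| + 1)).
  by near: s; apply: (@cvgr_dist_lt _ _ _ _ _ id).
rewrite lt_min => /andP[ts1 tse].
rewrite (@le_lt_trans _ _ ((`|C| + 1) * `|t - s|))//; last first.
  by rewrite mulrC -ltr_pdivlMr.
have CC : C <= `|C| + 1 by rewrite (le_trans (ler_norm C))// lerDl.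
have [st|/ltW ts] := leP s t.
  rewrite [`|t - s|]ger0_norm ?subr_ge0// (le_trans (hC s t s0 st _))//; first by rewrite lerDl.
  by rewrite ler_wpM2r// subr_ge0.
rewrite distrC [`|t - s|]distrC [`|s - t|]ger0_norm ?subr_ge0//.
rewrite (le_trans (hC t s t0 ts _))//; last by rewrite ler_wpM2r// subr_ge0.
by move: ts1; rewrite distrC ltr_norml => /andP[_]; lra.
Unshelve. all: by end_near. Qed.

Lemma continuous_norm_bounded y : {within half_line, continuous y} ->
  forall b : R, exists2 C : R, 0 <= C & forall s, 0 <= s <= b -> `|y s| <= C.
Proof.
move=> cy b; have [b0|b0] := leP 0 b; last first.
  by exists 0 => // s /andP[s0 sb]; have := lt_le_trans b0 (le_trans s0 sb); rewrite ltxx.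
have cyn : {within `[0, b], continuous (fun s => `|y s|)}.
  have : {within half_line, continuous (fun s => `|y s|)}.
    by move=> s; apply: continuous_comp; [exact: cy|exact: norm_continuous].
  by apply: continuous_subspaceW => s /=; rewrite !in_itv/= andbT => /andP[].
have [c _ hc] := EVT_max b0 cyn.
by exists `|y c| => // s sb; apply: hc; rewrite in_itv.
Qed.

Lemma locbm_of_continuous g : {within half_line, continuous g} -> locbm g.
Proof.
move=> cg; split; first by apply: subspace_continuous_measurable_fun.
move=> b; have [b0|b0] := leP 0 b; last first.
  by exists 0 => s /andP[s0 sb]; have := lt_le_trans b0 (le_trans s0 sb); rewrite ltxx.
have cyn : {within `[0, b], continuous (fun s => `|g s|)}.
  have : {within half_line, continuous (fun s => `|g s|)}.
    by move=> s; apply: continuous_comp; [exact: cg|exact: norm_continuous].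
  by apply: continuous_subspaceW => s /=; rewrite !in_itv/= andbT => /andP[].
have [c _ hc] := EVT_max b0 cyn.
by exists `|g c| => // s sb; apply: hc; rewrite in_itv.
Qed.

Lemma locbm_norm_path y : {within half_line, continuous y} -> locbm (fun s => `|y s|).
Proof.
move=> cy; apply: locbm_of_continuous.
by move=> s; apply: continuous_comp; [exact: cy|exact: norm_continuous].
Qed.

Lemma locbm_coord y i : {within half_line, continuous y} -> locbm (fun s => y s 0 i).
Proof.
move=> cy; apply: locbm_of_continuous.
move=> s; apply: (@continuous_comp _ _ _ _ (fun v : 'rV[R]_n => v 0 i)).
  exact: cy.
exact: coord_continuous.
Qed.

Definition vRI G (a b : R) : 'rV[R]_n := \row_i RI (fun s => G s 0 i) a b.

Lemma vRI_norm_le G g (a b : R) : (forall i, locbm (fun s => G s 0 i)) -> locbm g ->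
  0 <= a -> a <= b -> (forall s, a <= s <= b -> `|G s| <= g s) -> `|vRI G a b| <= RI g a b.
Proof.
move=> lG lg a0 ab Gg; apply: norm_rV_le => [|i].
  by apply: RI_ge0 => s sab; rewrite (le_trans _ (Gg s sab)).
rewrite mxE (le_trans (RI_abs _ (lG i) a0))//; apply: RI_le => //.
  exact: locbm_norm.
by move=> s sab; rewrite (le_trans (coord_le_norm _ _))// Gg.
Qed.

Lemma vRI_add G (a b c : R) : (forall i, locbm (fun s => G s 0 i)) ->
  0 <= a -> a <= b -> b <= c -> vRI G a c = vRI G a b + vRI G b c.
Proof. by move=> lG a0 ab bc; apply/rowP => i; rewrite !mxE -RI_add. Qed.

Lemma vRI_sub G (H : R -> 'rV[R]_n) (a b : R) : (forall i, locbm (fun s => G s 0 i)) ->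
  (forall i, locbm (fun s => H s 0 i)) -> 0 <= a ->
  vRI (fun s => G s - H s) a b = vRI G a b - vRI H a b.
Proof.
move=> lG lH a0; apply/rowP => i; rewrite !mxE -RIB//.
by apply: RI_eq => s _; rewrite !mxE.
Qed.

Lemma vRI_loclip x G : (forall i, locbm (fun s => G s 0 i)) ->
  loclip (fun t => x + vRI G 0 t).
Proof.
move=> lG b.
have /choice[C hC] := fun i => (lG i).2 b.
exists (\sum_i `|C i|) => s t s0 st tb.
rewrite (@vRI_add G 0 s t)// opprD addrACA subrr add0r addrAC subrr add0r.
rewrite -RI_cst//; apply: vRI_norm_le => //; first exact: locbm_cst.
move=> u /andP[su ut]; apply: norm_rV_le => [|i].
  by apply: sumr_ge0.
rewrite (le_trans (hC i u _))//; first by rewrite (le_trans s0)//= (le_trans ut).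
rewrite (bigD1 i)//= (le_trans (ler_norm _))// lerDl.
by apply: sumr_ge0.
Qed.

Lemma geometric_limit (u : nat -> R) (c : R) :
  (forall k, `|u k.+1 - u k| <= c * 2^-1 ^+ k) ->
  forall k, `|u k - lim (u @ \oo)| <= 2 * c * 2^-1 ^+ k.
Proof.
move=> hu.
have c0 : 0 <= c by have := hu 0; rewrite expr0 mulr1; exact: le_trans.
have dec k j : `|u (k + j)%N - u k| <= 2 * c * (2^-1 ^+ k - 2^-1 ^+ (k + j)).
  elim: j => [|j IH]; first by rewrite addn0 !subrr normr0 mulr0.
  rewrite addnS (_ : _ - _ = (u (k + j).+1 - u (k + j)%N) + (u (k + j)%N - u k)); last by ring.
  rewrite (le_trans (ler_normD _ _))//.
  rewrite (le_trans (lerD (hu _) IH))// [in leRHS]exprS.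
  by lra.
have gt0 k : 0 <= 2^-1 ^+ k :> R by rewrite exprn_ge0// invr_ge0.
have geo : (fun k => 2 * c * 2^-1 ^+ k : R) @ \oo --> (0 : R).
  rewrite -[X in _ --> X](mulr0 (2 * c)); apply: cvgMr.
  by apply: cvg_expr; rewrite ger0_norm ?invr_ge0// invf_lt1// ltr1n.
have cvgu : cvg (u @ \oo).
  apply/cauchy_cvgP; apply/cauchyP => e e0.
  have /cvgrPdist_lt/(_ e e0)[k _ /(_ k (leqnn k))] := geo.
  rewrite sub0r normrN ger0_norm; last by rewrite !mulr_ge0.
  move=> hk; exists (u k); exists k => //= j kj.
  rewrite -ball_normE /ball_/= distrC -(subnKC kj) (le_lt_trans (dec _ _))//.
  rewrite (le_lt_trans _ hk)// ler_wpM2l ?mulr_ge0//.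
  by rewrite gerBl.
move=> k; have : (fun j => `|u k - u (k + j)%N|) @ \oo --> `|u k - lim (u @ \oo)|.
  apply: cvg_norm; apply: cvgB; first exact: cvg_cst.
  have -> : (fun j => u (k + j)%N) = (fun j => u (j + k)%N).
    by apply/funext => j; rewrite addnC.
  by rewrite (cvg_shiftn k u).
move=> hl; apply: (cvgr_to_le hl); near=> j; rewrite distrC (le_trans (dec _ _))// ler_wpM2l ?mulr_ge0//.
by rewrite gerBl.
Unshelve. all: by end_near. Qed.

End Paths.

(** * Bounds on the data and existence of trajectories *)

Section ControlSystem.
Context {R : realType} {n m : nat}.
Implicit Types (f : 'rV[R]_n -> 'rV[R]_m -> 'rV[R]_n)
  (l : 'rV[R]_n -> 'rV[R]_m -> R) (A : set 'rV[R]_m)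
  (x : 'rV[R]_n) (alpha beta : R -> 'rV[R]_m) (y : R -> 'rV[R]_n).
Local Notation half_line := (`[0%R, +oo[%classic : set R).

(* The standing assumptions on the data, with the sup-norm in place of the
   Euclidean one. *)
Record control_system A f l : Prop := ControlSystem {
  cs_compact : compact A;
  cs_nonempty : A !=set0;
  cs_contf : {within [set: 'rV[R]_n] `*` A, continuous (fun z => f z.1 z.2)};
  cs_contl : {within [set: 'rV[R]_n] `*` A, continuous (fun z => l z.1 z.2)};
  cs_cost_ge0 : forall x a, A a -> 0 <= l x a;
  cs_growth : exists2 M : R, 0 < M & forall x a, A a -> `|f x a| <= M * (1 + `|x|);
  cs_lipschitz : forall r : R, exists2 L : R, 0 < L &
     forall x1 x2 a, `|x1| <= r -> `|x2| <= r -> A a ->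
       `|f x1 a - f x2 a| <= L * `|x1 - x2| /\
       `|l x1 a - l x2 a| <= L * `|x1 - x2| }.

(** The Euclidean norm is at most [n.+1%:R] times the sup-norm; [n.+1] in place of [n] keeps the new
    constants positive in dimension 0. *)
Lemma standing_control_system A T f l : standing_assumptions A T f l ->
  control_system A f l.
Proof.
move=> [[cA A0] _ [cf cl] l0 [[M M0 hM] hL]]; split => //.
  exists (M * n.+1%:R) => [|x a Aa]; first by rewrite mulr_gt0.
  rewrite (le_trans (norm_le_enorm _))// (le_trans (hM x a Aa))//.
  rewrite -mulrA ler_pM2l// mulrDr mulr1 lerD ?enorm_le_norm//.
  by rewrite ler1n.
move=> r; have r0 : 0 < n.+1%:R * (`|r| + 1) by rewrite mulr_gt0// ltr_wpDl.
have [L L0 h] := hL _ r0; exists (L * n.+1%:R) => [|x1 x2 a x1r x2r Aa].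
  by rewrite mulr_gt0.
have er (x : 'rV[R]_n) : `|x| <= r -> enorm x <= n.+1%:R * (`|r| + 1).
  move=> xr; rewrite (le_trans (enorm_le_norm _))// ler_pM2l// (le_trans xr)//.
  by rewrite (le_trans (ler_norm r))// lerDl.
have [h1 h2] := h x1 x2 a (er _ x1r) (er _ x2r) Aa.
rewrite -mulrA; split.
  rewrite (le_trans (norm_le_enorm _))// (le_trans h1)// ler_pM2l//.
  exact: enorm_le_norm.
by rewrite (le_trans h2)// ler_pM2l// enorm_le_norm.
Qed.

Variables (A : set 'rV[R]_m) (f : 'rV[R]_n -> 'rV[R]_m -> 'rV[R]_n)
  (l : 'rV[R]_n -> 'rV[R]_m -> R).
Hypothesis cs : control_system A f l.

(** Compactness of [A] bounds [l] at [x = 0], and the Lipschitz constant, uniform in [a], carries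
    the bound to the ball. *)
Lemma running_cost_bounded (r : R) :
  exists2 C : R, 0 <= C & forall x a, `|x| <= r -> A a -> l x a <= C.
Proof.
have [a0 Aa0] := cs_nonempty cs.
have [L L0 hL] := cs_lipschitz cs `|r|.
have [a1 Aa1 ha1] : exists2 a1, A a1 & forall a, A a -> - l 0 a1 <= - l 0 a.
  have la e a : 0 < e -> A a -> \forall a' \near a, A a' -> `|l 0 a - l 0 a'| < e.
    move=> e0 Aa.
    have [[P1 P2] /= [hP1 hP2] hP] :=
      within_continuous_dist (cs_contl cs) (z := (0, a)) (conj I Aa) e0.
    apply: filterS hP2 => a' P2a' Aa'.
    by apply: (hP (0, a')); split => //; exact: nbhs_singleton.
  have [c hc] : exists c : R, forall a, A a -> c <= - l 0 a.
    pose F (c : R) := [set a | A a /\ - l 0 a < c].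
    (* Otherwise all sublevel sets of [- l 0] are nonempty and generate a proper filter on [A],
       which contradicts continuity at a cluster point. *)
    apply: contrapT => /forallNP hn.
    pose FF : set_system 'rV[R]_m := [set B | exists c, F c `<=` B].
    have PF : ProperFilter FF.
      split; first by move=> [c hc]; apply: (hn c) => a Aa; rewrite leNgt; apply/negP => h; exact: (hc a).
      split.
      - by exists 0.
      - move=> P Q [c hP] [d hQ]; exists (Num.min c d) => a [Aa].
        by rewrite lt_min => /andP[h1 h2]; split; [exact: hP|exact: hQ].
      - by move=> P Q PQ [c h]; exists c; apply: subset_trans PQ.
    have FA : FF A by exists 0 => a [].
    have [p [Ap clp]] := cs_compact cs PF FA.
    have [w [[Aw h1] h2]] := clp _ _ (ex_intro _ (- l 0 p - 1) (@subset_refl _ _)) (la 1 p ltr01 Ap).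
    by have := h2 Aw; rewrite ltr_norml => /andP[]; lra.
  apply: (lsc_min (cs_compact cs) _ hc); first by exists a0.
  move=> p e Ap e0; apply: filterS (la e p e0 Ap) => a' h Aa'.
  by have := h Aa'; rewrite ltr_norml => /andP[]; lra.
exists (`|l 0 a1| + L * `|r|) => [|x a xr Aa].
  by rewrite addr_ge0// mulr_ge0// ltW.
have := (hL x 0 a _ _ Aa).2; rewrite normr0 subr0 => h.
have {}h : `|l x a - l 0 a| <= L * `|x|.
  by apply: h => //; rewrite (le_trans xr)// ler_norm.
have h2 : L * `|x| <= L * `|r| by rewrite ler_pM2l// (le_trans xr)// ler_norm.
have := ha1 a Aa; have := ler_norm (l 0 a1).
by move: h; rewrite ler_norml => /andP[_]; lra.
Qed.

Lemma locbm_field alpha y : control A alpha -> {within half_line, continuous y} ->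
  (forall i, locbm (fun s => f (y s) (alpha s) 0 i)) /\
  locbm (fun s => l (y s) (alpha s)).
Proof.
move=> [Aalpha malpha] cy.
have [M M0 hM] := cs_growth cs.
have Aal s : half_line s -> A (alpha s) by rewrite /= in_itv/= andbT; exact: Aalpha.
split.
  move=> i; split.
    have ci : {within [set: 'rV[R]_n] `*` A, continuous (fun z => f z.1 z.2 0 i)}.
      move=> u; apply: (@continuous_comp _ _ _ _ (fun v : 'rV[R]_n => v 0 i)).
        exact: (cs_contf cs).
      exact: coord_continuous.
    apply: (measurable_comp_continuous ci) => // j.
    exact: (locbm_coord j cy).1.
  move=> b; have [C C0 hC] := continuous_norm_bounded cy b.
  exists (M * (1 + C)) => s /[dup] sb /andP[s0 _].
  rewrite (le_trans (coord_le_norm _ _))// (le_trans (hM _ _ (Aalpha s s0)))//.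
  by rewrite ler_pM2l// lerD2l hC.
split.
  apply: (measurable_comp_continuous (cs_contl cs)) => // j.
  exact: (locbm_coord j cy).1.
move=> b; have [C C0 hC] := continuous_norm_bounded cy b.
have [D D0 hD] := running_cost_bounded C.
exists D => s /[dup] sb /andP[s0 _].
by rewrite ger0_norm ?(cs_cost_ge0 cs) ?hD ?hC//; exact: Aalpha.
Qed.

Lemma is_trajectoryP x alpha y : is_trajectory f x alpha y <->
  {within half_line, continuous y} /\
  forall t, 0 <= t -> y t = x + vRI (fun s => f (y s) (alpha s)) 0 t.
Proof.
split=> -[cy h]; split=> // t t0.
  by apply/rowP => i; rewrite !mxE h.
by move=> i; rewrite [in LHS]h// !mxE.
Qed.

Fixpoint picard x alpha k : R -> 'rV[R]_n :=
  if k is k'.+1 then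
    fun t => x + vRI (fun s => f (picard x alpha k' s) (alpha s)) 0 t
  else fun=> x.

Lemma picard_continuous x alpha k : control A alpha ->
  {within half_line, continuous (picard x alpha k)}.
Proof.
move=> ca; elim: k => [|k IH] /=; first by apply: continuous_subspaceT => ?; exact: cst_continuous.
by apply/loclip_continuous/vRI_loclip; exact: (locbm_field ca IH).1.
Qed.

(** With the rate [2 * M], the integral of the bound for the previous iterate contributes only half
    of the exponential, so the bound reproduces itself. *)
Lemma picard_bound x alpha k (t M : R) : control A alpha -> 0 < M ->
  (forall x a, A a -> `|f x a| <= M * (1 + `|x|)) -> 0 <= t ->
  1 + `|picard x alpha k t| <= (1 + `|x|) * expR (2 * M * t).
Proof.
move=> ca M0 hM; elim: k t => [|k IH] t t0 /=.
  by rewrite ler_peMr// -expR0 ler_expR !mulr_ge0// ltW.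
have lexp : locbm (fun s => expR (2 * M * s)).
  apply: locbm_of_continuous; apply: continuous_subspaceT => s.
  apply: continuous_comp; last exact: continuous_expR.
  by apply: cvgM; [exact: cvg_cst|exact: cvg_id].
have : `|vRI (fun s => f (picard x alpha k s) (alpha s)) 0 t| <=
       RI (fun s => (M * (1 + `|x|)) * expR (2 * M * s)) 0 t.
  apply: vRI_norm_le => //.
  - exact: (locbm_field ca (@picard_continuous x alpha k ca)).1.
  - exact: locbmZ.
  - move=> s /andP[s0 _]; rewrite (le_trans (hM _ _ (ca.1 _ s0)))//.
    by rewrite -mulrA ler_pM2l// IH.
rewrite RIZ// RI_expR// => h.
have h1 : M * (1 + `|x|) * ((expR (2 * M * t) - 1) / (2 * M)) =
  (1 + `|x|) * (expR (2 * M * t) - 1) / 2 by field; rewrite gt_eqF.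
rewrite h1 in h; have := ler_normD x (vRI (fun s => f (picard x alpha k s) (alpha s)) 0 t).
have : 1 <= expR (2 * M * t) by rewrite -expR0 ler_expR !mulr_ge0// ltW.
have := normr_ge0 x.
set e := expR _ in h *; set X := `|x| in h *; nra.
Qed.

(** Picard iterates stay in a ball depending only on the time, so a local Lipschitz constant [Lf b]
    is enough; with the weight [expR (- (2 * Lf b * t))] the Picard map halves distances. *)
Lemma trajectory_exists x alpha : control A alpha -> exists y, is_trajectory f x alpha y.
Proof.
move=> ca; have [M M0 hM] := cs_growth cs.
pose B (b : R) := (1 + `|x|) * expR (2 * M * b).
pose Y := picard x alpha.
have YB k t b : 0 <= t -> t <= b -> `|Y k t| <= B b.
  move=> t0 tb; have := picard_bound x k ca M0 hM t0; rewrite -/Y => h.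
  have : (1 + `|x|) * expR (2 * M * t) <= B b.
    by rewrite ler_pM2l ?ler_expR ?ler_pM2l ?mulr_gt0// ltr_pwDl.
  by move: h; lra.
have /choice[Lf hLf] : forall b, exists L : R, 0 < L /\
   forall x1 x2 a, `|x1| <= B b -> `|x2| <= B b -> A a -> `|f x1 a - f x2 a| <= L * `|x1 - x2|.
  move=> b; have [L L0 hL] := cs_lipschitz cs (B b); exists L; split => // x1 x2 a h1 h2 Aa.
  by have [] := hL x1 x2 a h1 h2 Aa.
pose E b := expR (2 * Lf b * b).
have lf k := (locbm_field ca (@picard_continuous x alpha k ca)).1.
have B0 b : 0 <= B b by rewrite mulr_ge0 ?expR_ge0// addr_ge0.
have dY b k t : 0 <= t -> t <= b ->
    `|Y k.+1 t - Y k t| <= (2 * B b) * 2^-1 ^+ k * expR (2 * Lf b * t).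
  have [L0 hL] := hLf b.
  have e1 s : 0 <= s -> 1 <= expR (2 * Lf b * s).
    by move=> s0; rewrite -expR0 ler_expR !mulr_ge0// ltW.
  elim: k t => [|k IH] t t0 tb.
    rewrite expr0 mulr1 (le_trans (ler_normB _ _))//.
    have := YB 1 t b t0 tb; have := YB 0 t b t0 tb; have := e1 t t0; have := B0 b.
    set e := expR _; set u := `|Y 0 t|; set v := `|Y 1 t|; nra.
  have lexp : locbm (fun s => expR (2 * Lf b * s)).
    apply: locbm_of_continuous; apply: continuous_subspaceT => s.
    apply: continuous_comp; last exact: continuous_expR.
    by apply: cvgM; [exact: cvg_cst|exact: cvg_id].
  have -> : Y k.+2 t - Y k.+1 t =
     vRI (fun s => f (Y k.+1 s) (alpha s) - f (Y k s) (alpha s)) 0 t.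
    rewrite (vRI_sub t (lf k.+1) (lf k))// /Y/=.
    by rewrite opprD addrACA subrr add0r.
  apply: (@le_trans _ _ (RI (fun s => (Lf b * (2 * B b * 2^-1 ^+ k)) * expR (2 * Lf b * s)) 0 t)).
    apply: vRI_norm_le => //.
    - move=> i; have := locbmD (lf k.+1 i) (locbmN (lf k i)).
      by congr locbm; apply/funext => s; rewrite !mxE.
    - exact: locbmZ.
    - move=> s /andP[s0 st]; rewrite (le_trans (hL _ _ _ _ _ _))//.
      + by apply: YB => //; exact: le_trans tb.
      + by apply: YB => //; exact: le_trans tb.
      + exact: ca.1.
      + by rewrite -[leRHS]mulrA ler_pM2l//; apply: IH => //; exact: le_trans tb.
  rewrite RIZ// RI_expR//.
  have -> : Lf b * (2 * B b * 2^-1 ^+ k) * ((expR (2 * Lf b * t) - 1) / (2 * Lf b)) =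
    2 * B b * 2^-1 ^+ k.+1 * (expR (2 * Lf b * t) - 1).
    by rewrite exprS; field; rewrite gt_eqF.
  by rewrite ler_wpM2l ?gerBl// !mulr_ge0// exprn_ge0// invr_ge0.
have E1 b t : 0 <= t -> t <= b -> expR (2 * Lf b * t) <= E b.
  by move=> t0 tb; rewrite ler_expR ler_pM2l// mulr_gt0//; have [] := hLf b.
pose y t : 'rV[R]_n := \row_i lim ((fun k => Y k t 0 i) @ \oo).
have Yy b k t : 0 <= t -> t <= b -> `|Y k t - y t| <= 2 * (2 * B b * E b) * 2^-1 ^+ k.
  move=> t0 tb; apply: norm_rV_le => [|i].
    by rewrite !mulr_ge0 ?expR_ge0// exprn_ge0// invr_ge0.
  rewrite !mxE; apply: geometric_limit => j.
  have := coord_le_norm (Y j.+1 t - Y j t) i; rewrite !mxE => /le_trans; apply.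
  rewrite (le_trans (dY b j t t0 tb))// -mulrA [2^-1 ^+ j * _]mulrC mulrA.
  rewrite ler_wpM2r ?exprn_ge0 ?invr_ge0// ler_wpM2l ?mulr_ge0//.
  exact: E1.
(* All statements about the limit are proved up to a multiple of [2^-1 ^+ k], which is removed here
   once and for all. *)
have small (c d : R) : (forall k, d <= c * 2^-1 ^+ k) -> d <= 0.
  move=> h; have c0 : 0 <= `|c| + 1 by rewrite addr_ge0.
  rewrite leNgt; apply/negP => d0.
  have geo : (fun k => c * 2^-1 ^+ k : R) @ \oo --> (0 : R).
    rewrite -[X in _ --> X](mulr0 c); apply: cvgMr.
    by apply: cvg_expr; rewrite ger0_norm ?invr_ge0// invf_lt1// ltr1n.
  have /cvgrPdist_lt/(_ d d0)[k _ /(_ k (leqnn k))] := geo.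
  rewrite sub0r normrN => /(le_lt_trans (ler_norm _))/(le_lt_trans (h k)).
  by rewrite ltxx.
have yB t b : 0 <= t -> t <= b -> `|y t| <= B b.
  move=> t0 tb; rewrite -subr_le0; apply: (small (2 * (2 * B b * E b))) => k.
  have := Yy b k t t0 tb; have := YB k t b t0 tb.
  have := ler_normD (Y k t) (y t - Y k t); rewrite subrKC distrC; lra.
have ly : loclip y.
  move=> b; exists (M * (1 + B b)) => s t s0 st tb.
  rewrite -subr_le0; apply: (small (2 * (2 * (2 * B b * E b)))) => k.
  have h1 := Yy b k.+1 t (le_trans s0 st) tb.
  have h2 := Yy b k.+1 s s0 (le_trans st tb).
  have h3 : `|Y k.+1 t - Y k.+1 s| <= M * (1 + B b) * (t - s).
    rewrite /Y /= (vRI_add (lf k) (lexx 0) s0 st) opprD addrACA subrr add0r addrAC subrr add0r.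
    rewrite -RI_cst//; apply: vRI_norm_le => //; first exact: locbm_cst.
    move=> u /andP[su ut]; rewrite (le_trans (hM _ _ (ca.1 _ (le_trans s0 su))))//.
    rewrite ler_pM2l// lerD2l; apply: YB; first exact: le_trans su.
    exact: le_trans tb.
  have h4 : `|y t - y s| <= `|Y k.+1 t - Y k.+1 s| + `|Y k.+1 t - y t| + `|Y k.+1 s - y s|.
    rewrite (_ : y t - y s = (Y k.+1 t - Y k.+1 s) - (Y k.+1 t - y t) + (Y k.+1 s - y s)).
      rewrite (le_trans (ler_normD _ _))// lerD2r; exact: ler_normB.
    by apply/rowP => i; rewrite !mxE; ring.
  have h5 : 2 * (2 * B b * E b) * 2^-1 ^+ k.+1 <= 2 * (2 * B b * E b) * 2^-1 ^+ k.
    rewrite ler_wpM2l ?mulr_ge0 ?expR_ge0// exprS ler_piMl ?exprn_ge0 ?invr_ge0//.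
    by rewrite invf_le1// ler1n.
  lra.
have cy := loclip_continuous ly.
have lfy := (locbm_field ca cy).1.
exists y; apply/is_trajectoryP; split => // t t0.
apply/eqP; rewrite -subr_eq0 -normr_eq0 eq_le normr_ge0 andbT.
have [L0 hL] := hLf t.
apply: (small (2 * (2 * B t * E t) + Lf t * (2 * (2 * B t * E t)) * t)) => k.
have h1 := Yy t k.+1 t t0 (lexx t).
have h2 : `|vRI (fun s => f (Y k s) (alpha s)) 0 t - vRI (fun s => f (y s) (alpha s)) 0 t| <=
   Lf t * (2 * (2 * B t * E t)) * 2^-1 ^+ k * t.
  rewrite -(vRI_sub t (lf k) lfy)// -[X in _ * X]subr0 -RI_cst//.
  apply: vRI_norm_le => //; last 2 first.
  - exact: locbm_cst.
  - move=> s /andP[s0 st]; rewrite (le_trans (hL _ _ _ _ _ _))//.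
    + exact: YB.
    + exact: yB.
    + exact: ca.1.
    + by rewrite -[leRHS]mulrA ler_pM2l//; exact: Yy.
  move=> i; have := locbmD (lf k i) (locbmN (lfy i)).
  by congr locbm; apply/funext => s; rewrite !mxE.
have h4 : `|y t - (x + vRI (fun s => f (y s) (alpha s)) 0 t)| <=
   `|Y k.+1 t - y t| + `|vRI (fun s => f (Y k s) (alpha s)) 0 t - vRI (fun s => f (y s) (alpha s)) 0 t|.
  rewrite -[`|Y _ _ - _|]normrN (le_trans _ (ler_normD _ _))// le_eqVlt; apply/orP; left.
  by apply/eqP; congr `|_|; apply/rowP => i; rewrite !mxE; ring.
have h5 : 2 * (2 * B t * E t) * 2^-1 ^+ k.+1 <= 2 * (2 * B t * E t) * 2^-1 ^+ k.
  rewrite ler_wpM2l ?mulr_ge0 ?expR_ge0// exprS ler_piMl ?exprn_ge0 ?invr_ge0//.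
  by rewrite invf_le1// ler1n.
rewrite mulrDl; lra.
Qed.

End ControlSystem.

(** * Uniqueness, time shift and concatenation of trajectories *)

Section Trajectories.
Context {R : realType} {n m : nat}.
Variables (A : set 'rV[R]_m) (f : 'rV[R]_n -> 'rV[R]_m -> 'rV[R]_n)
  (l : 'rV[R]_n -> 'rV[R]_m -> R).
Hypothesis cs : control_system A f l.
Implicit Types (x : 'rV[R]_n) (alpha beta : R -> 'rV[R]_m) (y z : R -> 'rV[R]_n)
  (r s t b : R).
Local Notation half_line := (`[0%R, +oo[%classic : set R).

Lemma locbm_fieldB alpha beta y z : control A alpha -> control A beta ->
  {within half_line, continuous y} -> {within half_line, continuous z} ->
  forall i, locbm (fun s => (f (y s) (alpha s) - f (z s) (beta s)) 0 i).
Proof.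
move=> ca cb cy cz i.
have := locbmD ((locbm_field cs ca cy).1 i) (locbmN ((locbm_field cs cb cz).1 i)).
by congr locbm; apply/funext => s; rewrite !mxE.
Qed.

Lemma continuous_pathB y z : {within half_line, continuous y} ->
  {within half_line, continuous z} -> {within half_line, continuous (y - z)}.
Proof. by move=> cy cz s; apply: (@continuousB _ _ (subspace half_line) y z s); [exact: cy|exact: cz]. Qed.

(** Gronwall's inequality without initial error. The controls may differ from [b] on, so that
    causality follows as well as uniqueness. *)
Lemma trajectory_local_uniqueness x alpha beta y z b :
  control A alpha -> control A beta ->
  {within half_line, continuous y} -> {within half_line, continuous z} ->
  (forall t, 0 <= t < b -> alpha t = beta t) ->
  (forall t, 0 <= t <= b -> y t = x + vRI (fun s => f (y s) (alpha s)) 0 t) ->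
  (forall t, 0 <= t <= b -> z t = x + vRI (fun s => f (z s) (beta s)) 0 t) ->
  forall t, 0 <= t <= b -> y t = z t.
Proof.
move=> ca cb cy cz ab hy hz t tb.
have [C C0 hC] := continuous_norm_bounded cy b.
have [D D0 hD] := continuous_norm_bounded cz b.
have [L L0 hL] := cs_lipschitz cs (C + D).
have lyz := locbm_norm_path (continuous_pathB cy cz).
have := @gronwall _ (fun s => `|(y - z) s|) 0 L b lyz L0 (lexx 0).
move=> /(_ _ t tb) h; apply/eqP; rewrite -subr_eq0 -normr_eq0 eq_le normr_ge0 andbT.
rewrite mulr0 mul0r in h; apply: h => {t tb} t /andP[t0 tb]; split => //.
rewrite add0r -RIZ// !fctE hy ?t0// hz ?t0//.
rewrite opprD addrACA subrr add0r.
have -> : vRI (fun s => f (z s) (beta s)) 0 t = vRI (fun s => f (z s) (alpha s)) 0 t.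
  apply/rowP => i; rewrite !mxE; apply: RI_eqo => //.
  - exact: (locbm_field cs cb cz).1.
  - exact: (locbm_field cs ca cz).1.
  - by move=> s /andP[s0 st]; rewrite ab// s0 (lt_le_trans st).
rewrite -(vRI_sub t (locbm_field cs ca cy).1 (locbm_field cs ca cz).1)//.
apply: vRI_norm_le => //; first exact: locbm_fieldB.
  exact: locbmZ.
move=> s /andP[s0 st].
have sb : 0 <= s <= b by rewrite s0 (le_trans st).
have [] // := hL (y s) (z s) (alpha s) _ _ (ca.1 _ s0).
  by rewrite (le_trans (hC _ sb))// lerDl.
by rewrite (le_trans (hD _ sb))// lerDr.
Qed.

Lemma trajectoryP x alpha : control A alpha -> is_trajectory f x alpha (trajectory f x alpha).
Proof.
move=> ca; have [y hy] := trajectory_exists cs x ca.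
exact: (@xgetI _ (fun=> x) [set y | is_trajectory f x alpha y] y hy).
Qed.

Lemma trajectory_continuous x alpha : control A alpha ->
  {within half_line, continuous (trajectory f x alpha)}.
Proof. by move=> ca; have [] := trajectoryP x ca. Qed.

Arguments trajectory_continuous x [alpha] _.

Lemma trajectoryE x alpha t : control A alpha -> 0 <= t ->
  trajectory f x alpha t = x + vRI (fun s => f (trajectory f x alpha s) (alpha s)) 0 t.
Proof. by move=> ca; have /is_trajectoryP[_] := trajectoryP x ca; exact. Qed.

Lemma trajectory0 x alpha : control A alpha -> trajectory f x alpha 0 = x.
Proof.
move=> ca; rewrite trajectoryE//; apply/rowP => i.
by rewrite !mxE RI_xx addr0.
Qed.

Lemma trajectory_unique x alpha y : control A alpha -> is_trajectory f x alpha y ->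
  forall t, 0 <= t -> y t = trajectory f x alpha t.
Proof.
move=> ca /is_trajectoryP[cy hy] t t0.
have tt : 0 <= t <= t by rewrite t0 lexx.
apply: (trajectory_local_uniqueness ca ca cy (trajectory_continuous x ca) _ _ _ tt) => //.
  by move=> s /andP[s0 _]; exact: hy.
by move=> s /andP[s0 _]; exact: trajectoryE.
Qed.

Lemma trajectory_causal x alpha beta b : control A alpha -> control A beta ->
  (forall t, 0 <= t < b -> alpha t = beta t) ->
  forall t, 0 <= t <= b -> trajectory f x alpha t = trajectory f x beta t.
Proof.
move=> ca cb ab; apply: (trajectory_local_uniqueness ca cb _ _ ab).
- exact: trajectory_continuous.
- exact: trajectory_continuous.
- by move=> t /andP[t0 _]; exact: trajectoryE.
- by move=> t /andP[t0 _]; exact: trajectoryE.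
Qed.

Lemma measurable_shift (g : R -> R) s : 0 <= s ->
  measurable_fun half_line g -> measurable_fun half_line (fun t => g (s + t)).
Proof.
move=> s0 mg; apply: (@measurable_comp _ _ _ _ _ _ half_line g) => //.
- by move=> _ [t /= + <-]; rewrite /= !in_itv/= !andbT; exact: addr_ge0.
- by apply: measurable_funD => //; exact: measurable_id.
Qed.

Lemma control_shift alpha s : 0 <= s -> control A alpha ->
  control A (fun t => alpha (s + t)).
Proof.
move=> s0 [Aa ma]; split; first by move=> t t0; apply: Aa; rewrite addr_ge0.
by move=> j; apply: (@measurable_shift (fun t => alpha t 0 j)).
Qed.

Lemma continuous_path_shift y s : 0 <= s -> {within half_line, continuous y} ->
  {within half_line, continuous (fun t => y (s + t))}.
Proof.
move=> s0 /subspace_continuousP cy; apply/subspace_continuousP => t /= t0.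
have st : half_line (s + t) by move: t0; rewrite /= !in_itv/= !andbT; exact: addr_ge0.
apply/cvgrPdist_lt => e e0.
have /cvgrPdist_lt/(_ e e0) := cy _ st.
rewrite !near_withinE => /nbhs_ballP[d /= d0 hd].
apply/nbhs_ballP; exists d => //= u tu u0; apply: hd.
  by move: tu; rewrite -!ball_normE /ball_/= opprD addrACA subrr add0r.
by move: u0; rewrite !in_itv/= !andbT; exact: addr_ge0.
Qed.

Lemma trajectory_shift x alpha s t : control A alpha -> 0 <= s -> 0 <= t ->
  trajectory f (trajectory f x alpha s) (fun u => alpha (s + u)) t =
  trajectory f x alpha (s + t).
Proof.
move=> ca s0 t0.
have cy := trajectory_continuous x ca.
have lfy := (locbm_field cs ca cy).1.
have := @trajectory_unique (trajectory f x alpha s) _ (fun u => trajectory f x alpha (s + u)) (control_shift s0 ca).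
move=> /(_ _ t t0) <-; first by [].
apply/is_trajectoryP; split; first exact: continuous_path_shift.
move=> u u0; rewrite trajectoryE ?addr_ge0//.
have su : s <= s + u by rewrite lerDl.
rewrite (vRI_add lfy (lexx 0) s0 su) addrA -(trajectoryE x ca s0); congr (_ + _).
by apply/rowP => i; rewrite !mxE (RI_shift (lfy i)).
Qed.

Definition splice s alpha beta t := if t < s then alpha t else beta (t - s).

Lemma control_splice s alpha beta : 0 <= s -> control A alpha -> control A beta ->
  control A (splice s alpha beta).
Proof.
move=> s0 [Aa ma] [Ab mb]; split.
  move=> t t0; rewrite /splice; case: ltP => st; first exact: Aa.
  by apply: Ab; rewrite subr_ge0.
move=> j.
have -> : (fun t => splice s alpha beta t 0 j) =
    (fun t => if t < s then alpha t 0 j else beta (t - s) 0 j).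
  by apply/funext => t; rewrite /splice; case: ifP.
apply: measurable_fun_if => //.
- by apply: measurable_fun_ltr => //; exact: measurable_id.
- by apply: measurable_funS (ma j) => //.
- apply: (@measurable_comp _ _ _ _ _ _ half_line (fun t => beta t 0 j)) => //.
  + move=> _ [t [_ /=] /negbT + <-] /=; rewrite -leNgt in_itv/= andbT.
    by rewrite subr_ge0.
  + by apply: measurable_funTS; apply: measurable_funB => //; exact: measurable_id.
Qed.

Lemma splice_lt s alpha beta t : t < s -> splice s alpha beta t = alpha t.
Proof. by rewrite /splice => ->. Qed.

Lemma splice_add s alpha beta t : 0 <= t -> splice s alpha beta (s + t) = beta t.
Proof. by move=> t0; rewrite /splice ltNge lerDl t0/= addrAC subrr add0r. Qed.

Lemma trajectory_splice_le s x alpha beta t : control A alpha -> control A beta ->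
  0 <= t -> t <= s -> trajectory f x (splice s alpha beta) t = trajectory f x alpha t.
Proof.
move=> ca cb t0 ts; have s0 := le_trans t0 ts.
apply: (@trajectory_causal _ _ _ s) => //; last by rewrite t0.
  exact: control_splice.
by move=> u /andP[u0 us]; rewrite splice_lt.
Qed.

Lemma trajectory_splice_add s x alpha beta t : control A alpha -> control A beta ->
  0 <= s -> 0 <= t -> trajectory f x (splice s alpha beta) (s + t) =
  trajectory f (trajectory f x alpha s) beta t.
Proof.
move=> ca cb s0 t0.
rewrite -trajectory_shift//; last exact: control_splice.
rewrite trajectory_splice_le//; apply: (@trajectory_causal _ _ _ t) => //.
- by apply: control_shift => //; exact: control_splice.
- by move=> u /andP[u0 _]; rewrite splice_add.
- by rewrite t0 lexx.
Qed.

Definition run_cost x alpha t := RI (fun s => l (trajectory f x alpha s) (alpha s)) 0 t.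

Lemma run_costE x alpha t :
  run_cost x alpha t = RI (fun s => l (trajectory f x alpha s) (alpha s)) 0 t.
Proof. by []. Qed.

Lemma run_cost_locbm x alpha : control A alpha ->
  locbm (fun s => l (trajectory f x alpha s) (alpha s)).
Proof. by move=> ca; exact: (locbm_field cs ca (trajectory_continuous x ca)).2. Qed.

Lemma run_cost0 x alpha : run_cost x alpha 0 = 0. Proof. exact: RI_xx. Qed.

Lemma run_cost_ge0 x alpha t : control A alpha -> 0 <= run_cost x alpha t.
Proof. by move=> ca; apply: RI_ge0 => s /andP[s0 _]; apply: (cs_cost_ge0 cs); exact: ca.1. Qed.

Lemma run_cost_add x alpha s t : control A alpha -> 0 <= s -> 0 <= t ->
  run_cost x alpha (s + t) = run_cost x alpha s +
    run_cost (trajectory f x alpha s) (fun u => alpha (s + u)) t.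
Proof.
move=> ca s0 t0; rewrite /run_cost.
have lc := run_cost_locbm x ca.
rewrite (RI_add lc (lexx 0) s0) ?lerDl//; congr (_ + _).
rewrite (RI_shift lc)//; apply: RI_eq => u /andP[u0 _].
by rewrite trajectory_shift.
Qed.

Lemma run_cost_le x alpha s t : control A alpha -> 0 <= s -> s <= t ->
  run_cost x alpha s <= run_cost x alpha t.
Proof.
move=> ca s0 st; rewrite -(subrKC s t) run_cost_add ?subr_ge0// lerDl.
by apply: run_cost_ge0; exact: control_shift.
Qed.

Lemma run_cost_causal x alpha beta b : control A alpha -> control A beta ->
  (forall t, 0 <= t < b -> alpha t = beta t) ->
  forall t, 0 <= t <= b -> run_cost x alpha t = run_cost x beta t.
Proof.
move=> ca cb ab t /andP[t0 tb]; apply: RI_eqo => //; try exact: run_cost_locbm.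
move=> s /andP[s0 st]; have sb : s < b by exact: lt_le_trans tb.
by rewrite ab ?s0// (trajectory_causal x ca cb ab)// s0 ltW.
Qed.

Lemma run_cost_splice_le s x alpha beta t : control A alpha -> control A beta ->
  0 <= t -> t <= s -> run_cost x (splice s alpha beta) t = run_cost x alpha t.
Proof.
move=> ca cb t0 ts; have s0 := le_trans t0 ts.
apply: (@run_cost_causal _ _ _ s) => //; last by rewrite t0.
  exact: control_splice.
by move=> u /andP[u0 us]; rewrite splice_lt.
Qed.

Lemma run_cost_splice_add s x alpha beta t : control A alpha -> control A beta ->
  0 <= s -> 0 <= t -> run_cost x (splice s alpha beta) (s + t) =
  run_cost x alpha s + run_cost (trajectory f x alpha s) beta t.
Proof.
move=> ca cb s0 t0.
have cab := control_splice s0 ca cb.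
rewrite run_cost_add// run_cost_splice_le// trajectory_splice_le//; congr (_ + _).
apply: (@run_cost_causal _ _ _ t) => //.
- exact: control_shift.
- by move=> u /andP[u0 _]; rewrite splice_add.
- by rewrite t0 lexx.
Qed.

(** Gronwall's inequality for the distance from [x], which grows at a rate of at most
    [M * (1 + |x|)] plus [M] times itself. *)
Lemma trajectory_displacement x alpha t (M : R) : control A alpha -> 0 < M ->
  (forall x a, A a -> `|f x a| <= M * (1 + `|x|)) -> 0 <= t ->
  `|trajectory f x alpha t - x| <= 2 * (M * (1 + `|x|) * t) * expR (2 * M * t).
Proof.
move=> ca M0 hM t0.
pose y := trajectory f x alpha.
have cy : {within half_line, continuous y} := trajectory_continuous x ca.
have cx : {within half_line, continuous (fun=> x)}.
  by apply: continuous_subspaceT => ?; exact: cst_continuous.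
have cyx := continuous_pathB cy cx.
have lg := locbm_norm_path cyx.
have := @gronwall _ (fun s => `|(y - (fun=> x)) s|) (M * (1 + `|x|) * t) M t lg M0.
apply => //; last by rewrite t0 lexx.
  by rewrite !mulr_ge0// ?addr_ge0// ltW.
move=> s /andP[s0 st]; split => //.
rewrite [in leLHS]/y !fctE trajectoryE// addrAC subrr add0r -/y.
apply: (@le_trans _ _ (RI (fun u => M * (1 + `|x|) + M * `|y u - x|) 0 s)).
  apply: vRI_norm_le => //.
  - exact: (locbm_field cs ca cy).1.
  - by apply: locbmD; [exact: locbm_cst|exact: locbmZ].
  - move=> u /andP[u0 us]; rewrite (le_trans (hM _ _ (ca.1 _ u0)))//.
    rewrite -mulrDr ler_pM2l// -addrA lerD2l.
    by rewrite -[X in `|X| <= _](subrKC x) ler_normD.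
rewrite RID//; [|exact: locbm_cst|exact: locbmZ].
have -> : RI (fun u => M * `|y u - x|) 0 s = M * RI (fun u => `|y u - x|) 0 s.
  exact: (@RIZ _ M _ 0 s lg (lexx 0)).
rewrite lerD2r RI_cst// subr0 ler_wpM2l// mulr_ge0 ?addr_ge0//.
exact: ltW.
Qed.

Lemma trajectory_lipschitz x alpha b (B M : R) : control A alpha -> 0 < M ->
  (forall x a, A a -> `|f x a| <= M * (1 + `|x|)) ->
  (forall t, 0 <= t <= b -> `|trajectory f x alpha t| <= B) ->
  forall s t, 0 <= s -> s <= t -> t <= b ->
  `|trajectory f x alpha t - trajectory f x alpha s| <= M * (1 + B) * (t - s).
Proof.
move=> ca M0 hM hB s t s0 st tb.
have lf := (locbm_field cs ca (trajectory_continuous x ca)).1.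
rewrite !(trajectoryE x ca)//; last exact: le_trans st.
rewrite (vRI_add lf (lexx 0) s0 st) opprD addrACA subrr add0r addrAC subrr add0r.
rewrite -RI_cst//; apply: vRI_norm_le => //; first exact: locbm_cst.
move=> u /andP[su ut]; have u0 := le_trans s0 su.
rewrite (le_trans (hM _ _ (ca.1 _ u0)))// ler_pM2l// lerD2l hB//.
by rewrite u0 (le_trans ut).
Qed.

End Trajectories.
Arguments trajectory_continuous {R n m A f l} cs x [alpha] _.

(** * Extremal aiming *)

Ltac nneg := repeat first
  [ assumption | apply: ltW; assumption | apply: addr_ge0 | apply: mulr_ge0
  | apply: exprn_ge0 | rewrite invr_ge0 | exact: expR_ge0 | exact: sqr_ge0
  | exact: normr_ge0 | exact: ler0n | exact: ler01 | done ].

Lemma dotp_sub_sqr (R : realType) n (x y : 'rV[R]_n) :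
  dotp (x - y) (x - y) = dotp x x - 2 * dotp x y + dotp y y.
Proof. by rewrite dotpDl !dotpDr !dotpNl !dotpNr (dotpC y x); ring. Qed.

Lemma dotp_sqr_diff (R : realType) n (x y : 'rV[R]_n) :
  dotp x x - dotp y y = dotp (x - y) (x + y).
Proof. by rewrite dotpDl !dotpDr !dotpNl (dotpC y x); ring. Qed.

Section Aiming.
Context {R : realType} {n m : nat}.
Variables (A : set 'rV[R]_m) (f : 'rV[R]_n -> 'rV[R]_m -> 'rV[R]_n)
  (l : 'rV[R]_n -> 'rV[R]_m -> R).
Hypothesis cs : control_system A f l.
Variables (x0 : 'rV[R]_n) (r Th : R) (g : 'rV[R]_n -> R).
Hypothesis r_gt0 : 0 < r.
Hypothesis Th_ge0 : 0 <= Th.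
Hypothesis g_bounded : forall x, `|x - x0| <= 2 * r -> `|g x| <= 1.
Hypothesis g_lsc : forall p e, `|p - x0| <= 2 * r -> 0 < e ->
  \forall z \near p, g p - e < g z.
Hypothesis stay : forall alpha t, control A alpha -> 0 <= t <= Th ->
  `|trajectory f x0 alpha t - x0| <= r.
Implicit Types (x y z p : 'rV[R]_n) (alpha beta gam : R -> 'rV[R]_m).

Local Notation traj := (trajectory f x0).
Local Notation rcost := (run_cost f l x0).
(** Trajectories stay within radius [r]. Minimizing over radius [2 * r] puts the minimizers close to
    a trajectory in the interior, where the viscosity inequality can be applied. *)
Let K : set 'rV[R]_n := [set x | `|x - x0| <= 2 * r].

Definition penalized (w : R) y x := g x + w / 2 * dotp (x - y) (x - y).

Lemma penalized_lsc w y p e : K p -> 0 < e ->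
  \forall z \near p, penalized w y p - e < penalized w y z.
Proof.
move=> Kp e0; have e20 : 0 < e / 2 by rewrite divr_gt0.
pose X : 'rV[R]_n := p - y; pose c := `|w / 2| * (n%:R * (2 * `|X| + 1)) + 1.
have c0 : 0 < c by rewrite ltr_wpDl// !mulr_ge0 ?addr_ge0// mulr_ge0.
have /nbhs_ballP[d /= d0 hd] := g_lsc Kp e20.
have dm : 0 < Num.min d (Num.min 1 (e / 2 / c)) by rewrite !lt_min d0 ltr01 divr_gt0.
apply/nbhs_ballP; exists (Num.min d (Num.min 1 (e / 2 / c))) => //= z.
rewrite -ball_normE /ball_/= !lt_min => /and3P[zd z1 zc].
have h1 : g p - e / 2 < g z by apply: hd; rewrite -ball_normE.
have h2 : dotp X X - dotp (z - y) (z - y) = dotp (p - z) (X + (z - y)).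
  by rewrite dotp_sqr_diff; congr (dotp _ _); rewrite /X opprB addrA subrK.
have h3 : `|X + (z - y)| <= 2 * `|X| + 1.
  have -> : X + (z - y) = X + X - (p - z).
    by apply/rowP => i; rewrite /X !mxE; ring.
  rewrite (le_trans (ler_normB _ _))// lerD ?(ltW z1)//.
  by rewrite (le_trans (ler_normD _ _))//; lra.
have h4 : `|w / 2 * (dotp X X - dotp (z - y) (z - y))| <= `|w / 2| * (n%:R * (2 * `|X| + 1)) * `|p - z|.
  rewrite normrM -mulrA ler_wpM2l// h2 (le_trans (dotp_bound _ _))//.
  by rewrite -!mulrA ler_wpM2l// mulrC ler_wpM2r.
have h5 : `|w / 2| * (n%:R * (2 * `|X| + 1)) * `|p - z| <= c * `|p - z|.
  by rewrite ler_wpM2r// lerDl.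
have h6 : c * `|p - z| < e / 2 by rewrite mulrC -ltr_pdivlMr.
have := le_lt_trans (le_trans h4 h5) h6.
by rewrite /penalized -/X ltr_norml => /andP[_]; lra.
Qed.

Lemma compact_norm_ball : compact K.
Proof.
have -> : K = closed_ball x0 (2 * r).
  rewrite closed_ballE ?mulr_gt0//.
  by apply/seteqP; split => x; rewrite /closed_ball_/= distrC.
apply: bounded_closed_compact; last exact: closed_ball_closed.
exists (`|x0| + 2 * r); split; first exact: num_real.
move=> M hM x; rewrite closed_ballE ?mulr_gt0// /closed_ball_/= => h.
rewrite -[X in `|X|](subKr x0) (le_trans (ler_normB _ _))// (le_trans _ (ltW hM))//.
by rewrite lerD2l.
Qed.

Lemma center_norm_ball : K x0. Proof. by rewrite /K/= subrr normr0 mulr_ge0// ltW. Qed.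

(** The inf-convolution (Moreau envelope) of [g] restricted to [K]. *)
Definition envelope w y := inf (penalized w y @` K).

Lemma envelopeP w y : 0 <= w ->
  (exists2 x, K x & envelope w y = penalized w y x) /\
  (forall x, K x -> envelope w y <= penalized w y x).
Proof.
move=> w0.
have lbp x : K x -> -1 <= penalized w y x.
  move=> Kx; have := g_bounded Kx; rewrite ler_norml => /andP[h _].
  by rewrite (le_trans h)// lerDl mulr_ge0 ?dotp_ge0// divr_ge0.
have [p Kp hp] : exists2 p, K p & forall z, K z -> penalized w y p <= penalized w y z.
  apply: (lsc_min compact_norm_ball _ lbp); first by exists x0; exact: center_norm_ball.
  by move=> p e Kp e0; apply: filterS (penalized_lsc w y Kp e0) => z.
have E : envelope w y = penalized w y p.
  apply/eqP; rewrite eq_le; apply/andP; split.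
    by apply: ge_inf; [exists (-1) => _ [z Kz <-]; exact: lbp|exists p].
  by apply: lb_le_inf; [exists (penalized w y p), p|move=> _ [z Kz <-]; exact: hp].
by split; [exists p|move=> x Kx; rewrite E; exact: hp].
Qed.

Lemma dotp_vRI p (G : R -> 'rV[R]_n) (a b : R) : (forall i, locbm (fun s => G s 0 i)) ->
  0 <= a -> locbm (fun s => dotp p (G s)) /\
  dotp p (vRI G a b) = RI (fun s => dotp p (G s)) a b.
Proof.
move=> lG a0; have E : (fun s => dotp p (G s)) = (fun s => \sum_i p 0 i * G s 0 i).
  by apply/funext => s; rewrite dotpE.
have lpG i : locbm (fun s => p 0 i * G s 0 i) by exact: locbmZ.
rewrite E; split; first exact: locbm_sum.
by rewrite dotpE RI_sum//; apply: eq_bigr => i _; rewrite mxE RIZ.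
Qed.

(** The factor [expR (- u) * (1 + u)] lies between [1 - u ^+ 2] and 1; the lower bound serves
    negative [Phi], the upper one the rest. *)
Lemma discount_step (u Phi : R) : 0 <= u -> -1 <= Phi -> expR (- u) * (Phi * (1 + u)) <= Phi + u ^+ 2.
Proof.
move=> u0 P1; have h1 : 1 + - u <= expR (- u) := expR_ge1Dx _.
have h2 : expR (- u) * (1 + u) <= 1.
  rewrite expRN ler_pdivrMl ?expR_gt0// mulr1; exact: expR_ge1Dx.
have h3 : (1 - u) * (1 + u) <= expR (- u) * (1 + u).
  by rewrite ler_wpM2r// addr_ge0.
set E := expR (- u) in h1 h2 h3 *.
have [P0|P0] := leP 0 Phi; first by nra.
by nra.
Qed.

(** Lowering the weight by the factor [1 - k * h] produces the term [- k * h * w / 2 * XX], which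
    cancels the error proportional to [w * XX]. Apart from [c * h], what is left is of second order
    in [h]. *)
Lemma step_arith (N G w k h XX XD DD dL c B q : R) :
  0 <= w -> 0 <= h -> 0 <= k * h -> k * h <= 1 -> 0 <= XX -> 0 <= DD -> 0 <= dL ->
  - (w * XD) <= G * dL + (c + k / 2 * w * XX) * h ->
  w * `|XD| <= B * h -> w * DD <= q * h ^+ 2 ->
  G + w * (1 - k * h) / 2 * (XX - 2 * XD + DD) <=
  (G + w / 2 * XX) * (1 + dL) + h * (c + k * h * B + q * h / 2).
Proof.
move=> w0 h0 kh0 kh1 XX0 DD0 dL0 h1 h2 h3.
have h4 : k * h * (w * XD) <= k * h * (B * h).
  by rewrite ler_wpM2l// (le_trans _ h2)// ler_wpM2l// ler_norm.
have h5 : 0 <= w * DD by rewrite mulr_ge0.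
have h6 : k * h * (w * DD) >= 0 by rewrite mulr_ge0.
have h7 : 0 <= w * XX * dL by rewrite !mulr_ge0.
have -> : G + w * (1 - k * h) / 2 * (XX - 2 * XD + DD) =
  (G + w / 2 * XX - k * h * w / 2 * XX) - w * XD + k * h * (w * XD) + w * DD / 2 - k * h * (w * DD) / 2.
  by field.
lra.
Qed.

(** The minimizer for the old position competes at the new one. The condition on the control bounds
    the first-order change of the penalty with [f] and [l] taken at [xh]; Lipschitz bounds transfer
    it to the trajectory. *)
Lemma aiming_step gam (s h w eta F L Lam : R) xh (k : R) :
  let y := traj gam s in let y' := traj gam (s + h) in
  let dL := rcost gam (s + h) - rcost gam s in
  control A gam -> 0 <= s -> 0 <= h -> s + h <= Th -> 0 < w -> 0 <= L -> 0 <= F ->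
  (forall x a, `|x - x0| <= 2 * r -> A a -> `|f x a| <= F) ->
  (forall x x' a, `|x - x0| <= 2 * r -> `|x' - x0| <= 2 * r -> A a ->
     `|f x a - f x' a| <= L * `|x - x'| /\ `|l x a - l x' a| <= L * `|x - x'|) ->
  (forall x a, `|x - x0| <= 2 * r -> A a -> l x a <= Lam) ->
  K xh -> k = 2 * n%:R * L -> k * h <= 1 ->
  (forall u, s <= u <= s + h ->
     w * dotp (y - xh) (f xh (gam u)) <= l xh (gam u) * g xh + eta) ->
  [/\ 0 <= dL, dL <= Lam * h &
  penalized (w * (1 - k * h)) y' xh <= penalized w y xh * (1 + dL) +
    h * (eta + n%:R * L * (w * `|xh - y|) * F * h + L * `|xh - y| + L * F * h
         + k * h * (n%:R * (w * `|xh - y|) * F) + w * n%:R * F ^+ 2 * h / 2)].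
Proof.
move=> y y' dL cg s0 h0 shT w0 L0 F0 hF hL hLam Kxh kE kh1 cond.
have ssh : s <= s + h by rewrite lerDl.
have in2r t : 0 <= t -> t <= Th -> `|traj gam t - x0| <= 2 * r.
  move=> t0 tT; rewrite (le_trans (stay cg _)) ?t0//.
  by move: r_gt0; lra.
have lfg := (locbm_field cs cg (trajectory_continuous cs x0 cg)).1.
have lcg := run_cost_locbm cs x0 cg.
have DE t : s <= t -> traj gam t - y = vRI (fun u => f (traj gam u) (gam u)) s t.
  move=> st; rewrite /y !(trajectoryE cs x0 cg)//; last exact: le_trans st.
  by rewrite (vRI_add lfg (lexx 0) s0 st) opprD addrACA subrr add0r addrAC subrr add0r.
have dLE : dL = RI (fun u => l (traj gam u) (gam u)) s (s + h).
  by rewrite /dL /run_cost (RI_add lcg (lexx 0) s0 ssh); ring.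
have Agam u : s <= u -> A (gam u) by move=> su; apply: cg.1; exact: le_trans su.
have lam u : s <= u <= s + h -> 0 <= l (traj gam u) (gam u) <= Lam.
  move=> /andP[su ush]; apply/andP; split.
    by apply: (cs_cost_ge0 cs); exact: Agam.
  by apply: hLam; [apply: in2r; [exact: le_trans su|exact: le_trans shT]|exact: Agam].
have dL0 : 0 <= dL.
  by rewrite dLE; apply: RI_ge0 => u /lam/andP[].
have dLL : dL <= Lam * h.
  rewrite dLE; have -> : Lam * h = RI (fun=> Lam) s (s + h) by rewrite RI_cst// addrAC subrr add0r.
  by apply: RI_le => //; [exact: locbm_cst|move=> u /lam/andP[]].
have moved u : s <= u <= s + h -> `|traj gam u - y| <= F * h.
  move=> /andP[su ush]; rewrite DE//.
  apply: (@le_trans _ _ (RI (fun=> F) s u)).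
    apply: vRI_norm_le => //; first exact: locbm_cst.
    move=> v /andP[sv vu]; apply: hF; last exact: Agam.
    by apply: in2r; [exact: le_trans sv|rewrite (le_trans vu)// (le_trans ush)].
  by rewrite RI_cst// ler_wpM2l// lerBlDl.
pose X : 'rV[R]_n := xh - y; pose D : 'rV[R]_n := y' - y.
have XDE : xh - y' = X - D by rewrite /X /D opprB addrA subrK.
have quad : dotp (X - D) (X - D) = dotp X X - 2 * dotp X D + dotp D D.
  exact: dotp_sub_sqr.
have DFh : `|D| <= F * h by apply: moved; rewrite ssh lexx.
split => //; rewrite /penalized XDE quad -/X.
pose c := eta + n%:R * L * (w * `|X|) * F * h + L * `|X| + L * F * h.
have gx : `|g xh| <= 1 := g_bounded Kxh.
have XX0 := dotp_ge0 X.
have XX := norm_sqr_le_dotp X.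
rewrite [leRHS](_ : _ = (g xh + w / 2 * dotp X X) * (1 + dL) +
  h * (c + k * h * (n%:R * (w * `|X|) * F) + (w * n%:R * F ^+ 2) * h / 2)); last first.
  by rewrite /c; ring.
have n0 : 0 <= n%:R :> R by [].
have k0 : 0 <= k by rewrite kE !mulr_ge0.
apply: (@step_arith 0) => //; first exact: ltW.
- exact: mulr_ge0.
- exact: dotp_ge0.
- have -> : - (w * dotp X D) = RI (fun u => dotp (w *: (y - xh)) (f (traj gam u) (gam u))) s (s + h).
    have [_ <-] := @dotp_vRI (w *: (y - xh)) _ s (s + h) lfg s0.
    by rewrite -DE// -/y' -/D -[y - xh]opprB dotpZl dotpNl mulrN.
  have -> : g xh * dL + (c + k / 2 * w * dotp X X) * h =
     RI (fun u => g xh * l (traj gam u) (gam u) + (c + k / 2 * w * dotp X X)) s (s + h).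
    rewrite RID//; [|exact: locbmZ|exact: locbm_cst].
    by rewrite (@RIZ _ (g xh) _ s (s + h) lcg s0) -dLE RI_cst// [s + h]addrC addrK.
  apply: RI_le => //.
  + by have [] := @dotp_vRI (w *: (y - xh)) _ s (s + h) lfg s0.
  + by apply: locbmD; [exact: locbmZ|exact: locbm_cst].
  move=> u /[dup] su /andP[su1 su2].
  have Ku : `|traj gam u - x0| <= 2 * r.
    by apply: in2r; [exact: le_trans su1|exact: le_trans shT].
  have [fL lL] := hL _ _ _ Ku Kxh (Agam u su1).
  have dist : `|traj gam u - xh| <= `|X| + F * h.
    rewrite -(subrKA y) (le_trans (ler_normD _ _))// addrC lerD//; first by rewrite distrC.
    exact: moved.
  rewrite -(subrK (f xh (gam u)) (f (traj gam u) (gam u))) dotpDr [dotp _ (f xh _)]dotpZl.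
  have h1 : dotp (w *: (y - xh)) (f (traj gam u) (gam u) - f xh (gam u)) <=
     n%:R * (w * `|X|) * (L * (`|X| + F * h)).
    rewrite (le_trans (ler_norm _))// (le_trans (dotp_bound _ _))//.
    rewrite normrZ (gtr0_norm w0) distrC -/X ler_wpM2l ?mulr_ge0 ?(ltW w0)//.
    by rewrite (le_trans fL)// ler_wpM2l.
  have h2 := cond u su.
  have h3 : l xh (gam u) * g xh <= g xh * l (traj gam u) (gam u) + L * (`|X| + F * h).
    have : `|(l xh (gam u) - l (traj gam u) (gam u)) * g xh| <= L * (`|X| + F * h) * 1.
      rewrite normrM ler_pM// distrC (le_trans lL)// ler_wpM2l//.
    by rewrite mulr1 => /(le_trans (ler_norm _)); rewrite mulrBl [_ * g xh]mulrC [l (traj _ _) _ * g xh]mulrC; lra.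
  (* The Lipschitz error in [f] is quadratic in [X] and carries the large weight [w];
     [k = 2 * n%:R * L] is chosen for the decrease of the weight to cancel it. *)
  have h4 : n%:R * (w * `|X|) * (L * `|X|) <= k / 2 * w * dotp X X.
    rewrite kE (_ : n%:R * (w * `|X|) * (L * `|X|) = n%:R * L * w * `|X| ^+ 2); last by ring.
    rewrite (_ : 2 * n%:R * L / 2 * w * dotp X X = n%:R * L * w * dotp X X); last by field.
    by rewrite ler_wpM2l// !mulr_ge0// ltW.
  have h5 : n%:R * (w * `|X|) * (L * (`|X| + F * h)) =
    n%:R * (w * `|X|) * (L * `|X|) + n%:R * L * (w * `|X|) * F * h by ring.
  move: h1; rewrite h5 /c => h1; lra.
- have : `|dotp X D| <= n%:R * `|X| * (F * h).
    by rewrite (le_trans (dotp_bound _ _))// ler_wpM2l// mulr_ge0.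
  move=> /(ler_wpM2l (ltW w0)) /le_trans; apply; rewrite le_eqVlt; apply/orP; left.
  by apply/eqP; ring.
- have : dotp D D <= n%:R * (F * h) * (F * h).
    rewrite (le_trans (ler_norm _))// (le_trans (dotp_bound _ _))//.
    by rewrite -[leLHS]mulrA -[leRHS]mulrA ler_wpM2l// ler_pM.
  move=> /(ler_wpM2l (ltW w0)) /le_trans; apply; rewrite le_eqVlt; apply/orP; left.
  by apply/eqP; ring.
Qed.

(** For [u <= 2^-1] one has [1 <= (1 - u) * (1 + 2 * u)]. This keeps the decreasing weights bounded
    below, however many steps there are. *)
Lemma expR_lower (u : R) : 0 <= u -> u <= 2^-1 -> expR (- (2 * u)) <= 1 - u.
Proof.
move=> u0 u1; rewrite expRN -[leRHS]invrK lef_pV2 ?posrE ?expR_gt0 ?invr_gt0//; last by lra.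
apply: le_trans (expR_ge1Dx _).
rewrite -[leLHS]mulr1 ler_pdivrMl; [by nra|by lra].
Qed.

(* Extremal aiming on [N] short steps: on each of them the control is chosen for
   the minimizer [xh] of the penalized function at the current position, and
   the envelope, discounted by the running cost, increases by a small multiple
   of the length of the step.  The weight [w] decreases geometrically with the
   steps, which absorbs the error of replacing the trajectory by [xh] in [f].
   The set [P] is a singleton for subsolutions, where no choice is left. *)
Lemma aiming (P : set (R -> 'rV[R]_m)) gam0 :
  P gam0 -> P `<=` control A ->
  (forall eta gam (s w : R) xh, 0 < eta -> P gam -> 0 <= s -> s <= Th -> 0 < w ->
     `|xh - x0| < 2 * r ->
     (\forall z \near xh, penalized w (traj gam s) xh <= penalized w (traj gam s) z) ->
     exists gam', [/\ P gam', forall u, u < s -> gam' u = gam u &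
       forall u, s <= u ->
       w * dotp (traj gam s - xh) (f xh (gam' u)) <= l xh (gam' u) * g xh + eta]) ->
  forall rho, 0 < rho -> exists gam xh, [/\ P gam, `|xh - x0| <= 2 * r,
    `|xh - traj gam Th| <= rho & expR (- rcost gam Th) * g xh <= g x0 + rho].
Proof.
move=> P0 Pc H rho rho0.
have [M M0 hM] := cs_growth cs.
have [L L0 hL] := cs_lipschitz cs (`|x0| + 2 * r).
have [Lam Lam0 hLam] := running_cost_bounded cs (`|x0| + 2 * r).
have inball x : `|x - x0| <= 2 * r -> `|x| <= `|x0| + 2 * r.
  by move=> h; rewrite -[X in `|X|](subrKC x0) (le_trans (ler_normD _ _))// lerD2l.
pose F := M * (1 + (`|x0| + 2 * r)).
have F0 : 0 <= F by rewrite mulr_ge0 ?(ltW M0)// !addr_ge0// mulr_ge0// ltW.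
have n0 : 0 <= n%:R :> R by [].
pose k := 2 * n%:R * L.
have k0 : 0 <= k by rewrite !mulr_ge0// ltW.
(* [c1 ^+ 2] bounds the product of all the weight reductions from below, independently of the number
   of steps. *)
pose c1 := expR (- (k * Th)).
have c10 : 0 < c1 by rewrite expR_gt0.
pose rho1 := Num.min rho (Num.min (r / 2) (rho / (3 * (L * Th + 1)))).
have LT0 : 0 < L * Th + 1 by rewrite ltr_wpDl// mulr_ge0// ltW.
have rho10 : 0 < rho1 by rewrite !lt_min rho0 !divr_gt0// mulr_gt0.
have rho1r : rho1 < r.
  rewrite (@le_lt_trans _ _ (r / 2))//; last by move: r_gt0; lra.
  by rewrite /rho1 !ge_min lexx ?orbT.
have rho1rho : rho1 <= rho by rewrite /rho1 ge_min lexx.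
have rho1L : L * Th * rho1 <= rho / 3.
  have : rho1 <= rho / (3 * (L * Th + 1)) by rewrite /rho1 !ge_min lexx ?orbT.
  move=> /(ler_wpM2l (ltW LT0)).
  have -> : (L * Th + 1) * (rho / (3 * (L * Th + 1))) = rho / 3.
    by field; rewrite gt_eqF.
  by apply: le_trans; rewrite ler_wpM2r ?lerDl// ltW.
(* Since [|g| <= 1], a weight of at least [(2 / rho1) ^+ 2] keeps the minimizer within [rho1] of the
   trajectory; the factor [c1] anticipates the loss of weight. *)
pose W := (2 / (rho1 * c1)) ^+ 2.
have W0 : 0 < W by rewrite exprn_gt0// divr_gt0// mulr_gt0.
(* The second-order errors of one step. They depend on [W] but not on the number of steps, which is
   chosen afterwards. *)
pose C := n%:R * L * (W * rho1) * F + L * F + k * (n%:R * (W * rho1) * F)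
          + W * n%:R * F ^+ 2 / 2 + Lam ^+ 2.
have C0 : 0 <= C.
  by rewrite /C; nneg.
pose eta := rho / (3 * (Th + 1)).
have eta0 : 0 < eta by rewrite divr_gt0// mulr_gt0// ltr_wpDl.
have [N hN1 hN2] : exists2 N : nat, k * (Th / N.+1%:R) <= 2^-1 &
    Th * (Th / N.+1%:R * C) <= rho / 3.
  pose S := 2 * k * Th + 3 * Th * Th * C / rho.
  exists (Num.truncn S); have := truncnS_gt S;
    move: (Num.truncn S).+1%:R (ltr0Sn R (Num.truncn S)) => q q0 Sq.
    rewrite mulrA ler_pdivrMr//.
    have : 0 <= 3 * Th * Th * C / rho by nneg.
    by move: Sq; rewrite /S; lra.
  rewrite (_ : Th * (Th / q * C) = Th * Th * C / q); last by field; rewrite gt_eqF.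
  rewrite ler_pdivrMr//.
  have : 0 <= 2 * k * Th by nneg.
  have -> : Th * Th * C = (3 * Th * Th * C / rho) * (rho / 3) by field; rewrite gt_eqF.
  rewrite [rho / 3 * _]mulrC => h1; rewrite ler_wpM2r ?divr_ge0 ?(ltW rho0)//.
  by move: Sq; rewrite /S; lra.
pose h := Th / N.+1%:R.
rewrite -/h in hN1 hN2.
have h0 : 0 <= h by rewrite divr_ge0.
have hNT : N.+1%:R * h = Th by rewrite /h mulrCA divff ?mulr1// pnatr_eq0.
have kh1 : k * h <= 1 by rewrite (le_trans hN1)// invf_le1// ler1n.
pose w i := W * (1 - k * h) ^+ i.
have w0 i : 0 < w i.
  by rewrite mulr_gt0// exprn_gt0// subr_gt0 (le_lt_trans hN1)// invf_lt1// ltr1n.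
have wW i : w i <= W.
  rewrite ler_piMr ?(ltW W0)// exprn_ile1// ?subr_ge0//.
  by rewrite gerBl mulr_ge0.
have ihT (i : nat) : (i <= N.+1)%N -> i%:R * h <= Th.
  by move=> iN; rewrite -hNT ler_wpM2r// ler_nat.
have wl i : (i <= N.+1)%N -> (2 / rho1) ^+ 2 <= w i.
  move=> iN.
  have -> : (2 / rho1) ^+ 2 = W * c1 ^+ 2.
    by rewrite /W -exprMn; congr (_ ^+ 2); field; rewrite !gt_eqF.
  rewrite ler_pM2l// -expRM_natl.
  apply: (@le_trans _ _ (expR (- (2 * (k * h))) ^+ i)).
    rewrite -expRM_natl ler_expR.
    rewrite (_ : 2 * - (k * Th) = - (2 * k * Th)); last by ring.
    rewrite (_ : i%:R * - (2 * (k * h)) = - (2 * k * (i%:R * h))); last by ring.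
    by rewrite lerN2; apply: ler_wpM2l; [nneg|exact: ihT].
  rewrite lerXn2r ?nnegrE ?expR_ge0 ?subr_ge0//.
  by apply: expR_lower => //; rewrite mulr_ge0.
have near_min i gam : P gam -> (i <= N.+1)%N ->
    let y := traj gam (i%:R * h) in
    exists xh, [/\ K xh, `|xh - y| <= rho1, envelope (w i) y = penalized (w i) y xh &
      forall z, K z -> penalized (w i) y xh <= penalized (w i) y z].
  move=> Pg iN y.
  have [[xh Kxh E] hmin] := envelopeP y (ltW (w0 i)).
  exists xh; split => //; last by move=> z Kz; rewrite -E; exact: hmin.
  have yr : `|y - x0| <= r by apply: stay; [exact: Pc|rewrite mulr_ge0//= ihT].
  have Ky : K y by rewrite /K/= (le_trans yr)//; move: r_gt0; lra.
  have := hmin y Ky; rewrite E /penalized subrr [dotp 0 0]dotpE big1; last first.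
    by move=> j _; rewrite !mxE mul0r.
  rewrite mulr0 addr0 => h1.
  have := g_bounded Ky; have := g_bounded Kxh; rewrite !ler_norml => /andP[g1 _] /andP[_ g2].
  have h2 : w i * `|xh - y| ^+ 2 <= 4.
    rewrite (@le_trans _ _ (w i * dotp (xh - y) (xh - y)))//.
      by rewrite ler_pM2l// norm_sqr_le_dotp.
    by lra.
  have h3 : (2 / rho1) ^+ 2 * `|xh - y| ^+ 2 <= 2 ^+ 2.
    rewrite (le_trans (ler_wpM2r _ (wl i iN)))// ?exprn_ge0//.
    by rewrite (le_trans h2)// -natrX ler_nat.
  rewrite -exprMn ler_pXn2r// ?nnegrE// ?mulr_ge0 ?invr_ge0 ?(ltW rho10)// in h3.
  by move: h3; rewrite mulrAC ler_pdivrMr// ler_pM2l.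
pose err := eta + L * rho1 + h * C.
have iter i : (i <= N.+1)%N -> exists2 gam, P gam &
    expR (- rcost gam (i%:R * h)) * envelope (w i) (traj gam (i%:R * h)) <=
    g x0 + i%:R * h * err.
  elim: i => [_|i IH iN].
    exists gam0 => //; rewrite !mul0r addr0 run_cost0 oppr0 expR0 mul1r.
    rewrite (trajectory0 cs x0 (Pc _ P0)).
    have [_ /(_ x0 center_norm_ball)] := envelopeP x0 (ltW (w0 0)).
    move=> /le_trans; apply; rewrite /penalized subrr [dotp 0 0]dotpE big1.
      by rewrite mulr0 addr0.
    by move=> j _; rewrite !mxE mul0r.
  have iN' : (i <= N.+1)%N by exact: ltnW.
  have [gam Pg hg] := IH iN'.
  have [xh [Kxh Xr E hmin]] := near_min i gam Pg iN'.
  set s := i%:R * h in hg Xr E hmin.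
  have s0 : 0 <= s by rewrite mulr_ge0.
  have sT : s <= Th by exact: ihT.
  have yr : `|traj gam s - x0| <= r by apply: stay; [exact: Pc|rewrite s0].
  have xh2 : `|xh - x0| < 2 * r.
    rewrite -(subrKA (traj gam s)) (le_lt_trans (ler_normD _ _))//.
    by rewrite (le_lt_trans (lerD Xr yr))//; lra.
  have near_xh : \forall z \near xh, penalized (w i) (traj gam s) xh <= penalized (w i) (traj gam s) z.
    apply/nbhs_ballP; exists (2 * r - `|xh - x0|) => /=; first by rewrite subr_gt0.
    move=> z; rewrite -ball_normE /ball_/= => hz; apply: hmin; rewrite /K/=.
    rewrite -(subrKA xh) (le_trans (ler_normD _ _))// [`|z - xh|]distrC; lra.
  have [gam' [Pg' agr cond]] := H eta gam s (w i) xh eta0 Pg s0 sT (w0 i) xh2 near_xh.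
  exists gam' => //.
  have ss : 0 <= s <= s by rewrite s0 lexx.
  have agr' t : 0 <= t < s -> gam t = gam' t by move=> /andP[_ ts]; rewrite agr.
  have trE : traj gam s = traj gam' s := trajectory_causal cs x0 (Pc _ Pg) (Pc _ Pg') agr' ss.
  have rcE : rcost gam s = rcost gam' s := run_cost_causal cs x0 (Pc _ Pg) (Pc _ Pg') agr' ss.
  have sh : i.+1%:R * h = s + h by rewrite -natr1 mulrDl mul1r.
  have shT : s + h <= Th by rewrite -sh ihT.
  have hF x a : `|x - x0| <= 2 * r -> A a -> `|f x a| <= F.
    by move=> xr Aa; rewrite (le_trans (hM _ _ Aa))// ler_pM2l// lerD2l inball.
  have hL' x x' a : `|x - x0| <= 2 * r -> `|x' - x0| <= 2 * r -> A a ->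
     `|f x a - f x' a| <= L * `|x - x'| /\ `|l x a - l x' a| <= L * `|x - x'|.
    by move=> xr xr' Aa; apply: hL => //; exact: inball.
  have hLam' x a : `|x - x0| <= 2 * r -> A a -> l x a <= Lam.
    by move=> xr Aa; apply: hLam => //; exact: inball.
  rewrite trE in cond.
  have cond' u : s <= u <= s + h -> w i * dotp (traj gam' s - xh) (f xh (gam' u)) <=
     l xh (gam' u) * g xh + eta by move=> /andP[su _]; exact: cond.
  have [dL0 dLh stp] := aiming_step (Pc _ Pg') s0 h0 shT (w0 i) (ltW L0) F0 hF hL' hLam'
    Kxh (erefl k) kh1 cond'.
  rewrite sh.
  set dL := rcost gam' (s + h) - rcost gam' s in dL0 dLh stp.
  have rcD : rcost gam' (s + h) = rcost gam' s + dL by rewrite /dL addrCA subrr addr0.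
  have w' : w i.+1 = w i * (1 - k * h) by rewrite /w exprSr mulrA.
  rewrite -trE in stp.
  have stp2 : envelope (w i.+1) (traj gam' (s + h)) <=
      envelope (w i) (traj gam s) * (1 + dL) + h * (eta + L * rho1 + h * (C - Lam ^+ 2)).
    have [_ /(_ xh Kxh)] := envelopeP (traj gam' (s + h)) (ltW (w0 i.+1)).
    move=> /le_trans; apply; rewrite w' E (le_trans stp)// lerD2l ler_wpM2l//.
    have wX : w i * `|xh - traj gam s| <= W * rho1 by rewrite ler_pM// ltW.
    have e1 : n%:R * L * (w i * `|xh - traj gam s|) * F * h <= n%:R * L * (W * rho1) * F * h.
      by rewrite ler_wpM2r// ler_wpM2r// ler_wpM2l// mulr_ge0// ltW.
    have e2 : L * `|xh - traj gam s| <= L * rho1 by rewrite ler_pM2l.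
    have e3 : k * h * (n%:R * (w i * `|xh - traj gam s|) * F) <= k * h * (n%:R * (W * rho1) * F).
      by apply: ler_wpM2l; [nneg|apply: ler_wpM2r => //; exact: ler_wpM2l].
    have e4 : w i * n%:R * F ^+ 2 * h / 2 <= W * n%:R * F ^+ 2 * h / 2.
      by rewrite !ler_wpM2r ?invr_ge0 ?exprn_ge0.
    have -> : h * (C - Lam ^+ 2) = n%:R * L * (W * rho1) * F * h + L * F * h +
      k * h * (n%:R * (W * rho1) * F) + W * n%:R * F ^+ 2 * h / 2 by rewrite /C; ring.
    lra.
  have env1 : -1 <= envelope (w i) (traj gam s).
    rewrite E /penalized; have := g_bounded Kxh; rewrite ler_norml => /andP[g1 _].
    by rewrite (le_trans g1)// lerDl mulr_ge0 ?dotp_ge0// divr_ge0// ltW.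
  have disc := discount_step dL0 env1.
  rewrite rcD opprD expRD -mulrA -rcE.
  have rc1 : expR (- rcost gam s) <= 1.
    by rewrite -expR0 ler_expR oppr_le0 (run_cost_ge0 cs)//; exact: Pc.
  have dl1 : expR (- dL) <= 1 by rewrite -expR0 ler_expR oppr_le0.
  set Ev := envelope (w i) (traj gam s) in hg stp2 disc env1 *.
  set e1 := eta + L * rho1 + h * (C - Lam ^+ 2) in stp2.
  have e10 : 0 <= e1.
    by rewrite /e1 /C addrK; nneg.
  have t1 : expR (- dL) * envelope (w i.+1) (traj gam' (s + h)) <= Ev + (dL ^+ 2 + h * e1).
    rewrite (le_trans (ler_wpM2l (expR_ge0 _) stp2))// mulrDr [in leRHS]addrA lerD//.
    by rewrite ler_piMl// mulr_ge0.
  have t2 : 0 <= dL ^+ 2 + h * e1 by rewrite addr_ge0 ?sqr_ge0 ?mulr_ge0.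
  rewrite (le_trans (ler_wpM2l (expR_ge0 _) t1))// mulrDr.
  (* The summand [Lam ^+ 2] of [C] is reserved for the error [dL ^+ 2] made in discounting. *)
  have t3 : expR (- rcost gam s) * (dL ^+ 2 + h * e1) <= h * err.
    rewrite (@le_trans _ _ (dL ^+ 2 + h * e1))// ?ler_piMl//.
    have : dL ^+ 2 <= (Lam * h) ^+ 2 by rewrite lerXn2r ?nnegrE// mulr_ge0.
    have -> : h * err = h * e1 + (Lam * h) ^+ 2 by rewrite /err /e1; ring.
    by move=> h2; rewrite addrC lerD2l.
  by rewrite mulrDl addrA lerD.
have [gam Pg hg] := iter N.+1 (leqnn _).
have [xh [Kxh Xr E _]] := near_min N.+1 gam Pg (leqnn _).
exists gam, xh; rewrite hNT in hg Xr E; split => //.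
  exact: le_trans rho1rho.
apply: (@le_trans _ _ (expR (- rcost gam Th) * envelope (w N.+1) (traj gam Th))).
  rewrite ler_wpM2l ?expR_ge0// E /penalized lerDl mulr_ge0 ?dotp_ge0// divr_ge0//.
  exact: ltW.
rewrite (le_trans hg)// lerD2l /err.
have eT : Th * eta <= rho / 3.
  rewrite /eta mulrCA ler_pM2l//.
  rewrite ler_pdivrMr ?mulr_gt0 ?ltr_wpDl// mulrA mulVf ?pnatr_eq0// mul1r lerDl//.
rewrite (_ : Th * (eta + L * rho1 + h * C) = Th * eta + L * Th * rho1 + Th * (h * C)); last by ring.
rewrite (le_trans (lerD (lerD eT rho1L) hN2))//.
by rewrite le_eqVlt; apply/orP; left; apply/eqP; field.
Qed.

End Aiming.

Local Opaque trajectory.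

(** * The value function *)

Section ExitTime.
Context {R : realType} {n m : nat}.
Variables (A : set 'rV[R]_m) (T : set 'rV[R]_n)
  (f : 'rV[R]_n -> 'rV[R]_m -> 'rV[R]_n) (l : 'rV[R]_n -> 'rV[R]_m -> R).
Hypothesis cs : control_system A f l.
Hypothesis closedT : closed T.
Implicit Types (x y z p : 'rV[R]_n) (alpha beta gam : R -> 'rV[R]_m) (s t c : R).
Local Notation mu := (@lebesgue_measure R).
Local Notation exit := (exit_time T f).
Local Notation rcost := (run_cost f l).
Local Notation half_line := (`[0%R, +oo[%classic : set R).

Lemma before_exit x alpha t : 0 <= t -> (t%:E < exit x alpha)%E ->
  ~ T (trajectory f x alpha t).
Proof.
move=> t0 te Tt; have : (exit x alpha <= t%:E)%E by apply: ereal_inf_lbound; exists t.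
by rewrite leNgt te.
Qed.

Lemma exit_ge0 x alpha : (0 <= exit x alpha)%E.
Proof. by apply: le_ereal_inf_tmp => _ [t [t0 _] <-]; rewrite lee_fin. Qed.

(** The complement of [T] is open, so the trajectory stays outside for a little longer than [t];
    this makes the inequality strict. *)
Lemma lt_exit x alpha t : control A alpha -> 0 <= t ->
  (forall s, 0 <= s <= t -> ~ T (trajectory f x alpha s)) -> (t%:E < exit x alpha)%E.
Proof.
move=> ca t0 nT.
have /subspace_continuousP cy := trajectory_continuous cs x ca.
have tH : half_line t by rewrite /= in_itv/= t0.
have nTt : nbhs (trajectory f x alpha t) (~` T).
  by apply: open_nbhs_nbhs; split; [exact: closed_openC|apply: nT; rewrite t0 lexx].
have := cy t tH _ nTt.
rewrite -[X in X -> _]/(nbhs t (fun s => half_line s -> ~ T (trajectory f x alpha s))).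
move=> /nbhs_ballP[d /= d0 hd].
apply: (@lt_le_trans _ _ (t + d)%:E); first by rewrite lte_fin ltrDl.
apply: le_ereal_inf_tmp => _ [s [s0 Ts] <-]; rewrite lee_fin leNgt; apply/negP => sd.
have [st|ts] := leP s t; first by apply: (nT s); rewrite ?s0.
apply: (hd s) => //; last by rewrite /= in_itv/= s0.
rewrite -ball_normE /ball_/= ltr0_norm; first by lra.
by rewrite subr_lt0.
Qed.

Lemma exit_gt0 x alpha : control A alpha -> ~ T x -> (0 < exit x alpha)%E.
Proof.
move=> ca nT; apply: lt_exit => // s; rewrite -eq_le => /eqP <-.
by rewrite (trajectory0 cs).
Qed.

Lemma exit_shift x alpha s : control A alpha -> 0 <= s -> (s%:E < exit x alpha)%E ->
  exit x alpha = (s%:E + exit (trajectory f x alpha s) (fun u => alpha (s + u)%R))%E.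
Proof.
move=> ca s0 se; apply/eqP; rewrite eq_le; apply/andP; split.
  rewrite -leeBlDl//; apply: le_ereal_inf_tmp => z [t [t0]].
  rewrite (trajectory_shift cs)// => Tst <-.
  rewrite leeBlDl// -EFinD; apply: ereal_inf_lbound; exists (s + t) => //.
  by split => //; rewrite addr_ge0.
apply: le_ereal_inf_tmp => _ [t [t0 Tt] <-].
have st : s <= t.
  rewrite leNgt; apply/negP => ts.
  by apply: (@before_exit x alpha t) => //; rewrite (lt_trans _ se)// lte_fin.
rewrite -leeBrDl//; apply: ereal_inf_lbound; exists (t - s) => //=.
  by split; rewrite ?subr_ge0// (trajectory_shift cs) ?subr_ge0// subrKC.
Qed.

Lemma exit_agree x y alpha beta :
  (forall t, 0 <= t -> trajectory f x alpha t = trajectory f y beta t) ->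
  exit x alpha = exit y beta.
Proof.
move=> agr; congr ereal_inf; apply/seteqP; split => _ [t [t0 Tt] <-]; exists t => //.
  by split => //; rewrite -agr.
by split => //; rewrite agr.
Qed.

Local Opaque exit_time.

Lemma integral_run_cost x alpha t : control A alpha ->
  (\int[mu]_(s in `[0%R, t]) (l (trajectory f x alpha s) (alpha s))%:E)%E =
  (rcost x alpha t)%:E.
Proof.
move=> ca; rewrite /run_cost /RI /Rintegral fineK//.
apply: integrable_fin_num => //.
exact: (locbm_integrable _ (run_cost_locbm cs x ca) (lexx 0)).
Qed.

(** Replaces an extended integral up to a possibly infinite exit time by real integrals over finite
    intervals; for [tau = +oo] this is monotone convergence. *)
Lemma cost_leP x alpha (tau : \bar R) c : control A alpha -> (0 <= tau)%E ->
  (cost f l tau x alpha <= c%:E)%E <->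
  (forall t, 0 <= t -> (t%:E <= tau)%E -> rcost x alpha t <= c).
Proof.
move=> ca tau0.
have lc := run_cost_locbm cs x ca.
have l0 s : half_line s -> (0 <= (l (trajectory f x alpha s) (alpha s))%:E)%E.
  rewrite /= in_itv/= andbT lee_fin => s0.
  by apply: (cs_cost_ge0 cs); exact: ca.1.
have ml : measurable_fun half_line (fun s => (l (trajectory f x alpha s) (alpha s))%:E).
  by apply/measurable_EFinP; exact: lc.1.
case: tau tau0 => [r| |]// tau0.
  have -> : cost f l r%:E x alpha = (rcost x alpha r)%:E.
    rewrite -integral_run_cost// /cost; congr (integral _ _ _).
    by apply/seteqP; split => s /=; rewrite in_itv/= lee_fin => /andP.
  rewrite lee_fin; split => [h t t0|h]; last by apply: h.
  by rewrite lee_fin => tr; rewrite (le_trans _ h)// (run_cost_le cs).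
have -> : cost f l +oo%E x alpha =
    (\int[mu]_(s in half_line) (l (trajectory f x alpha s) (alpha s))%:E)%E.
  rewrite /cost; congr (integral _ _ _).
  apply/seteqP; split => s /=; rewrite in_itv/= andbT; first by case.
  by move=> s0; split => //; rewrite leey.
split => [h t t0 _|h].
  rewrite -lee_fin -integral_run_cost// (le_trans _ h)//.
  apply: ge0_subset_integral => //.
  by move=> s /=; rewrite !in_itv/= andbT => /andP[].
pose F (i : nat) : set (measurableTypeR R) := `[0%R, i%:R]%classic.
have UF : \bigcup_i F i = half_line.
  apply/seteqP; split => [s [i _]|s]; rewrite /F /= !in_itv/=.
    by move=> /andP[->].
  rewrite andbT => s0; exists (Num.truncn s).+1 => //=.
  by rewrite in_itv/= s0 ltW// truncnS_gt.
rewrite -UF; have := @ge0_nondecreasing_set_cvg_integral _ _ R F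
   (fun s => (l (trajectory f x alpha s) (alpha s))%:E) mu.
rewrite UF => /(_ _ _ _ _)/cvg_lim <-//.
- apply: lime_le.
    apply: ereal_nondecreasing_is_cvgn; apply: ge0_nondecreasing_set_nondecreasing_integral => //.
    + move=> i j ij; apply/subsetPset => s; rewrite /F/= !in_itv/= => /andP[->/=].
      by move=> /le_trans; apply; rewrite ler_nat.
    + by move=> i; exact: measurable_itv.
    + move=> i; apply: measurable_funS ml => // s; rewrite /F/= !in_itv/= andbT.
      by move=> /andP[].
    + by move=> i s; rewrite /F/= in_itv/= => /andP[s0 _]; apply: l0; rewrite /= in_itv/= s0.
  apply: nearW => i; rewrite /F integral_run_cost// lee_fin.
  by apply: h => //; rewrite leey.
- move=> i j ij; apply/subsetPset => s; rewrite /F/= !in_itv/= => /andP[->/=].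
  by move=> /le_trans; apply; rewrite ler_nat.
- by move=> i; exact: measurable_itv.
- move=> i; apply: measurable_funS ml => // s; rewrite /F/= !in_itv/= andbT.
  by move=> /andP[].
- by move=> i s; rewrite /F/= in_itv/= => /andP[s0 _]; apply: l0; rewrite /= in_itv/= s0.
Qed.

Local Opaque run_cost.

Lemma dist_ge0 y : (0 <= dist y T)%E.
Proof. by apply: le_ereal_inf_tmp => _ [z _ <-]; rewrite lee_fin sqrtr_ge0. Qed.

Local Opaque dist.

(** Treats finite and infinite exit times alike. *)
Lemma left_nbhsP (tau : \bar R) (V : set R) : (0 < tau)%E ->
  left_nbhs tau V <->
  exists2 t0, 0 <= t0 /\ (t0%:E < tau)%E & forall t, t0 < t -> (t%:E < tau)%E -> V t.
Proof.
case: tau => [r| |]//= r0; split.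
- move=> /nbhs_ballP[d /= d0 hd]; exists (Num.max 0 (r - d)).
    rewrite le_max lexx lte_fin gt_max; split => //.
    by move: r0; rewrite lte_fin => -> /=; lra.
  move=> t; rewrite gt_max lte_fin => /andP[t0 td] tr; apply: hd => //.
  by rewrite -ball_normE /ball_/= gtr0_norm ?subr_gt0//; lra.
- move=> [t0 [t00]]; rewrite lte_fin => t0r hV.
  apply/nbhs_ballP; exists (r - t0) => /=; first by rewrite subr_gt0.
  move=> t; rewrite -ball_normE /ball_/= => rt tr; apply: hV; last by rewrite lte_fin.
  by move: rt; rewrite gtr0_norm ?subr_gt0//; lra.
- move=> [M [_ hM]]; exists (Num.max 0 M); first by rewrite le_max lexx ltry.
  by move=> t; rewrite gt_max => /andP[_ Mt] _; exact: hM.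
- move=> [t0 _ hV]; exists t0; split; first exact: num_real.
  by move=> t t0t; apply: hV => //; rewrite ltry.
Qed.

(** As [dist] is nonnegative, only the upper bound in the equation for the lower limit carries
    information. *)
Lemma reachingP x alpha : ~ T x -> reaching A T f x alpha <->
  control A alpha /\
  forall d t0, 0 < d -> 0 <= t0 -> (t0%:E < exit x alpha)%E ->
    exists t, [/\ t0 < t, (t%:E < exit x alpha)%E &
                 (dist (trajectory f x alpha t) T < d%:E)%E].
Proof.
move=> nT; split => -[ca h]; split => //.
  move=> d t0 d0 t00 te.
  pose V := [set t | t0 < t /\ (t%:E < exit x alpha)%E].
  have FV : left_nbhs (exit x alpha) V.
    by apply/left_nbhsP; [exact: exit_gt0|exists t0].
  have : (ereal_inf [set dist (trajectory f x alpha t) T | t in V] < d%:E)%E.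
    apply: (@le_lt_trans _ _ 0%E); last by rewrite lte_fin.
    by rewrite -h limf_einfE; apply: ereal_sup_ubound; exists V.
  by move=> /ereal_inf_lt[_ [t [t0t te'] <-] dd]; exists t.
apply/eqP; rewrite limf_einfE eq_le; apply/andP; split.
  apply: ge_ereal_sup => z [V /left_nbhsP].
  move=> /(_ (exit_gt0 ca nT))[t0 [t00 te] hV] <-.
  apply/lee_addgt0Pr => e e0; rewrite add0e.
  have [t [t0t te' dd]] := h e t0 e0 t00 te.
  apply: (le_trans _ (ltW dd)); apply: ereal_inf_lbound; exists t => //.
  exact: hV.
apply: (@le_trans _ _ (ereal_inf [set dist (trajectory f x alpha t) T | t in setT])).
  by apply: le_ereal_inf_tmp => _ [t _ <-]; exact: dist_ge0.
apply: ereal_sup_ubound; exists setT => //.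
by apply/left_nbhsP; [exact: exit_gt0|exists 0 => //; split => //; exact: exit_gt0].
Qed.

Lemma reaching_shift x alpha s : control A alpha -> ~ T x -> 0 <= s ->
  (s%:E < exit x alpha)%E ->
  reaching A T f x alpha <->
  reaching A T f (trajectory f x alpha s) (fun u => alpha (s + u)).
Proof.
move=> ca nT s0 se.
have nTs := before_exit s0 se.
have ca' := control_shift s0 ca.
have E t : (t%:E < exit (trajectory f x alpha s) (fun u => alpha (s + u)%R))%E =
    ((s + t)%:E < exit x alpha)%E.
  by rewrite (exit_shift ca s0 se) EFinD lteD2lE.
split => [/(reachingP _ nT).1[_ h]|/(reachingP _ nTs).1[_ h]];
  [apply: (reachingP _ nTs).2|apply: (reachingP _ nT).2]; (split; first by []);
  move=> d t0 d0 t00.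
  rewrite E => te; have [t [t0t te' dd]] := h d (s + t0) d0 (addr_ge0 s0 t00) te.
  have ts : 0 <= t - s by lra.
  exists (t - s); split; first by lra.
    by rewrite E subrKC.
  by rewrite (trajectory_shift cs)// subrKC.
move=> te; pose t1 := Num.max 0 (t0 - s).
have t1e : (t1%:E < exit (trajectory f x alpha s) (fun u => alpha (s + u)%R))%E.
  by rewrite E /t1; case: (leP 0 (t0 - s)) => _; rewrite ?addr0// subrKC.
have t10 : 0 <= t1 by rewrite le_max lexx.
have [t [t1t te' dd]] := h d t1 d0 t10 t1e.
have t00' : 0 <= t by rewrite ltW// (le_lt_trans t10).
exists (s + t); split.
- have : t0 - s <= t1 by rewrite le_max lexx orbT.
  by lra.
- by rewrite -E.
- by rewrite -(trajectory_shift cs).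
Qed.

(* only used for [u >= 0]: the value at -oo is junk *)
Definition expNe (u : \bar R) : R := if u is r%:E then expR (- r) else 0.

Definition disc_value x : R := expNe (value A T f l x).

Lemma value_ge0 x : (0 <= value A T f l x)%E.
Proof.
rewrite /value; case: ifP => // _; apply: le_ereal_inf_tmp => _ [alpha [ca _] <-].
rewrite /cost; apply: integral_ge0 => s /= [s0 _]; rewrite lee_fin.
by apply: (cs_cost_ge0 cs); exact: ca.1.
Qed.

Lemma disc_value_ge0 x : 0 <= disc_value x.
Proof. by rewrite /disc_value; case: value => //= r; rewrite expR_ge0. Qed.

Lemma disc_value_le1 x : disc_value x <= 1.
Proof.
rewrite /disc_value; have := value_ge0 x; case: value => //= r; rewrite lee_fin => r0.
by rewrite -expR0 ler_expR oppr_le0.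
Qed.

Lemma disc_value_target x : T x -> disc_value x = 1.
Proof. by move=> Tx; rewrite /disc_value /value mem_set//= oppr0 expR0. Qed.

Lemma expNe_ge (u : \bar R) c : (0 <= u)%E -> (u <= c%:E)%E -> expR (- c) <= expNe u.
Proof. by case: u => //= r _; rewrite lee_fin => rc; rewrite ler_expR lerN2. Qed.

Lemma disc_value_ge_reaching x alpha c : ~ T x -> reaching A T f x alpha ->
  (forall t, 0 <= t -> (t%:E <= exit x alpha)%E -> rcost x alpha t <= c) ->
  expR (- c) <= disc_value x.
Proof.
move=> nT ra h; apply: expNe_ge; first exact: value_ge0.
rewrite /value memNset//; apply: ge_ereal_inf.
exists (cost f l (exit x alpha) x alpha); first by exists alpha.
by apply/cost_leP => //; [exact: ra.1|exact: exit_ge0].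
Qed.

Lemma disc_value_ge_control x alpha c : value A T f l x = value_m A T f l x ->
  ~ T x -> control A alpha ->
  (forall t, 0 <= t -> (t%:E <= exit x alpha)%E -> rcost x alpha t <= c) ->
  expR (- c) <= disc_value x.
Proof.
move=> vE nT ca h; apply: expNe_ge; first exact: value_ge0.
rewrite vE /value_m memNset//; apply: ge_ereal_inf.
exists (cost f l (exit x alpha) x alpha); first by exists alpha.
by apply/cost_leP => //; exact: exit_ge0.
Qed.

Lemma disc_value_approx x (e : R) : ~ T x -> 0 < disc_value x -> 0 < e ->
  exists alpha c, [/\ reaching A T f x alpha,
    forall t, 0 <= t -> (t%:E <= exit x alpha)%E -> rcost x alpha t <= c &
    disc_value x - e <= expR (- c)].
Proof.
move=> nT; rewrite /disc_value; have := value_ge0 x; case E : value => [r| |]//= r0 h0 e0; last by rewrite ltxx in h0.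
  have := E; rewrite /value memNset// => E'.
  have : (ereal_inf [set cost f l (exit x alpha) x alpha | alpha in reaching A T f x] < (r + e)%:E)%E.
    by rewrite E' lte_fin ltrDl.
  move=> /ereal_inf_lt[_ [alpha ra <-] ce]; exists alpha, (r + e); split => //.
    apply/cost_leP; [exact: ra.1|exact: exit_ge0|exact: ltW].
  rewrite opprD expRD; have h1 : 1 + - e <= expR (- e) := expR_ge1Dx _.
  have h2 : expR (- r) <= 1.
    by rewrite -expR0 ler_expR oppr_le0 -lee_fin.
  have h3 := expR_ge0 (- r).
  have : expR (- r) * (1 - e) <= expR (- r) * expR (- e) by rewrite ler_wpM2l.
  by nra.
Qed.

(** One half of the dynamic programming principle: an almost optimal control for the position at
    time [s] is spliced after [alpha]. *)
Lemma disc_value_shift x alpha s : ~ T x -> control A alpha -> 0 <= s ->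
  (s%:E < exit x alpha)%E ->
  expR (- rcost x alpha s) * disc_value (trajectory f x alpha s) <= disc_value x.
Proof.
move=> nT ca s0 se; set y := trajectory f x alpha s.
have nTy : ~ T y := before_exit s0 se.
have Ey := expR_ge0 (- rcost x alpha s).
have E1 : expR (- rcost x alpha s) <= 1.
  by rewrite -expR0 ler_expR oppr_le0 (run_cost_ge0 cs).
(* If the value at [y] is infinite there may be no reaching control to splice, but then the
   left-hand side is 0. *)
have := disc_value_ge0 y; rewrite le_eqVlt => /predU1P[<-|y0].
  by rewrite mulr0 disc_value_ge0.
apply/ler_addgt0Pr => e e0.
have [beta [c [rb hc yc]]] := disc_value_approx nTy y0 e0.
have cb := rb.1.
pose gam := splice s alpha beta.
have cg : control A gam := control_splice s0 ca cb.
have ys : trajectory f x gam s = y by rewrite (trajectory_splice_le cs)//.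
have sg : (s%:E < exit x gam)%E.
  apply: lt_exit => // t /andP[t0 ts]; rewrite (trajectory_splice_le cs)//.
  by apply: before_exit => //; rewrite (le_lt_trans _ se)// lee_fin.
have agr t : 0 <= t -> trajectory f y (fun u => gam (s + u)) t = trajectory f y beta t.
  move=> t0; have tt : 0 <= t <= t by rewrite t0 lexx.
  apply: (trajectory_causal cs y (control_shift s0 cg) cb _ tt).
  by move=> u /andP[u0 _]; rewrite /gam splice_add.
have exE : exit y (fun u => gam (s + u)) = exit y beta.
  exact: exit_agree.
have exg : exit x gam = (s%:E + exit y beta)%E.
  by rewrite (exit_shift cg s0 sg) ys exE.
have rg : reaching A T f x gam.
  apply: (reaching_shift cg nT s0 sg).2; rewrite ys.
  have ca' := control_shift s0 cg.
  apply: (reachingP _ nTy).2; split; first by [].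
  move=> d t0 d0 t00; rewrite exE => te.
  have [_ h] := (reachingP _ nTy).1 rb.
  have [t [t0t te' dd]] := h d t0 d0 t00 te.
  exists t; split; [exact: t0t|exact: te'|].
  by rewrite (agr t (ltW (le_lt_trans t00 t0t))).
have : expR (- (rcost x alpha s + c)) <= disc_value x.
  apply: (disc_value_ge_reaching nT rg) => t t0 te.
  have c0 : 0 <= c.
    have := hc 0 (lexx 0) (exit_ge0 _ _); rewrite run_cost0; exact.
  have [ts|st] := leP t s.
    rewrite (run_cost_splice_le cs x ca cb t0 ts).
    by apply: le_trans (run_cost_le cs x ca t0 ts) _; rewrite lerDl.
  have ts0 : 0 <= t - s by rewrite subr_ge0 ltW.
  have := run_cost_splice_add cs x ca cb s0 ts0; rewrite subrKC => ->.
  rewrite lerD2l; apply: hc; first by [].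
  by move: te; rewrite exg EFinB leeBlDl.
rewrite opprD expRD => h1.
have h2 := ler_wpM2l Ey yc; have h3 := ler_piMl (ltW e0) E1.
move: (expR (- rcost x alpha s)) (expR (- c)) (disc_value x) (disc_value y) h1 h2 h3.
by move=> a b u v h1; rewrite mulrBr => h2 h3; lra.
Qed.

(** The other half of dynamic programming: the tail of an almost optimal control is still reaching
    from the position at time [s]. *)
Lemma disc_value_dpp x (e s : R) : ~ T x -> 0 < disc_value x -> 0 < e -> 0 <= s ->
  (forall gam, control A gam -> (s%:E < exit x gam)%E) ->
  exists2 alpha, control A alpha &
  disc_value x - e <= expR (- rcost x alpha s) * disc_value (trajectory f x alpha s).
Proof.
move=> nT x0 e0 s0 hs.
have [alpha [c [ra hc xc]]] := disc_value_approx nT x0 e0.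
have ca := ra.1; have se := hs _ ca.
exists alpha => //; set y := trajectory f x alpha s.
have nTy : ~ T y := before_exit s0 se.
have ry : reaching A T f y (fun u => alpha (s + u)) := (reaching_shift ca nT s0 se).1 ra.
have : expR (- (c - rcost x alpha s)) <= disc_value y.
  apply: (disc_value_ge_reaching nTy ry) => t t0 te.
  have : rcost x alpha (s + t) <= c.
    apply: hc; first exact: addr_ge0.
    by rewrite (exit_shift ca s0 se) EFinD leeD2lE.
  by rewrite (run_cost_add cs)// -/y; lra.
rewrite opprB addrC expRD [_ (- c)]/= => h.
rewrite (le_trans xc)// -(@ler_pM2l _ (expR (rcost x alpha s))) ?expR_gt0//.
by rewrite [in leRHS]mulrA -[in leRHS]expRD subrr expR0 mul1r mulrC.
Qed.

End ExitTime.

(** * Viscosity properties of the value *)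

Section Envelopes.
Context {R : realType} {n : nat}.
Implicit Types (x z : 'rV[R]_n) (D : set 'rV[R]_n) (W : 'rV[R]_n -> R) (a c e : R).

Lemma within_self D x : D x -> forall P, within D (nbhs x) P -> P x.
Proof. by move=> Dx P /nbhs_singleton; exact. Qed.

(** The bound on [W] makes the lower limit finite, so that [fine] loses nothing. *)
Lemma lsc_env_fin D W c x : (forall z, D z -> `|W z| <= c) -> D x ->
  limf_einf (EFin \o W) (within D (nbhs x)) = (lsc_env D W x)%:E.
Proof.
move=> Wc Dx; rewrite /lsc_env fineK//.
have lo : ((- c)%:E <= limf_einf (EFin \o W) (within D (nbhs x)))%E.
  rewrite limf_einfE; apply: (@le_trans _ _ (ereal_inf [set (EFin \o W) z | z in D])).
    apply: le_ereal_inf_tmp => _ [z Dz <-]; rewrite lee_fin.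
    by have := Wc z Dz; rewrite ler_norml => /andP[].
  by apply: ereal_sup_ubound; exists D => //; exact: withinT.
have hi : (limf_einf (EFin \o W) (within D (nbhs x)) <= c%:E)%E.
  rewrite limf_einfE; apply: ge_ereal_sup => u [V FV <-].
  apply: (@le_trans _ _ (W x)%:E).
    by apply: ereal_inf_lbound; exists x => //; exact: within_self FV.
  by rewrite lee_fin; have := Wc x Dx; rewrite ler_norml => /andP[].
by rewrite fin_numE -ltNye -ltey (lt_le_trans (ltNyr _) lo) (le_lt_trans hi (ltry _)).
Qed.

Lemma lsc_env_ge D W c x a : (forall z, D z -> `|W z| <= c) -> D x ->
  (\forall z \near x, D z -> a <= W z) -> a <= lsc_env D W x.
Proof.
move=> Wc Dx h; rewrite -lee_fin -(lsc_env_fin Wc Dx) limf_einfE.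
apply: (@le_trans _ _ (ereal_inf [set (EFin \o W) z | z in [set z | a <= W z]])).
  by apply: le_ereal_inf_tmp => _ [z az <-]; rewrite lee_fin.
by apply: ereal_sup_ubound; exists [set z | a <= W z].
Qed.

Lemma lsc_env_near D W c x e : (forall z, D z -> `|W z| <= c) -> D x -> 0 < e ->
  \forall z \near x, D z -> lsc_env D W x - e < W z.
Proof.
move=> Wc Dx e0.
have : ((lsc_env D W x - e)%:E < limf_einf (EFin \o W) (within D (nbhs x)))%E.
  by rewrite (lsc_env_fin Wc Dx) lte_fin ltrBlDr ltrDl.
rewrite limf_einfE => /ereal_sup_gt[_ [V FV <-] hV].
have FV' : nbhs x (fun z => D z -> V z) := FV.
apply: filterS FV' => z Vz Dz; rewrite -lte_fin (lt_le_trans hV)//.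
by apply: ereal_inf_lbound; exists z => //; exact: Vz.
Qed.

Lemma lsc_env_le D W c x : (forall z, D z -> `|W z| <= c) -> D x -> lsc_env D W x <= W x.
Proof.
move=> Wc Dx; apply/ler_addgt0Pr => e e0; rewrite -lerBlDr ltW//.
exact: (nbhs_singleton (lsc_env_near Wc Dx e0)).
Qed.

Lemma lsc_env_approx D W c x e (B : set 'rV[R]_n) : (forall z, D z -> `|W z| <= c) -> D x ->
  0 < e -> nbhs x B -> exists z, [/\ B z, D z & W z < lsc_env D W x + e].
Proof.
move=> Wc Dx e0 Bx; apply: contrapT => /forallNP h.
suff : lsc_env D W x + e <= lsc_env D W x by lra.
apply: (lsc_env_ge Wc Dx); apply: filterS Bx => z Bz Dz.
by rewrite leNgt; apply/negP => zz; exact: (h z).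
Qed.

Lemma lsc_env_lsc D W c x e : (forall z, D z -> `|W z| <= c) -> nbhs x D -> 0 < e ->
  \forall z \near x, lsc_env D W x - e < lsc_env D W z.
Proof.
move=> Wc nD e0; have e20 : 0 < e / 2 by rewrite divr_gt0.
have h : nbhs x (D `&` [set z | D z -> lsc_env D W x - e / 2 < W z]).
  by apply: filterI => //; exact: (lsc_env_near Wc (nbhs_singleton nD) e20).
apply: filterS (nbhs_interior h) => z hz; have [Dz _] := nbhs_singleton hz.
rewrite (@lt_le_trans _ _ (lsc_env D W x - e / 2))//; first by lra.
apply: (lsc_env_ge Wc Dz); apply: filterS hz => u [_ hu] Du; exact/ltW/hu.
Qed.

(** Through this identity the properties of the upper envelope are read off from those of the lower
    one. *)
Lemma usc_envE D W x : usc_env D W x = - lsc_env D (fun z => - W z) x.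
Proof.
rewrite /usc_env /lsc_env -[X in fine (limf_esup X _)](_ : (\- (EFin \o (fun z => (- W z)%R)))%E = _).
  by rewrite limf_esupN fineN.
by apply/funext => z /=; rewrite opprK.
Qed.

Lemma norm_opp_bound D W c : (forall z, D z -> `|W z| <= c) -> forall z, D z -> `|- W z| <= c.
Proof. by move=> h z /h; rewrite normrN. Qed.

Lemma usc_env_le D W c x a : (forall z, D z -> `|W z| <= c) -> D x ->
  (\forall z \near x, D z -> W z <= a) -> usc_env D W x <= a.
Proof.
move=> Wc Dx h; rewrite usc_envE lerNl; apply: (lsc_env_ge (norm_opp_bound Wc) Dx).
by apply: filterS h => z h Dz; rewrite lerN2 h.
Qed.

Lemma usc_env_near D W c x e : (forall z, D z -> `|W z| <= c) -> D x -> 0 < e ->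
  \forall z \near x, D z -> W z < usc_env D W x + e.
Proof.
move=> Wc Dx e0; have := lsc_env_near (norm_opp_bound Wc) Dx e0.
apply: filterS => z h Dz; rewrite usc_envE.
by have := h Dz; lra.
Qed.

Lemma usc_env_ge D W c x : (forall z, D z -> `|W z| <= c) -> D x -> W x <= usc_env D W x.
Proof.
by move=> Wc Dx; rewrite usc_envE lerNr; exact: (lsc_env_le (norm_opp_bound Wc) Dx).
Qed.

Lemma usc_env_approx D W c x e (B : set 'rV[R]_n) : (forall z, D z -> `|W z| <= c) -> D x ->
  0 < e -> nbhs x B -> exists z, [/\ B z, D z & usc_env D W x - e < W z].
Proof.
move=> Wc Dx e0 Bx; have [z [Bz Dz h]] := lsc_env_approx (norm_opp_bound Wc) Dx e0 Bx.
by exists z; split => //; rewrite usc_envE; lra.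
Qed.

Lemma usc_env_usc D W c x e : (forall z, D z -> `|W z| <= c) -> nbhs x D -> 0 < e ->
  \forall z \near x, usc_env D W z < usc_env D W x + e.
Proof.
move=> Wc nD e0; have := lsc_env_lsc (norm_opp_bound Wc) nD e0.
by apply: filterS => z; rewrite !usc_envE; lra.
Qed.

Lemma derive_dotp (phi : 'rV[R]_n -> R) x v : differentiable phi x ->
  'D_v phi x = dotp (gradient phi x) v.
Proof.
move=> dphi; rewrite deriveE// {1}(row_sum_delta v) linear_sum dotpE.
apply: eq_bigr => i _; rewrite linearZ /= mxE deriveE//.
by rewrite /GRing.scale /= mulrC.
Qed.

(** The base point [u] has to vary, because an envelope at [x0] is only approached by values at
    nearby points. The mean value theorem on the segment and continuity of the gradient give the
    uniform estimate. *)
Lemma C1_strictly_differentiable (O : set 'rV[R]_n) (phi : 'rV[R]_n -> R) x0 e :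
  open O -> C1_on O phi -> O x0 -> 0 < e ->
  exists2 d, 0 < d & forall u v, `|u - x0| < d -> `|v - x0| < d ->
    `|phi v - phi u - dotp (gradient phi x0) (v - u)| <= e * `|v - u|.
Proof.
move=> oO C1 Ox0 e0.
have e'0 : 0 < e / n.+1%:R by rewrite divr_gt0.
have [_ /cvgrPdist_lt/(_ _ e'0) cg] := C1 x0 Ox0.
have nO : nbhs x0 O by exact: open_nbhs_nbhs.
have /nbhs_ballP[d /= d0 hd] :
    nbhs x0 ([set z | `|gradient phi x0 - gradient phi z| < e / n.+1%:R] `&` O).
  by apply: filterI.
exists d => // u v ux vx.
pose w : 'rV[R]_n := v - u; pose p (t : R) : 'rV[R]_n := u + t *: w.
have pin (t : R) : 0 <= t <= 1 -> ball x0 d (p t).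
  move=> /andP[t0 t1]; rewrite -ball_normE /ball_/=.
  have -> : x0 - p t = (1 - t) *: (x0 - u) + t *: (x0 - v).
    by rewrite /p /w; apply/rowP => i; rewrite !mxE; ring.
  have h1 : `|(1 - t) *: (x0 - u)| = (1 - t) * `|x0 - u|.
    by rewrite normrZ ger0_norm// subr_ge0.
  have h2 : `|t *: (x0 - v)| = t * `|x0 - v| by rewrite normrZ ger0_norm.
  rewrite (le_lt_trans (ler_normD _ _))// h1 h2 ![`|x0 - _|]distrC.
  have [t1'|t1'] := ltP t 1.
    have : (1 - t) * `|u - x0| < (1 - t) * d by rewrite ltr_pM2l// subr_gt0.
    have : t * `|v - x0| <= t * d by rewrite ler_wpM2l// ltW.
    by lra.
  have -> : t = 1 by apply/le_anti; rewrite t1.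
  by rewrite subrr mul0r add0r mul1r.
pose h (t : R) : R := phi (p t).
have dh (t : R) : 0 <= t <= 1 -> is_derive t 1 h (dotp (gradient phi (p t)) w).
  move=> t01; have [_ Op] := hd _ (pin t t01).
  have [dphi _] := C1 _ Op.
  have E : (fun s => s^-1 *: (h (s *: 1 + t) - h t)) = (fun s => s^-1 *: (phi (s *: w + p t) - phi (p t))).
    apply/funext => s; rewrite /h /p; congr (_ *: (phi _ - _)).
    by rewrite /GRing.scale /= mulr1; apply/rowP => i; rewrite !mxE; ring.
  apply: DeriveDef.
    by rewrite /derivable E; exact: diff_derivable.
  by rewrite /derive E -derive_dotp.
have [||c c01 E] := @MVT _ h (fun t => dotp (gradient phi (p t)) w) 0 1 ltr01.
- move=> t; rewrite in_itv/= => /andP[t0 t1]; apply: dh.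
  by rewrite (ltW t0) (ltW t1).
- apply: derivable_within_continuous => t; rewrite in_itv/= => t01.
  by have := dh t t01 => -[].
have c01' : 0 <= c <= 1 by move: c01; rewrite in_itv/= => /andP[/ltW -> /ltW ->].
have hv : h 1 = phi v by rewrite /h /p scale1r /w subrKC.
have hu : h 0 = phi u by rewrite /h /p scale0r addr0.
rewrite hv hu subr0 mulr1 in E.
have -> : phi v - phi u - dotp (gradient phi x0) (v - u) =
   - dotp (gradient phi x0 - gradient phi (p c)) w.
  by rewrite E dotpDl dotpNl -/w; ring.
rewrite normrN (le_trans (dotp_bound _ _))// -/w ler_wpM2r//.
have [hg _] := hd _ (pin c c01').
rewrite (le_trans (ler_wpM2l _ (ltW hg)))// mulrCA ler_piMr ?(ltW e0)//.
by rewrite ler_pdivrMr// mul1r ler_nat.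
Qed.

End Envelopes.

(** * The transformed value as a viscosity solution *)

Section Viscosity.
Context {R : realType} {n m : nat}.
Variables (A : set 'rV[R]_m) (T : set 'rV[R]_n)
  (f : 'rV[R]_n -> 'rV[R]_m -> 'rV[R]_n) (l : 'rV[R]_n -> 'rV[R]_m -> R).
Hypothesis cs : control_system A f l.
Hypothesis closedT : closed T.
Implicit Types (x y z p : 'rV[R]_n) (alpha beta gam : R -> 'rV[R]_m) (s t c e d : R).
Local Notation exit := (exit_time T f).
Local Notation rcost := (run_cost f l).

Lemma local_displacement x0 : exists2 c, 0 < c &
  forall x alpha t, `|x - x0| <= 1 -> control A alpha -> 0 <= t <= 1 ->
  `|trajectory f x alpha t - x| <= c * t.
Proof.
have [M M0 hM] := cs_growth cs.
exists (2 * (M * (2 + `|x0|)) * expR (2 * M)).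
  by rewrite !mulr_gt0 ?expR_gt0// ltr_wpDr.
move=> x alpha t xx0 ca /andP[t0 t1].
rewrite (le_trans (trajectory_displacement cs x ca M0 hM t0))//.
rewrite [leRHS]mulrAC ler_pM ?expR_ge0//.
- by rewrite !mulr_ge0 ?addr_ge0// ltW.
- rewrite mulrA [leRHS](_ : _ = 2 * (M * (2 + `|x0|)) * t); last by ring.
  rewrite ler_wpM2r// ler_pM2l// ler_pM2l//.
  have := ler_normD (x - x0) x0; rewrite subrK; lra.
- by rewrite ler_expR ler_piMr// mulr_ge0// ltW.
Qed.

Lemma trajectory_in_ball x0 d : 0 < d -> exists2 d', 0 < d' &
  forall x alpha t, `|x - x0| < d' -> control A alpha -> 0 <= t <= d' ->
  `|trajectory f x alpha t - x0| < d.
Proof.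
move=> d0; have [c c0 hc] := local_displacement x0.
exists (Num.min 1 (d / (c + 1))).
  by rewrite lt_min ltr01 divr_gt0// ltr_wpDl// ltW.
move=> x alpha t; rewrite lt_min => /andP[x1 xd] ca /andP[t0].
rewrite le_min => /andP[t1 td].
have := hc x alpha t (ltW x1) ca; rewrite t0 t1 => /(_ isT) h.
rewrite -(subrKA x) (le_lt_trans (ler_normD _ _))//.
have c10 : 0 < c + 1 by rewrite ltr_wpDl// ltW.
have : c * t <= c * (d / (c + 1)) by rewrite ler_pM2l.
have : d = c * (d / (c + 1)) + d / (c + 1) by field; rewrite gt_eqF.
by move: h xd; lra.
Qed.

Lemma stays_outside x0 : ~ T x0 -> exists2 d, 0 < d &
  forall x alpha t, `|x - x0| < d -> control A alpha -> 0 <= t <= d ->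
  (t%:E < exit x alpha)%E.
Proof.
move=> nT; have : nbhs x0 (~` T).
  by apply: open_nbhs_nbhs; split => //; exact: closed_openC.
move=> /nbhs_ballP[r /= r0 hr].
have [d d0 hd] := trajectory_in_ball x0 r0.
exists d => // x alpha t xd ca /andP[t0 td].
apply: (lt_exit cs closedT ca t0) => s /andP[s0 st].
apply: hr; rewrite -ball_normE /ball_/= distrC; apply: hd => //.
by rewrite s0 (le_trans st).
Qed.

Lemma expR_quadratic (u : R) : 0 <= u -> u <= 2^-1 -> expR u <= 1 + u + 2 * u ^+ 2.
Proof.
move=> u0 u1; have h1 : 1 - u <= expR (- u) := expR_ge1Dx _.
have u2 : 0 < 1 - u by lra.
have : expR u <= (1 - u)^-1.
  by rewrite -[expR u]invrK -expRN lef_pV2 ?posrE ?expR_gt0.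
move=> /le_trans; apply; rewrite -[leLHS]mul1r ler_pdivrMr//.
rewrite [leRHS](_ : _ = 1 + u ^+ 2 * (1 - 2 * u)); last by ring.
by rewrite lerDl mulr_ge0 ?sqr_ge0//; lra.
Qed.

(* Used with [g = Z] and with [g = - Z], whence both the sub- and the
   supersolution property of [1 - Z]. *)
Lemma dpp_infinitesimal (g psi : 'rV[R]_n -> R) (G0 eta : R) x0 p (A' : set 'rV[R]_m) :
  -1 <= G0 <= 1 -> 0 < eta -> A' `<=` A ->
  (forall e, 0 < e -> exists2 d, 0 < d & forall u v, `|u - x0| < d -> `|v - x0| < d ->
     `|psi v - psi u - dotp p (v - u)| <= e * `|v - u|) ->
  (\forall z \near x0, G0 + psi z - psi x0 <= g z) ->
  (exists2 t0, 0 < t0 & forall t e, 0 < t -> t < t0 -> 0 < e ->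
     exists x alpha, [/\ `|x - x0| < e, control A alpha, forall s, 0 <= s -> A' (alpha s),
       g x < G0 + e &
       expR (- rcost x alpha t) * g (trajectory f x alpha t) <= g x + e]) ->
  (forall a, A' a -> eta <= dotp p (f x0 a) - l x0 a * G0) -> False.
Proof.
move=> /andP[G1 G2] eta0 A'A hpsi /nbhs_ballP[dg /= dg0 hg] [t0 t00 hdpp] heta.
have [C C0 hC] := local_displacement x0.
have [L L0 hL] := cs_lipschitz cs (`|x0| + 1 + (C + 1)).
have [Lam Lam0 hLam] := running_cost_bounded cs (`|x0| + 1 + (C + 1)).
have n0 : 0 <= n%:R * `|p| :> R by rewrite mulr_ge0.
pose e1 := eta / (8 * C).
have e10 : 0 < e1 by rewrite divr_gt0// mulr_gt0.
have [d1 d10 hd1] := hpsi e1 e10.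
pose B := n%:R * `|p| * L * C + L * C + 2 * Lam ^+ 2.
have B0 : 0 <= B by rewrite /B; nneg.
pose dd := Num.min d1 dg.
have dd0 : 0 < dd by rewrite lt_min d10.
(* The time [t] is so short that errors of order [t ^+ 2] cost at most a quarter of [eta * t];
   afterwards the displacement [e] of the starting point is made small compared with [eta * t]. *)
pose t := Num.min (t0 / 2) (Num.min 1 (Num.min (dd / (2 * C)) (Num.min (1 / (2 * (Lam + 1))) (eta / (4 * (B + 1)))))).
have t_gt0 : 0 < t.
  by rewrite /t !lt_min ltr01 !divr_gt0 ?mulr_gt0 ?ltr_wpDl.
have [tt0 [tt1 [tt2 [tt3 tt4]]]] : t < t0 /\ t <= 1 /\ C * t <= dd / 2 /\
    Lam * t <= 2^-1 /\ B * t <= eta / 4.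
  have h1 : t <= t0 / 2 by rewrite /t ge_min lexx.
  have h2 : t <= 1 by rewrite /t !ge_min lexx ?orbT.
  have h3 : t <= dd / (2 * C) by rewrite /t !ge_min lexx ?orbT.
  have h4 : t <= 1 / (2 * (Lam + 1)) by rewrite /t !ge_min lexx ?orbT.
  have h5 : t <= eta / (4 * (B + 1)) by rewrite /t !ge_min lexx ?orbT.
  split; first by move: t00 h1; lra.
  split => //; split.
    have -> : dd / 2 = C * (dd / (2 * C)) by field; rewrite gt_eqF.
    by rewrite ler_pM2l.
  split.
    have L1 : 0 < Lam + 1 by rewrite ltr_wpDl.
    have : (Lam + 1) * t <= 2^-1.
      have -> : 2^-1 = (Lam + 1) * (1 / (2 * (Lam + 1))) by field; rewrite gt_eqF.
      by rewrite ler_pM2l.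
    by move: t_gt0; lra.
  have B1 : 0 < B + 1 by rewrite ltr_wpDl.
  have : (B + 1) * t <= eta / 4.
    have -> : eta / 4 = (B + 1) * (eta / (4 * (B + 1))) by field; rewrite gt_eqF.
    by rewrite ler_pM2l.
  by move: t_gt0; lra.
pose Q := 8 + n%:R * `|p| + e1 + n%:R * `|p| * L + L.
have Q0 : 0 < Q by rewrite /Q -!addrA ltr_pwDl//; nneg.
pose e := Num.min 1 (Num.min (dd / 2) (eta * t / (4 * Q))).
have e0 : 0 < e by rewrite /e !lt_min ltr01 !divr_gt0 ?mulr_gt0.
have ee1 : e <= 1 by rewrite /e ge_min lexx.
have ee2 : e <= dd / 2 by rewrite /e !ge_min lexx ?orbT.
have ee3 : Q * e <= eta * t / 4.
  have -> : eta * t / 4 = Q * (eta * t / (4 * Q)) by field; rewrite gt_eqF.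
  by rewrite ler_pM2l// /e !ge_min lexx ?orbT.
have [x [alpha [xe ca Aal gx gy]]] := hdpp t e t_gt0 tt0 e0.
set y := trajectory f x alpha t in gy.
have disp s : 0 <= s -> s <= t -> `|trajectory f x alpha s - x| <= C * t.
  move=> s0 st; rewrite (le_trans (hC x alpha s _ ca _))//.
  - by rewrite (le_trans (ltW xe)).
  - by rewrite s0 (le_trans st).
  - by rewrite ler_pM2l.
have Ct0 : 0 <= C * t by rewrite mulr_ge0// ltW.
have yx : `|y - x| <= C * t by apply: disp => //; exact: ltW.
have yx0 : `|y - x0| < dd.
  rewrite -(subrKA x) (le_lt_trans (ler_normD _ _))//.
  by rewrite (le_lt_trans (lerD yx (lexx _)))//; lra.
have xx0 : `|x - x0| < dd by rewrite (lt_le_trans xe)// (le_trans ee2)//; lra.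
have ddd1 : dd <= d1 by rewrite /dd ge_min lexx.
have dddg : dd <= dg by rewrite /dd ge_min lexx orbT.
have gy1 : G0 + psi y - psi x0 <= g y.
  by apply: hg; rewrite -ball_normE /ball_/= distrC (lt_le_trans yx0).
have psi1 := hd1 x y (lt_le_trans xx0 ddd1) (lt_le_trans yx0 ddd1).
have x0d1 : `|x0 - x0| < d1 by rewrite subrr normr0.
have psi2 := hd1 x0 x x0d1 (lt_le_trans xx0 ddd1).
set rc := rcost x alpha t in gy.
have lfg := (locbm_field cs ca (trajectory_continuous cs x ca)).1.
have lcg := run_cost_locbm cs x ca.
have DE : y - x = vRI (fun u => f (trajectory f x alpha u) (alpha u)) 0 t.
  by rewrite /y (trajectoryE cs x ca) ?ltW// addrAC subrr add0r.
have near_x0 s : 0 <= s -> s <= t -> `|trajectory f x alpha s - x0| <= C * t + e.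
  move=> s0 st; rewrite -(subrKA x) (le_trans (ler_normD _ _))// lerD ?disp//.
  exact: ltW.
have inball z : `|z - x0| <= C + 1 -> `|z| <= `|x0| + 1 + (C + 1).
  move=> h; have := ler_normD (z - x0) x0; rewrite subrK; lra.
have CtC : C * t + e <= C + 1 by rewrite lerD// ler_piMr// ltW.
have rcE : rc = RI (fun s => l (trajectory f x alpha s) (alpha s)) 0 t by [].
have lle s : 0 <= s <= t -> 0 <= l (trajectory f x alpha s) (alpha s) <= Lam.
  move=> /andP[s0 st]; apply/andP; split.
    by apply: (cs_cost_ge0 cs); exact: ca.1.
  apply: hLam; last exact: ca.1.
  by apply: inball; rewrite (le_trans (near_x0 s s0 st)).
have rc0 : 0 <= rc by apply: (run_cost_ge0 cs).
have rcL : rc <= Lam * t.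
  rewrite rcE; have -> : Lam * t = RI (fun=> Lam) 0 t by rewrite RI_cst ?subr0// ltW.
  by apply: RI_le => //; [exact: locbm_cst|move=> s /lle/andP[]].
have key : G0 * rc + (eta - (n%:R * `|p| * L + L) * (C * t + e)) * t <= dotp p (y - x).
  rewrite DE; have [lp ->] := @dotp_vRI _ _ p _ 0 t lfg (lexx 0).
  have -> : G0 * rc + (eta - (n%:R * `|p| * L + L) * (C * t + e)) * t =
     RI (fun s => G0 * l (trajectory f x alpha s) (alpha s) +
          (eta - (n%:R * `|p| * L + L) * (C * t + e))) 0 t.
    rewrite RID//; [|exact: locbmZ|exact: locbm_cst].
    by rewrite (@RIZ _ G0 _ 0 t lcg (lexx 0)) RI_cst ?subr0// ltW.
  apply: RI_le => //; first by apply: locbmD; [exact: locbmZ|exact: locbm_cst].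
  move=> s /andP[s0 st].
  have Aas := Aal s s0.
  have xs := near_x0 s s0 st.
  have h := heta _ Aas.
  have x0b : `|x0 - x0| <= C + 1 by rewrite subrr normr0 addr_ge0// ltW.
  have [fL lL] := hL _ x0 _ (inball _ (le_trans xs CtC)) (inball x0 x0b) (A'A _ Aas).
  have h1 : `|dotp p (f (trajectory f x alpha s) (alpha s) - f x0 (alpha s))| <= n%:R * `|p| * (L * (C * t + e)).
    rewrite (le_trans (dotp_bound _ _))// ler_wpM2l// (le_trans fL)//.
    by rewrite ler_pM2l.
  have h2 : `|(l (trajectory f x alpha s) (alpha s) - l x0 (alpha s)) * G0| <= L * (C * t + e) * 1.
    rewrite normrM ler_pM// ?(le_trans lL) ?ler_pM2l//.
    by rewrite ler_norml G1.
  move: h1 h2; rewrite !ler_norml dotpBr => /andP[h1 _] /andP[_ h2].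
  by move: h h1 h2; clear; rewrite mulrBl; lra.
have expq := expR_quadratic rc0 (le_trans rcL tt3).
have exp1 := expR_ge1Dx rc.
have main : G0 + psi y - psi x0 <= expR rc * (G0 + 2 * e).
  rewrite (le_trans gy1)// -(@ler_pM2l _ (expR (- rc))) ?expR_gt0//.
  rewrite mulrA -expRD addNr expR0 mul1r (le_trans gy)//.
  by move: gx; clear; lra.
have b1 : e1 * `|y - x| <= eta / 8 * t.
  have : e1 * `|y - x| <= e1 * (C * t) by rewrite ler_pM2l.
  by rewrite (_ : e1 * (C * t) = eta / 8 * t)// /e1; field; rewrite gt_eqF.
have b2 : e1 * `|x - x0| <= e1 * e by rewrite ler_pM2l// ltW.
have b3 : `|dotp p (x - x0)| <= n%:R * `|p| * e.
  by rewrite (le_trans (dotp_bound _ _))// ler_wpM2l// ltW.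
have rc2 : rc ^+ 2 <= Lam ^+ 2 * t * t.
  by rewrite (_ : Lam ^+ 2 * t * t = (Lam * t) ^+ 2) ?lerXn2r ?nnegrE ?mulr_ge0 ?(ltW t_gt0)//; ring.
have b4 : expR rc * (G0 + 2 * e) <= G0 + G0 * rc + 2 * (Lam ^+ 2 * t * t) + 4 * e.
  have q1 : 0 <= expR rc - (1 + rc) by rewrite subr_ge0.
  have q2 : (expR rc - (1 + rc)) * G0 <= 2 * rc ^+ 2.
    rewrite (@le_trans _ _ (expR rc - (1 + rc)))//; last by rewrite lerBlDl.
    by rewrite ler_piMr.
  have q3 : expR rc <= 2.
    have rch : rc <= 2^-1 := le_trans rcL tt3.
    have : rc ^+ 2 <= (2^-1) ^+ 2 by rewrite lerXn2r ?nnegrE ?invr_ge0.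
    by move: expq rch; clear; rewrite [2^-1 ^+ 2]expr2; lra.
  have q4 : expR rc * e <= 2 * e by rewrite ler_pM2r.
  have -> : expR rc * (G0 + 2 * e) = G0 + G0 * rc + (expR rc - (1 + rc)) * G0 + 2 * (expR rc * e) by ring.
  by move: q2 q4 rc2; clear; lra.
have te : (n%:R * `|p| * L + L) * (C * t + e) * t <= (n%:R * `|p| * L * C + L * C) * t * t + (n%:R * `|p| * L + L) * e.
  have -> : (n%:R * `|p| * L + L) * (C * t + e) * t =
    (n%:R * `|p| * L * C + L * C) * t * t + (n%:R * `|p| * L + L) * e * t by ring.
  by rewrite lerD2l ler_piMr//; nneg.
have Bt : B * t * t <= eta / 4 * t by rewrite ler_pM2r.
have BtE : B * t * t = (n%:R * `|p| * L * C + L * C) * t * t + 2 * (Lam ^+ 2 * t * t) by rewrite /B; ring.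
have QE : Q * e = 8 * e + n%:R * `|p| * e + e1 * e + (n%:R * `|p| * L + L) * e by rewrite /Q; ring.
move: psi1 psi2 b3; rewrite !ler_norml => /andP[psi1 _] /andP[psi2 _] /andP[b3 _].
have etat : 0 < eta * t by rewrite mulr_gt0.
by move: key; rewrite mulrBl; lra.
Qed.

Lemma outside_ext_domain x : ~ T x -> nbhs x (ext_domain T).
Proof.
move=> nT; have nb : nbhs x (~` T).
  by apply: open_nbhs_nbhs; split => //; exact: closed_openC.
by apply: filterS nb => z nTz /interior_subset.
Qed.

Local Notation Z := (disc_value A T f l).
Local Notation D := (ext_domain T).

Lemma kruzkov_bound x : D x -> `|1 - Z x| <= 1.
Proof.
move=> _; rewrite ler_norml.
have := disc_value_ge0 A T f l x; have := disc_value_le1 T cs x; lra.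
Qed.

Lemma kruzkov_envelope_bounds x : D x ->
  0 <= lsc_env D (fun z => 1 - Z z) x /\ usc_env D (fun z => 1 - Z z) x <= 1.
Proof.
move=> Dx; split.
  apply: (lsc_env_ge kruzkov_bound Dx); apply: filterE => z _.
  by rewrite subr_ge0 (disc_value_le1 T cs).
apply: (usc_env_le kruzkov_bound Dx); apply: filterE => z _.
by have := disc_value_ge0 A T f l z; lra.
Qed.

Lemma C1_test phi x : C1_on (~` T) phi -> ~ T x -> forall e, 0 < e ->
  exists2 d, 0 < d & forall u v, `|u - x| < d -> `|v - x| < d ->
     `|phi v - phi u - dotp (gradient phi x) (v - u)| <= e * `|v - u|.
Proof.
move=> C1 nT e e0; apply: C1_strictly_differentiable C1 nT e0.
exact: closed_openC.
Qed.

(** A point [a] that violates the inequality serves as a constant control from points near [x0];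
    along it dynamic programming contradicts the test function. *)
Lemma kruzkov_subsolution :
  viscosity_subsolution (~` T) (HamK A f l) (usc_env D (fun z => 1 - Z z)).
Proof.
move=> phi x0 C1 nT hmax; set W := fun z => 1 - Z z in hmax *.
have nD := outside_ext_domain nT; have Dx0 := nbhs_singleton nD.
apply: ge_ereal_sup => _ [a Aa <-]; rewrite lee_fin leNgt; apply/negP => eta0.
set u0 := usc_env D W x0 in hmax eta0 *.
set p := gradient phi x0 in eta0 *.
have [_ u01] := kruzkov_envelope_bounds Dx0.
have u00 : 0 <= u0.
  rewrite (le_trans _ (usc_env_ge kruzkov_bound Dx0))// subr_ge0.
  exact: (disc_value_le1 T cs).
have ca : control A (fun=> a) by split => // j; exact: measurable_cst.
have aA : [set a] `<=` A by move=> _ ->.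
apply: (@dpp_infinitesimal Z (fun z => - phi z) (1 - u0) _ x0 (- p) [set a] _ eta0 aA).
- by apply/andP; split; move: u00 u01; rewrite -/u0; lra.
- move=> e e0; have [d d0 hd] := C1_test C1 nT e0; exists d => // u v ux vx.
  rewrite dotpNl (_ : - phi v - - phi u - - dotp p (v - u) =
    - (phi v - phi u - dotp p (v - u))); last by ring.
  by rewrite normrN; exact: hd.
- have h : nbhs x0 ([set z | usc_env D W z - phi z <= u0 - phi x0] `&` D).
    exact: filterI.
  apply: filterS h => z [h Dz].
  by have := usc_env_ge kruzkov_bound Dz; rewrite -/W /W; move: h => /=; rewrite -/W; lra.
- have [d d0 hd] := stays_outside nT.
  exists d => // t e t0 td e0.
  have nb : nbhs x0 ([set z | `|z - x0| < Num.min e d] `&` ~` T).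
    apply: filterI; last by apply: open_nbhs_nbhs; split => //; exact: closed_openC.
    apply/nbhs_ballP; exists (Num.min e d) => /=; first by rewrite lt_min e0.
    by move=> z; rewrite -ball_normE /ball_/= distrC.
  have [z [[/= zx nTz] Dz hz]] := usc_env_approx kruzkov_bound Dx0 e0 nb.
  move: zx; rewrite lt_min => /andP[ze zd].
  exists z, (fun=> a); split => //.
    by move: hz; rewrite -/W -/u0; lra.
  rewrite (le_trans (disc_value_shift cs closedT nTz ca (ltW t0) _))//.
    by apply: hd => //; rewrite (ltW t0) ltW.
  by rewrite lerDl ltW.
- by move=> _ ->; rewrite dotpNl le_eqVlt; apply/orP; left; apply/eqP; ring.
Qed.

(** If the inequality fails it does so for every [a], hence along the almost optimal controls given
    by dynamic programming. *)
Lemma kruzkov_supersolution :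
  viscosity_supersolution (~` T) (HamK A f l) (lsc_env D (fun z => 1 - Z z)).
Proof.
move=> phi x0 C1 nT hmin; set W := fun z => 1 - Z z in hmin *.
have nD := outside_ext_domain nT; have Dx0 := nbhs_singleton nD.
rewrite leNgt; apply/negP => sup0.
set u0 := lsc_env D W x0 in hmin sup0 *.
set p := gradient phi x0 in sup0 *.
(* A negative supremum provides one margin [eta] for all of [A], which is needed because the almost
   optimal control is not known in advance. *)
have [eta eta0 heta] : exists2 eta, 0 < eta & forall a, A a ->
    - dotp p (f x0 a) - l x0 a + l x0 a * u0 <= - eta.
  have ub a : A a -> ((- dotp p (f x0 a) - l x0 a + l x0 a * u0)%:E <= HamK A f l x0 u0 p)%E.
    by move=> Aa; apply: ereal_sup_ubound; exists a.
  case E : (HamK A f l x0 u0 p) sup0 ub => [r| |]// r0 ub.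
    exists (- r); first by move: r0; rewrite lte_fin oppr_gt0.
    by move=> a /ub; rewrite lee_fin opprK.
  by exists 1 => // a /ub; rewrite leeNy_eq.
have [u00 _] := kruzkov_envelope_bounds Dx0.
have u01 : u0 <= 1.
  rewrite (le_trans (lsc_env_le kruzkov_bound Dx0))//.
  by have := disc_value_ge0 A T f l x0; lra.
apply: (@dpp_infinitesimal (fun z => - Z z) phi (u0 - 1) _ x0 p A _ eta0) => //.
- by apply/andP; split; move: u00 u01; rewrite -/W -/u0; lra.
- by move=> e e0; exact: C1_test.
- have h : nbhs x0 ([set z | u0 - phi x0 <= lsc_env D W z - phi z] `&` D).
    exact: filterI.
  apply: filterS h => z [h Dz].
  by have := lsc_env_le kruzkov_bound Dz; rewrite -/W /W; move: h => /=; rewrite -/W; lra.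
- have [d d0 hd] := stays_outside nT.
  exists d => // t e t0 td e0.
  have nb : nbhs x0 ([set z | `|z - x0| < Num.min e d] `&` ~` T).
    apply: filterI; last by apply: open_nbhs_nbhs; split => //; exact: closed_openC.
    apply/nbhs_ballP; exists (Num.min e d) => /=; first by rewrite lt_min e0.
    by move=> z; rewrite -ball_normE /ball_/= distrC.
  have [z [[/= zx nTz] Dz hz]] := lsc_env_approx kruzkov_bound Dx0 e0 nb.
  move: zx; rewrite lt_min => /andP[ze zd].
  have stay gam : control A gam -> (t%:E < exit z gam)%E.
    by move=> cg; apply: hd => //; rewrite (ltW t0) ltW.
  have [alpha ca ha] : exists2 alpha, control A alpha &
      Z z - e <= expR (- rcost z alpha t) * Z (trajectory f z alpha t).
    (* Where the value is infinite there may be no reaching control; there the left-hand side is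
       negative and any constant control does. *)
    have [Z0|Z0] := ltP 0 (Z z).
      exact: (disc_value_dpp cs closedT nTz Z0 e0 (ltW t0) stay).
    have [a Aa] := cs_nonempty cs.
    exists (fun=> a); first by split => // j; exact: measurable_cst.
    rewrite (@le_trans _ _ 0)//; first by lra.
    by rewrite mulr_ge0 ?expR_ge0// disc_value_ge0.
  exists z, alpha; split => //.
  + by move=> s s0; exact: ca.1.
  + by move: hz; rewrite -/W -/u0 /W; clear; lra.
  + move: (expR (- rcost z alpha t)) (Z (trajectory f z alpha t)) (Z z) ha => a b c.
    by rewrite mulrN => h; lra.
- by move=> a Aa; have := heta a Aa; rewrite mulrBr mulr1; lra.
Qed.

End Viscosity.

(** * Comparison along trajectories *)

Section QuadraticTest.
Context {R : realType} {n : nat}.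
Implicit Types (x y v : 'rV[R]_n) (c : R).

Definition quad c y x := c * dotp (x - y) (x - y).

Lemma quad_differentiable c y x : differentiable (quad c y) x.
Proof.
have -> : quad c y = (fun x => c * \sum_(i < n) (x 0 i - y 0 i) * (x 0 i - y 0 i)).
  apply/funext => z; rewrite /quad dotpE; congr (_ * _).
  by apply: eq_bigr => i _; rewrite !mxE.
have dc i : differentiable (fun x : 'rV[R]_n => x 0 i - y 0 i) x.
  by apply: differentiableB; [exact: differentiable_coord|exact: differentiable_cst].
apply: differentiableM; first exact: differentiable_cst.
have -> : (fun x : 'rV[R]_n => \sum_(i < n) (x 0 i - y 0 i) * (x 0 i - y 0 i)) =
   \sum_(i < n) (fun x : 'rV[R]_n => (x 0 i - y 0 i) * (x 0 i - y 0 i)).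
  by apply/funext => z; rewrite fct_sumE.
by apply: differentiable_sum => i; exact: differentiableM.
Qed.

Lemma dotp_add_scale x v (h : R) : dotp (x + h *: v) (x + h *: v) =
  dotp x x + 2 * h * dotp x v + h * h * dotp v v.
Proof. by rewrite dotpDl !dotpDr !dotpZl !dotpZr (dotpC v x); ring. Qed.

Lemma quad_gradient c y x : gradient (quad c y) x = (2 * c) *: (x - y).
Proof.
apply/rowP => i; rewrite !mxE; set v : 'rV[R]_n := delta_mx 0 i.
have vv : dotp (x - y) v = x 0 i - y 0 i.
  rewrite dotpE (bigD1 i)//= big1 ?addr0 => [|j ji]; rewrite !mxE eqxx/=.
    by rewrite eqxx mulr1.
  by rewrite (negbTE ji) mulr0.
rewrite -vv.
have E : (fun h : R => h^-1 *: (quad c y (h *: v + x) - quad c y x)) @ 0^' --> (2 * c) * dotp (x - y) v.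
  have : (fun h : R => (2 * c) * dotp (x - y) v + h * (c * dotp v v)) @ 0^' --> (2 * c) * dotp (x - y) v.
    rewrite -[X in _ --> X]addr0 -[X in _ --> _ + X](mul0r (c * dotp v v)).
    apply: cvgD; first exact: cvg_cst.
    apply: cvgMl; apply: cvg_within_filter; exact: cvg_id.
  apply: cvg_trans; apply: near_eq_cvg.
  rewrite near_withinE; near=> h => h0; rewrite /quad.
  have -> : h *: v + x - y = (x - y) + h *: v.
    by apply/rowP => j; rewrite !mxE; ring.
  rewrite dotp_add_scale.
  rewrite /GRing.scale/=; field; exact: h0.
by rewrite /derive; exact/cvg_lim.
Unshelve. all: by end_near. Qed.

Lemma quad_C1 (O : set 'rV[R]_n) c y : C1_on O (quad c y).
Proof.
move=> x _; split; first exact: quad_differentiable.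
have -> : gradient (quad c y) = (fun x => (2 * c) *: (x - y)).
  by apply/funext => z; exact: quad_gradient.
apply: (@continuousZr _ _ 'rV[R]_n (fun x : 'rV[R]_n => x - y)).
apply: (@continuousB _ _ _ (fun x : 'rV[R]_n => x) (fun=> y) x).
  by move=> ? h.
exact: cst_continuous.
Qed.

End QuadraticTest.

(** * Truncated distance to the target *)

Section Gap.
Context {R : realType} {n : nat}.
Variable T : set 'rV[R]_n.
Hypothesis closedT : closed T.
Implicit Types (x y z : 'rV[R]_n).

(* Adding 1 keeps the infimum meaningful when [T] is empty. *)
Definition gap x : R := inf ([set 1] `|` [set `|x - z| | z in T]).

Let gap_lb x : has_lbound ([set 1] `|` [set `|x - z| | z in T]).
Proof. by exists 0 => _ [->|[z _ <-]]. Qed.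

Lemma gap_le1 x : gap x <= 1.
Proof. by apply: ge_inf; [exact: gap_lb|left]. Qed.

Lemma gap_le x z : T z -> gap x <= `|x - z|.
Proof. by move=> Tz; apply: ge_inf; [exact: gap_lb|right; exists z]. Qed.

Lemma gap_ge x (c : R) : c <= 1 -> (forall z, T z -> c <= `|x - z|) -> c <= gap x.
Proof.
move=> c1 h; apply: lb_le_inf; first by exists 1; left.
by move=> _ [->|[z Tz <-]] //; exact: h.
Qed.

Lemma gap_ge0 x : 0 <= gap x. Proof. exact: gap_ge. Qed.

Lemma gap_lipschitz x y : gap x <= gap y + `|x - y|.
Proof.
rewrite -lerBlDr; apply: gap_ge.
  by rewrite lerBlDr (le_trans (gap_le1 x))// lerDl.
move=> z Tz; rewrite lerBlDr (le_trans (gap_le x Tz))//.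
have -> : x - z = (y - z) + (x - y) by rewrite [RHS]addrC addrA subrK.
exact: ler_normD.
Qed.

Lemma gap_gt0 x : ~ T x -> 0 < gap x.
Proof.
move=> nT; have : nbhs x (~` T).
  by apply: open_nbhs_nbhs; split => //; exact: closed_openC.
move=> /nbhs_ballP[d /= d0 hd].
apply: (@lt_le_trans _ _ (Num.min 1 d)); first by rewrite lt_min ltr01.
apply: gap_ge; first by rewrite ge_min lexx.
move=> z Tz; rewrite leNgt; apply/negP => xz; apply: (hd z) => //.
by rewrite -ball_normE /ball_/= (lt_le_trans xz)// ge_min lexx orbT.
Qed.

Lemma gap_outside x z : `|x - z| < gap x -> ~ T z.
Proof. by move=> xz Tz; have := gap_le x Tz; rewrite leNgt xz. Qed.

End Gap.

(** * Aiming on one short stage *)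

Section Stages.
Context {R : realType} {n m : nat}.
Variables (A : set 'rV[R]_m) (T : set 'rV[R]_n)
  (f : 'rV[R]_n -> 'rV[R]_m -> 'rV[R]_n) (l : 'rV[R]_n -> 'rV[R]_m -> R).
Hypothesis cs : control_system A f l.
Hypothesis closedT : closed T.
Implicit Types (x y z p : 'rV[R]_n) (alpha beta gam : R -> 'rV[R]_m) (s t c e d : R).
Local Notation exit := (exit_time T f).
Local Notation rcost := (run_cost f l).
Local Notation D := (ext_domain T).

Variable M : R.
Hypothesis M_gt0 : 0 < M.
Hypothesis hM : forall x a, A a -> `|f x a| <= M * (1 + `|x|).

(* By [stage_stay], a time too short to leave a ball around [x] outside [T]. *)
Definition stage x : R := gap T x / (16 * M * (1 + `|x|)).

Let den_gt0 x : 0 < 16 * M * (1 + `|x|).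
Proof. by rewrite !mulr_gt0// ltr_pwDl. Qed.

Lemma stage_gt0 x : ~ T x -> 0 < stage x.
Proof. by move=> nT; rewrite divr_gt0//; exact: gap_gt0. Qed.

(** The reason for the factor 16 in [stage]: the exponential in the displacement bound is at most 2,
    and the bound becomes [4 / 16] of the gap. *)
Lemma stage_stay x alpha t : control A alpha -> 0 <= t <= stage x ->
  `|trajectory f x alpha t - x| <= gap T x / 4.
Proof.
move=> ca /andP[t0 ts].
rewrite (le_trans (trajectory_displacement cs x ca M_gt0 hM t0))//.
have X0 : 0 < 1 + `|x| by rewrite ltr_pwDl.
have Mt : 2 * M * t <= 2^-1.
  have : 2 * M * t <= 2 * M * stage x by rewrite ler_pM2l// mulr_gt0.
  move=> /le_trans; apply.
  have -> : 2 * M * stage x = gap T x / (1 + `|x|) / 8.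
    by rewrite /stage; field; rewrite !gt_eqF.
  have : gap T x / (1 + `|x|) <= 1.
    by rewrite ler_pdivrMr// mul1r (le_trans (gap_le1 T x))// lerDl.
  by lra.
have e2 : expR (2 * M * t) <= 2.
  have Mt0 : 0 <= 2 * M * t by rewrite !mulr_ge0// ltW.
  have := expR_quadratic Mt0 Mt; set u := 2 * M * t in Mt Mt0 *.
  have : u ^+ 2 <= 2^-1 ^+ 2 by rewrite lerXn2r ?nnegrE ?invr_ge0.
  by rewrite [2^-1 ^+ 2]expr2; lra.
apply: (@le_trans _ _ (2 * (M * (1 + `|x|) * stage x) * 2)).
  apply: ler_pM => //; rewrite ?expR_ge0//.
    by rewrite !mulr_ge0// ltW.
  by rewrite ler_pM2l// ler_pM2l// mulr_gt0.
by rewrite le_eqVlt; apply/orP; left; apply/eqP; rewrite /stage; field; rewrite !gt_eqF.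
Qed.

Lemma stage_ball x z : ~ T x -> `|z - x| <= 2 * (gap T x / 4) -> ~ T z.
Proof.
move=> nT h; apply: (@gap_outside _ _ _ x); rewrite distrC (le_lt_trans h)//.
by have := gap_gt0 closedT nT; lra.
Qed.

Lemma gap_quarter_gt0 x : ~ T x -> 0 < gap T x / 4.
Proof. by move=> nT; rewrite divr_gt0//; exact: gap_gt0. Qed.

Section Candidate.
Variable W : 'rV[R]_n -> R.
Hypothesis W01 : forall x, D x -> 0 <= W x <= 1.

Let Wb x : D x -> `|W x| <= 1.
Proof. by move=> /W01/andP[h1 h2]; rewrite ler_norml h2 (le_trans _ h1). Qed.

Lemma envelopes01 x : D x ->
  [/\ 0 <= lsc_env D W x, lsc_env D W x <= 1, 0 <= usc_env D W x & usc_env D W x <= 1].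
Proof.
move=> Dx; have /andP[W0 W1] := W01 Dx.
split.
- by apply: (lsc_env_ge Wb Dx); apply: filterE => z /W01/andP[].
- exact: le_trans (lsc_env_le Wb Dx) W1.
- exact: le_trans W0 (usc_env_ge Wb Dx).
- by apply: (usc_env_le Wb Dx); apply: filterE => z /W01/andP[].
Qed.

(** Aiming runs with the singleton of [alpha], so the end point does not depend on [rho], and lower
    semicontinuity of [1 - usc_env D W] at this one point allows [rho] to tend to 0. *)
Lemma subsolution_stage x alpha Th : viscosity_subsolution (~` T) (HamK A f l) (usc_env D W) ->
  ~ T x -> control A alpha -> 0 <= Th -> Th <= stage x ->
  expR (- rcost x alpha Th) * (1 - usc_env D W (trajectory f x alpha Th)) <= 1 - usc_env D W x.
Proof.
move=> sub nT ca Th0 Ths.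
set r := gap T x / 4.
have r0 : 0 < r := gap_quarter_gt0 nT.
pose g z := 1 - usc_env D W z.
have ball_out z : `|z - x| <= 2 * r -> ~ T z by exact: stage_ball.
have Dz z : ~ T z -> D z by move=> nTz; exact: nbhs_singleton (outside_ext_domain closedT nTz).
have gb z : `|z - x| <= 2 * r -> `|g z| <= 1.
  move=> /ball_out/Dz/envelopes01[_ _ h1 h2]; rewrite /g ler_norml; lra.
have glsc p e : `|p - x| <= 2 * r -> 0 < e -> \forall z \near p, g p - e < g z.
  move=> /ball_out nTp e0.
  apply: filterS (usc_env_usc Wb (outside_ext_domain closedT nTp) e0) => z.
  by rewrite /g; lra.
have stay alpha' t : control A alpha' -> 0 <= t <= Th -> `|trajectory f x alpha' t - x| <= r.
  by move=> ca' /andP[t0 tTh]; apply: stage_stay => //; rewrite t0 (le_trans tTh).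
have H eta gam s w xh : 0 < eta -> gam = alpha -> 0 <= s -> s <= Th -> 0 < w ->
     `|xh - x| < 2 * r ->
     (\forall z \near xh, penalized g w (trajectory f x gam s) xh <= penalized g w (trajectory f x gam s) z) ->
     exists gam', [/\ gam' = alpha, forall u, u < s -> gam' u = gam u &
       forall u, s <= u ->
       w * dotp (trajectory f x gam s - xh) (f xh (gam' u)) <= l xh (gam' u) * g xh + eta].
  move=> eta0 gamE s0 sTh w0 xhr hmin; exists alpha; split => // [u _|u su]; first by rewrite gamE.
  set y := trajectory f x gam s in hmin *.
  have nTxh : ~ T xh by apply: ball_out; exact: ltW.
  have := sub (quad (w / 2) y) xh (@quad_C1 _ _ _ _ _) nTxh.
  have hmax : \forall z \near xh, usc_env D W z - quad (w / 2) y z <= usc_env D W xh - quad (w / 2) y xh.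
    by apply: filterS hmin => z; rewrite /penalized /quad /g; lra.
  move=> /(_ hmax); rewrite quad_gradient => hH.
  have Aa : A (alpha u) by apply: ca.1; exact: le_trans su.
  have : ((- dotp ((2 * (w / 2)) *: (xh - y)) (f xh (alpha u)) - l xh (alpha u) + l xh (alpha u) * usc_env D W xh)%:E <= 0)%E.
    by apply: le_trans hH; apply: ereal_sup_ubound; exists (alpha u).
  rewrite lee_fin mulrCA divff ?mulr1 ?pnatr_eq0// dotpZl -[xh - y]opprB dotpNl /g.
  by lra.
have P0 : [set gam | gam = alpha] alpha by [].
have Pc : [set gam | gam = alpha] `<=` control A by move=> _ ->.
have aim := aiming cs r0 Th0 gb glsc stay P0 Pc H.
set y := trajectory f x alpha Th.
have yr : `|y - x| <= 2 * r.
  by rewrite (le_trans (stay alpha Th ca _)) ?Th0 ?lexx//; lra.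
rewrite -[leLHS]/(_ * g y) -[leRHS]/(g x).
apply/ler_addgt0Pr => e e0; have e20 : 0 < e / 2 by rewrite divr_gt0.
have /nbhs_ballP[d /= d0 hd] := glsc y (e / 2) yr e20.
have rho0 : 0 < Num.min (d / 2) (e / 2) by rewrite lt_min !divr_gt0.
have [gam [xh [-> _ xhy h]]] := aim _ rho0.
have : g y - e / 2 < g xh.
  apply: hd; rewrite -ball_normE /ball_/= distrC (le_lt_trans xhy)//.
  by rewrite gt_min; apply/orP; left; lra.
have h2 : Num.min (d / 2) (e / 2) <= e / 2 by rewrite ge_min lexx orbT.
move=> /ltW/(ler_wpM2l (expR_ge0 (- rcost x alpha Th))).
have : expR (- rcost x alpha Th) * (e / 2) <= e / 2.
  rewrite ler_piMl ?(ltW e20)// -expR0 ler_expR oppr_le0.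
  exact: (run_cost_ge0 cs).
move: h h2; set E := expR _; move: (g y) (g xh) (g x) => u v w.
by rewrite mulrBr => h h2 h3 h4; lra.
Qed.

(** The control depends on [rho], so the auxiliary point [xh] cannot be replaced by the end point of
    the trajectory here; the two assumptions on the data or on [W] do this later, each in its own
    way. *)
Lemma supersolution_aim x rho : viscosity_supersolution (~` T) (HamK A f l) (lsc_env D W) ->
  ~ T x -> 0 < rho -> exists gam xh, [/\ control A gam, `|xh - x| <= 2 * (gap T x / 4),
    `|xh - trajectory f x gam (stage x)| <= rho &
    expR (- rcost x gam (stage x)) * (lsc_env D W xh - 1) <= lsc_env D W x - 1 + rho].
Proof.
move=> sup nT rho0.
set r := gap T x / 4.
have r0 : 0 < r := gap_quarter_gt0 nT.
have Th0 := ltW (stage_gt0 nT).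
pose g z := lsc_env D W z - 1.
have ball_out z : `|z - x| <= 2 * r -> ~ T z by exact: stage_ball.
have Dz z : ~ T z -> D z by move=> nTz; exact: nbhs_singleton (outside_ext_domain closedT nTz).
have gb z : `|z - x| <= 2 * r -> `|g z| <= 1.
  move=> /ball_out/Dz/envelopes01[h1 h2 _ _]; rewrite /g ler_norml; lra.
have glsc p e : `|p - x| <= 2 * r -> 0 < e -> \forall z \near p, g p - e < g z.
  move=> /ball_out nTp e0.
  apply: filterS (lsc_env_lsc Wb (outside_ext_domain closedT nTp) e0) => z.
  by rewrite /g; lra.
have stay alpha' t : control A alpha' -> 0 <= t <= stage x -> `|trajectory f x alpha' t - x| <= r.
  by move=> ca' tTh; exact: stage_stay.
have [a0 Aa0] := cs_nonempty cs.
have ca0 a : A a -> control A (fun=> a) by move=> Aa; split => // j; exact: measurable_cst.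
have H eta gam s w xh : 0 < eta -> control A gam -> 0 <= s -> s <= stage x -> 0 < w ->
     `|xh - x| < 2 * r ->
     (\forall z \near xh, penalized g w (trajectory f x gam s) xh <= penalized g w (trajectory f x gam s) z) ->
     exists gam', [/\ control A gam', forall u, u < s -> gam' u = gam u &
       forall u, s <= u ->
       w * dotp (trajectory f x gam s - xh) (f xh (gam' u)) <= l xh (gam' u) * g xh + eta].
  move=> eta0 cg s0 sTh w0 xhr hmin.
  set y := trajectory f x gam s in hmin *.
  have nTxh : ~ T xh by apply: ball_out; exact: ltW.
  have := sup (quad (- (w / 2)) y) xh (@quad_C1 _ _ _ _ _) nTxh.
  have hmin' : \forall z \near xh, lsc_env D W xh - quad (- (w / 2)) y xh <= lsc_env D W z - quad (- (w / 2)) y z.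
    by apply: filterS hmin => z; rewrite /penalized /quad /g; lra.
  move=> /(_ hmin'); rewrite quad_gradient => hH.
  (* The slack [eta] allows the supremum to be replaced by the value at one [a], which then
     continues the control as a constant. *)
  have : ((- eta)%:E < HamK A f l xh (lsc_env D W xh) ((2 * - (w / 2)) *: (xh - y)))%E.
    by apply: lt_le_trans hH; rewrite lte_fin oppr_lt0.
  move=> /ereal_sup_gt[_ [a Aa <-]]; rewrite lte_fin.
  have -> : 2 * - (w / 2) = - w by field.
  rewrite dotpZl -[xh - y]opprB dotpNl => ha.
  exists (splice s gam (fun=> a)); split.
  - by apply: control_splice => //; exact: ca0.
  - by move=> u us; rewrite splice_lt.
  - by move=> u su; rewrite /splice ltNge su /= /g; lra.
exact: (aiming cs r0 Th0 gb glsc stay (ca0 a0 Aa0) (@subset_refl _ _) H).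
Qed.

End Candidate.

End Stages.

(** * From stages to the exit time *)

Section Globalization.
Context {R : realType} {n m : nat}.
Variables (A : set 'rV[R]_m) (T : set 'rV[R]_n)
  (f : 'rV[R]_n -> 'rV[R]_m -> 'rV[R]_n) (l : 'rV[R]_n -> 'rV[R]_m -> R).
Hypothesis cs : control_system A f l.
Hypothesis closedT : closed T.
Implicit Types (x y z p : 'rV[R]_n) (alpha beta gam : R -> 'rV[R]_m) (s t c e d : R).
Local Notation exit := (exit_time T f).
Local Notation rcost := (run_cost f l).
Local Notation D := (ext_domain T).

Variable M : R.
Hypothesis M_gt0 : 0 < M.
Hypothesis hM : forall x a, A a -> `|f x a| <= M * (1 + `|x|).

Local Notation stage := (stage T M).

Lemma gap_path_continuous x alpha : control A alpha ->
  {within (`[0%R, +oo[%classic : set R), continuous (fun t => gap T (trajectory f x alpha t))}.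
Proof.
move=> ca; apply/subspace_continuousP => t t0.
have h := @within_continuous_dist R _ _ _ _ (trajectory_continuous cs x ca) t.
apply/cvgrPdist_lt => e e0; rewrite near_withinE.
apply: filterS (h e t0 e0) => s hs s0; apply: le_lt_trans (hs s0).
have h1 := @gap_lipschitz _ _ T (trajectory f x alpha t) (trajectory f x alpha s).
have h2 := @gap_lipschitz _ _ T (trajectory f x alpha s) (trajectory f x alpha t).
by rewrite distrC in h2; rewrite ler_norml; apply/andP; split; lra.
Qed.

Lemma stage_lower_bound x alpha t : control A alpha -> 0 <= t ->
  (forall s, 0 <= s <= t -> ~ T (trajectory f x alpha s)) ->
  exists2 h : R, 0 < h & forall s, 0 <= s <= t -> h <= stage (trajectory f x alpha s).
Proof.
move=> ca t0 out.
have [B B0 hB] := continuous_norm_bounded (trajectory_continuous cs x ca) t.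
have cg : {within `[0, t], continuous (fun t => gap T (trajectory f x alpha t))}.
  have := gap_path_continuous (x := x) ca; apply: continuous_subspaceW => s /=.
  by rewrite !in_itv/= andbT => /andP[].
have [c ct hc] := EVT_min t0 cg.
exists (gap T (trajectory f x alpha c) / (16 * M * (1 + B))).
  rewrite divr_gt0//; last by rewrite !mulr_gt0// ltr_pwDl.
  by apply: gap_gt0 => //; apply: out; rewrite in_itv/= in ct.
move=> s st; rewrite /stage; apply: ler_pM.
- exact: gap_ge0.
- by rewrite invr_ge0 !mulr_ge0// ?(ltW M_gt0)// addr_ge0.
- by apply: hc; rewrite in_itv.
- rewrite lef_pV2 ?posrE ?mulr_gt0// ?ltr_pwDl//.
  by rewrite ler_pM2l ?mulr_gt0// lerD2l; exact: hB.
Qed.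

Lemma subsolution_along (W : 'rV[R]_n -> R) x alpha t :
  (forall x, D x -> 0 <= W x <= 1) ->
  viscosity_subsolution (~` T) (HamK A f l) (usc_env D W) ->
  control A alpha -> 0 <= t -> (t%:E < exit x alpha)%E ->
  expR (- rcost x alpha t) * (1 - usc_env D W (trajectory f x alpha t)) <= 1 - usc_env D W x.
Proof.
move=> W01 sub ca t0 tex.
have out s : 0 <= s <= t -> ~ T (trajectory f x alpha s).
  by move=> /andP[s0 st]; apply: before_exit => //; apply: le_lt_trans tex; rewrite lee_fin.
have [h h0 hstage] := stage_lower_bound ca t0 out.
pose P (s : R) := expR (- rcost x alpha s) * (1 - usc_env D W (trajectory f x alpha s)) <= 1 - usc_env D W x.
(* Induction on the number of steps of length [h], where [h] is shorter than every stage met along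
   the trajectory. *)
suff : forall N : nat, forall s, 0 <= s <= t -> s <= N%:R * h -> P s.
  move=> H; apply: (H (Num.bound (t / h)) t); first by rewrite t0 lexx.
  rewrite -ler_pdivrMr//; apply: ltW; apply: archi_boundP.
  by rewrite divr_ge0// ltW.
elim=> [s /andP[s0 st]|N IH s /andP[s0 st] sN].
  rewrite mul0r => s0'; have -> : s = 0 by apply/eqP; rewrite eq_le s0 s0'.
  by rewrite /P run_cost0 oppr0 expR0 mul1r (trajectory0 cs).
have [sh|hs] := leP s h.
  have := subsolution_stage cs closedT M_gt0 hM W01 sub.
  apply => //; first by have := out 0; rewrite lexx (trajectory0 cs)//; exact.
  by apply: (le_trans sh); have := hstage 0; rewrite lexx (trajectory0 cs)//; exact.
set s' := s - h.
have s'0 : 0 <= s' by rewrite subr_ge0 ltW.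
have s't : 0 <= s' <= t by rewrite s'0 (le_trans _ st)// gerBl ltW.
have Ps' : P s'.
  by apply: IH => //; rewrite lerBlDr (le_trans sN)// -natr1 mulrDl mul1r.
have ss : s = s' + h by rewrite subrK.
rewrite /P ss (run_cost_add cs x ca s'0 (ltW h0)) -(trajectory_shift cs x ca s'0 (ltW h0)).
rewrite opprD expRD -mulrA; apply: le_trans Ps'; rewrite ler_wpM2l ?expR_ge0//.
apply: (subsolution_stage cs closedT M_gt0 hM W01 sub) => //.
- exact: out.
- exact: control_shift.
- exact: ltW.
- exact: hstage.
Qed.

Section Concatenation.
Variable g : 'rV[R]_n -> R.
Hypothesis g_ge : forall z, ~ T z -> -1 <= g z.
Hypothesis g_stage : forall z e, ~ T z -> 0 < e -> exists2 gam, control A gam &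
  expR (- rcost z gam (stage z)) * g (trajectory f z gam (stage z)) <= g z + e.

Lemma append_stage x gam s c e : control A gam -> 0 <= s ->
  ~ T (trajectory f x gam s) -> 0 < e ->
  expR (- rcost x gam s) * g (trajectory f x gam s) <= c ->
  exists gam', [/\ control A gam', forall t, t < s -> gam' t = gam t,
    ~ T (trajectory f x gam' (s + stage (trajectory f x gam s))) &
    expR (- rcost x gam' (s + stage (trajectory f x gam s))) *
      g (trajectory f x gam' (s + stage (trajectory f x gam s))) <= c + e].
Proof.
move=> cg s0 nT e0 hc; set z := trajectory f x gam s in nT hc *.
have h0 := ltW (stage_gt0 closedT M_gt0 nT).
have [beta cb hb] := g_stage nT e0.
exists (splice s gam beta); split.
- exact: control_splice.
- by move=> t ts; rewrite splice_lt.
- rewrite (trajectory_splice_add cs)// -/z.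
  have hz : `|trajectory f z beta (stage z) - z| <= gap T z / 4.
    by apply: (stage_stay cs M_gt0 hM cb); rewrite h0 lexx.
  apply: (stage_ball closedT nT); apply: (le_trans hz).
  by have := gap_quarter_gt0 closedT nT; lra.
rewrite (trajectory_splice_add cs)// (run_cost_splice_add cs)// -/z opprD expRD -mulrA.
apply: (@le_trans _ _ (expR (- rcost x gam s) * (g z + e))).
  by rewrite ler_wpM2l ?expR_ge0.
rewrite mulrDr lerD// ler_piMl ?(ltW e0)// -expR0 ler_expR oppr_le0.
exact: (run_cost_ge0 cs).
Qed.

(** At each time the splices are eventually constant in [k], so the glued control is a pointwise
    limit of measurable ones. Beyond all [tk] it takes an arbitrary value in [A]. *)
Lemma glue_controls (gamk : nat -> R -> 'rV[R]_m) (tk : nat -> R) :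
  (forall k, control A (gamk k)) -> (forall k, 0 <= tk k) ->
  (forall k j t, (k <= j)%N -> t < tk k -> gamk j t = gamk k t) ->
  (forall k j, (k <= j)%N -> tk k <= tk j) ->
  exists2 gam, control A gam & forall k t, t < tk k -> gam t = gamk k t.
Proof.
move=> cg tk0 agree tk_mono.
have [a0 Aa0] := cs_nonempty cs.
pose gam t := if pselect (exists k, t < tk k) is left h then gamk (sval (cid h)) t else a0.
have gamE k t : t < tk k -> gam t = gamk k t.
  rewrite /gam => tk1; case: pselect => [h|]; last by case; exists k.
  case: cid => j tj /=; have [kj|/ltnW jk] := leqP k j; first exact: agree.
  by rewrite (agree _ _ _ jk).
exists gam => //; split => [t t0|j].
  rewrite /gam; case: pselect => [h|//]; exact: (cg _).1.
apply: (@measurable_fun_cvg _ _ R _ (fun k t => splice (tk k) (gamk k) (fun=> a0) t 0 j)) => [k|t _].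
  apply: (control_splice (tk0 k) (cg k) _).2; split => // i; exact: measurable_cst.
apply: cvg_near_cst.
have [[k tkk]|h] := pselect (exists k, t < tk k).
  exists k => // i /= ki; have ti : t < tk i by apply: lt_le_trans (tk_mono _ _ ki).
  by rewrite splice_lt// (gamE i).
exists 0 => // i _ /=.
rewrite /splice ifF; last by apply/negbTE/negP => ti; apply: h; exists i.
by rewrite /gam; case: pselect.
Qed.

(* The stages fill the whole interval up to the exit time: their lengths are
   bounded below along a path that stays outside [T] on a compact interval. *)
Lemma concatenate_stages x e : ~ T x -> 0 < e -> exists2 gam, control A gam &
  forall t, 0 <= t -> (t%:E <= exit x gam)%E -> - g x - e <= expR (- rcost x gam t).
Proof.
move=> nT e0.
pose st := ((R -> 'rV[R]_m) * R)%type.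
(* The stage that follows the first [k] ones is allowed the error [e * 2^-1 ^+ k.+1]; these errors
   add up to less than [e]. *)
pose inv (k : nat) (p : st) := [/\ control A p.1, 0 <= p.2, ~ T (trajectory f x p.1 p.2) &
  expR (- rcost x p.1 p.2) * g (trajectory f x p.1 p.2) <= g x + e * (1 - 2^-1 ^+ k)].
pose rel (p q : st) := q.2 = p.2 + stage (trajectory f x p.1 p.2) /\
  forall t, t < p.2 -> q.1 t = p.1 t.
have step (kp : nat * st) : exists q, inv kp.1 kp.2 -> inv kp.1.+1 q /\ rel kp.2 q.
  case: kp => k [gam s] /=.
  have [[/= cg s0 nTs hs]|h] := pselect (inv k (gam, s)); last by exists (gam, s).
  have ek : 0 < e * 2^-1 ^+ k.+1 by rewrite mulr_gt0// exprn_gt0// invr_gt0.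
  have [gam' [cg' ag nT' h']] := append_stage cg s0 nTs ek hs.
  exists (gam', s + stage (trajectory f x gam s)) => _; split => //; split => //=.
    by rewrite addr_ge0// ltW// (stage_gt0 closedT M_gt0).
  by move: h'; rewrite [2^-1 ^+ k.+1]exprS; lra.
have [F hF] := choice step.
have [a0 Aa0] := cs_nonempty cs.
pose q := fix q k : st := if k is k'.+1 then F (k', q k') else ((fun=> a0), 0).
have invq k : inv k (q k).
  have ca0 : control A (fun=> a0) by split => // j; exact: measurable_cst.
  elim: k => [|k IH]; last by have [] := hF (k, q k) IH.
  rewrite /inv /= (trajectory0 cs)// run_cost0 oppr0 expR0 expr0 subrr mulr0 addr0 mul1r.
  by split.
have relq k : rel (q k) (q k.+1) by have [] := hF (k, q k) (invq k).
have tS k : (q k).2 <= (q k.+1).2.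
  rewrite (relq k).1 lerDl ltW// (stage_gt0 closedT M_gt0)//.
  by have [] := invq k.
have tmono k j : (k <= j)%N -> (q k).2 <= (q j).2.
  by move=> /subnK <-; elim: (j - k)%N => // i IH; rewrite addSn (le_trans IH).
have agree k j t : (k <= j)%N -> t < (q k).2 -> (q j).1 t = (q k).1 t.
  move=> /subnK <- tk; elim: (j - k)%N => // i IH; rewrite addSn (relq _).2 ?IH//.
  by rewrite (lt_le_trans tk)// tmono// leq_addl.
have cq k : control A (q k).1 by have [] := invq k.
have tq0 k : 0 <= (q k).2 by have [] := invq k.
have [gam cg gamE] := glue_controls cq tq0 agree tmono.
exists gam => // t t0 tex.
have trajE k s : 0 <= s <= (q k).2 -> trajectory f x gam s = trajectory f x (q k).1 s.
  by apply: (trajectory_causal cs) => // u /andP[_ uk]; exact: gamE.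
have costE k : rcost x gam (q k).2 = rcost x (q k).1 (q k).2.
  have h u : 0 <= u < (q k).2 -> gam u = (q k).1 u.
    by move=> /andP[_ uk]; exact: gamE.
  by apply: (run_cost_causal cs x cg (cq k) h); rewrite tq0 lexx.
(* Outside [T] the bound [-1 <= g] turns the invariant into a lower bound for the discount. *)
have bound k : - g x - e <= expR (- rcost x gam (q k).2).
  have [_ _ nTk hk] := invq k; rewrite costE.
  have := ler_wpM2l (expR_ge0 (- rcost x (q k).1 (q k).2)) (g_ge nTk).
  have : 0 <= e * 2^-1 ^+ k by rewrite mulr_ge0 ?(ltW e0)// exprn_ge0 ?invr_ge0.
  by rewrite mulrN1; lra.
have exhaust d : 0 < d -> exists k, t - d < (q k).2.
  move=> d0; apply: contrapT => /forallNP hk.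
  have hk' k : (q k).2 <= t - d by rewrite leNgt; apply/negP; exact: hk.
  have td0 : 0 <= t - d := hk' 0.
  have out s : 0 <= s <= t - d -> ~ T (trajectory f x gam s).
    move=> /andP[s0 std]; apply: before_exit => //; apply: lt_le_trans tex.
    by rewrite lte_fin; lra.
  have [h h0 hst] := stage_lower_bound cg td0 out.
  have lb k : k%:R * h <= (q k).2.
    elim: k => [|k IH]; first by rewrite mul0r.
    rewrite -natr1 mulrDl mul1r (relq k).1 lerD// -(trajE k) ?tq0 ?lexx//.
    by apply: hst; rewrite tq0 hk'.
  have := archi_boundP (divr_ge0 td0 (ltW h0)).
  by rewrite ltr_pdivrMr// ltNge (le_trans (lb _) (hk' _)).
(* The stages may only come arbitrarily close to [t]; the remaining interval is bridged by the bound
   [C] on the running cost. *)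
apply/ler_addgt0Pr => e' e'0.
have [B B0 hB] := continuous_norm_bounded (trajectory_continuous cs x cg) t.
have [C C0 hC] := running_cost_bounded cs B.
have [k hk] := exhaust (e' / (C + 1)) (divr_gt0 e'0 (ltr_wpDl C0 ltr01)).
apply: (le_trans (bound k)).
have [tk|/ltW tk] := leP t (q k).2.
  apply: (@le_trans _ _ (expR (- rcost x gam t))); last by rewrite lerDl ltW.
  by rewrite ler_expR lerN2 (run_cost_le cs x cg t0 tk).
have tE : t = (q k).2 + (t - (q k).2) by rewrite subrKC.
have u0 : 0 <= t - (q k).2 by rewrite subr_ge0.
have cost_inc : rcost x gam t <= rcost x gam (q k).2 + e'.
  rewrite {1}tE (run_cost_add cs)// lerD2l.
  have -> : e' = (C + 1) * (e' / (C + 1)) by field; rewrite gt_eqF// ltr_wpDl.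
  apply: (@le_trans _ _ ((C + 1) * (t - (q k).2))); last first.
    by rewrite ler_pM2l ?ltr_wpDl//; lra.
  have csh := control_shift (tq0 k) cg.
  apply: (@le_trans _ _ (RI (fun=> C + 1) 0 (t - (q k).2))).
    apply: RI_le => //; [exact: (run_cost_locbm cs)|exact: locbm_cst|].
    move=> s /andP[s0 sk].
    rewrite (trajectory_shift cs)//.
    rewrite (@le_trans _ _ C)// ?lerDl//; apply: hC.
      by apply: hB; rewrite addr_ge0//=; lra.
    by apply: cg.1; rewrite addr_ge0.
  by rewrite RI_cst// subr0.
have := expR_ge1Dx (- e').
have := expR_ge0 (- rcost x gam (q k).2).
have e1 : expR (- rcost x gam (q k).2) <= 1.
  by rewrite -expR0 ler_expR oppr_le0 (run_cost_ge0 cs).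
have : expR (- rcost x gam (q k).2) * expR (- e') <= expR (- rcost x gam t).
  by rewrite -expRD ler_expR; lra.
move: (expR (- rcost x gam (q k).2)) e1 (expR (- e')) (expR (- rcost x gam t)) => a a1 b c.
move=> abc a0' b1.
have : a * (1 - e') <= a * b by rewrite ler_wpM2l.
have : a * e' <= e' by rewrite ler_piMl// ltW.
by lra.
Qed.

End Concatenation.

Lemma supersolution_value (W : 'rV[R]_n -> R) :
  (forall x, D x -> 0 <= W x <= 1) ->
  (forall x, value A T f l x = value_m A T f l x) ->
  (forall z e, ~ T z -> 0 < e -> exists2 gam, control A gam &
    expR (- rcost z gam (stage z)) * (lsc_env D W (trajectory f z gam (stage z)) - 1)
      <= lsc_env D W z - 1 + e) ->
  forall x, ~ T x -> 1 - lsc_env D W x <= disc_value A T f l x.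
Proof.
move=> W01 VVm hst x nT.
have Dz z : ~ T z -> D z by move=> nTz; exact: nbhs_singleton (outside_ext_domain closedT nTz).
pose g z := lsc_env D W z - 1.
have g_ge z : ~ T z -> -1 <= g z by move=> /Dz/(envelopes01 W01)[+ _ _ _]; rewrite /g; lra.
apply/ler_addgt0Pr => e e0; have e20 : 0 < e / 2 by rewrite divr_gt0.
have [gam cg hg] := concatenate_stages g_ge hst nT e20.
set v := - g x - e / 2 in hg.
(* For [v <= 0] the claim is trivial; otherwise the lower bound [v] on the discount is the bound
   [- ln v] on the cost. *)
have [v0|v0] := leP v 0.
  have := disc_value_ge0 A T f l x; rewrite /v /g in v0; lra.
have vx : 1 - lsc_env D W x = v + e / 2 by rewrite /v /g; lra.
suff : v <= disc_value A T f l x by lra.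
rewrite -(lnK v0) -[ln v]opprK.
apply: (disc_value_ge_control cs (VVm x) nT cg) => t t0 tex.
have := hg t t0 tex; rewrite -{1}(lnK v0) ler_expR; lra.
Qed.

(** Continuity is uniform around the compact ball that contains [xh], so [rho] can be chosen before
    the control and its end point are known. *)
Lemma continuous_supersolution_stage (W : 'rV[R]_n -> R) :
  (forall x, D x -> 0 <= W x <= 1) -> continuous_on D W ->
  viscosity_supersolution (~` T) (HamK A f l) (lsc_env D W) ->
  forall z e, ~ T z -> 0 < e -> exists2 gam, control A gam &
    expR (- rcost z gam (stage z)) * (lsc_env D W (trajectory f z gam (stage z)) - 1)
      <= lsc_env D W z - 1 + e.
Proof.
move=> W01 cW sup x e nT e0.
have Wb z : D z -> `|W z| <= 1.
  by move=> /W01/andP[h1 h2]; rewrite ler_norml h2 (le_trans _ h1).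
pose K := [set z : 'rV[R]_n | `|z - x| <= 2 * (gap T x / 4)].
have Kout z : K z -> ~ T z by exact: stage_ball.
have cK : compact K := compact_norm_ball (gap_quarter_gt0 closedT nT).
have e20 : 0 < e / 2 by rewrite divr_gt0.
have Dn z (nTz : ~ T z) : nbhs z D := outside_ext_domain closedT nTz.
have cWn z : ~ T z -> W @ z --> W z.
  move=> nTz; have Dz := nbhs_singleton (Dn z nTz).
  have := cW z Dz; apply: cvg_trans; apply: cvg_app => B /= DB.
  by apply: filterS2 (Dn z nTz) DB => y Dy; exact.
have lscE z : ~ T z -> lsc_env D W z = W z.
  move=> nTz; have Dz := nbhs_singleton (Dn z nTz).
  apply/eqP; rewrite eq_le (lsc_env_le Wb Dz)/=; apply/ler_addgt0Pr => d d0.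
  rewrite -lerBlDr; apply: (lsc_env_ge Wb Dz).
  move/cvgrPdist_lt : (cWn z nTz) => /(_ d d0); apply: filterS => y + _.
  by rewrite ltr_distlC => /andP[/ltW].
have near_cov := (compact_near_coveringP K).1 cK.
pose P (rho : R) (z : 'rV[R]_n) := forall z', `|z - z'| <= rho -> W z' <= W z + e / 2.
have : \forall rho \near (0 : R)^'+, K `<=` P rho.
  apply: near_cov => z /Kout nTz.
  have e40 : 0 < e / 4 by rewrite divr_gt0.
  move/cvgrPdist_lt : (cWn z nTz) => /(_ _ e40)/nbhs_ballP[d /= d0 hd].
  have d20 : 0 < d / 2 by rewrite divr_gt0.
  exists (ball z (d / 2), [set rho : R | 0 < rho < d / 2]) => /=.
    split; first exact: nbhsx_ballx.
    by near=> rho; rewrite /= ; apply/andP; split; near: rho;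
      [exact: nbhs_right_gt|exact: nbhs_right_lt].
  move=> [z1 rho] [/= zz1 /andP[rho0 rhod]] z2 z12.
  have b1 : ball z d z1 by apply: le_ball zz1; lra.
  have b2 : ball z d z2.
    move: zz1; rewrite -ball_normE /ball_/= => zz1.
    by rewrite -(subrKA z1) (le_lt_trans (ler_normD _ _))//; lra.
  have := hd _ b1; have := hd _ b2; rewrite /= !ltr_norml => /andP[h1 h2] /andP[h3 h4].
  by lra.
move=> hrho.
have [rho [rho0 hP]] : exists rho : R, 0 < rho /\ K `<=` P rho.
  have : \forall rho \near (0 : R)^'+, 0 < rho /\ K `<=` P rho.
    by apply: filterI => //; exact: nbhs_right_gt.
  by move=> /filter_ex.
have rho'0 : 0 < Num.min rho (e / 2) by rewrite lt_min rho0.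
have [gam [xh [cg Kxh hxh h]]] := supersolution_aim cs closedT M_gt0 hM W01 sup nT rho'0.
exists gam => //.
move: hxh; rewrite le_min => /andP[hx1 hx2].
set y := trajectory f x gam (stage x) in hx1 hx2 *.
have nTy : ~ T y.
  have hy : `|y - x| <= gap T x / 4.
    by apply: (stage_stay cs M_gt0 hM cg); rewrite lexx ltW// (stage_gt0 closedT M_gt0).
  apply: (stage_ball closedT nT); apply: (le_trans hy).
  by have := gap_quarter_gt0 closedT nT; lra.
have := hP xh Kxh y hx1.
rewrite (lscE y nTy) => Wy.
move: h; rewrite (lscE xh (Kout _ Kxh)) => h.
have m2 : Num.min rho (e / 2) <= e / 2 by rewrite ge_min lexx orbT.
have E1 : expR (- rcost x gam (stage x)) * (e / 2) <= e / 2.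
  by rewrite ler_piMl ?(ltW e20)// -expR0 ler_expR oppr_le0 (run_cost_ge0 cs).
have E2 : expR (- rcost x gam (stage x)) * (W y - 1) <=
    expR (- rcost x gam (stage x)) * (W xh - 1 + e / 2).
  by rewrite ler_wpM2l ?expR_ge0//; lra.
by move: E2; rewrite mulrDr; lra.
Unshelve. all: by end_near. Qed.

End Globalization.

(** * Compactness under convexity *)

Section UltraLimit.
Context {R : realType}.
Variable U : set_system nat.
Context {ultraU : UltraFilter U}.
Implicit Types (u : nat -> R) (c : R).

(** Along an ultrafilter all bounded sequences converge at once. This replaces the extraction of
    subsequences, here for the integrals over all measurable sets simultaneously. *)
Lemma ultra_bounded_cvg u c : (forall k, `|u k| <= c) -> u @ U --> lim (u @ U).
Proof.
move=> uc.
have cK : compact (`[- c, c]%classic : set R) by exact: segment_compact.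
have FK : (u @ U) `[- c, c]%classic.
  have : \forall k \near U, `[- c, c]%classic (u k).
    by apply: filterE => k /=; rewrite in_itv/= -ler_norml.
  exact.
have [p [_ clp]] := cK _ _ FK.
suff up : u @ U --> p by rewrite (cvg_lim _ up).
move=> B Bp; have [//|h] := in_ultra_setVsetC (u @^-1` B) ultraU.
by have [z []] := clp (~` B) B h Bp.
Qed.

End UltraLimit.

(** * Weak limits of uniformly bounded integrands *)

Section WeakLimit.
Context {R : realType}.
Local Notation mu := (@lebesgue_measure R).
Variable U : set_system nat.
Context {ultraU : UltraFilter U}.
Variables (F : nat -> R -> R) (h C : R).
Hypothesis F_locbm : forall k, locbm (F k).
Hypothesis F_bound : forall k s, 0 <= s <= h -> `|F k s| <= C.
Local Notation Ih := (`[0, h]%classic : set R).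
Implicit Types (B : set (measurableTypeR R)).

Let mass B : R := fine (mu (B `&` Ih)).
Let J k B : R := \int[mu]_(s in B `&` Ih) F k s.
Let nur B : R := lim (J ^~ B @ U).

Let muI_fin B : measurable B -> (mu (B `&` Ih) < +oo)%E.
Proof.
move=> mB; apply: (@le_lt_trans _ _ (mu Ih)).
  by apply: le_measure; rewrite ?inE//; exact: measurableI.
by apply: (@compact_finite_measure _ `[0, h]%classic); exact: segment_compact.
Qed.

Let F_int k B : measurable B -> mu.-integrable (B `&` Ih) (EFin \o F k).
Proof.
move=> mB; apply: (integrableS _ _ _ (locbm_integrable h (F_locbm k) (lexx 0))) => //.
exact: measurableI.
Qed.

Let J_bound k B : measurable B -> `|J k B| <= C * mass B.
Proof.
move=> mB; have mBI : measurable (B `&` Ih) by exact: measurableI.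
rewrite (le_trans (le_normr_Rintegral mBI (F_int k mB)))//.
rewrite /mass -(Rintegral_cst mu mBI); apply: le_Rintegral => //.
- exact: integrable_norm (F_int k mB).
- apply: measurable_bounded_integrable => //; first exact: muI_fin.
  by exists `|C|; split; [exact: num_real|move=> D CD s _; exact: ltW].
- by move=> s [_ /=]; rewrite in_itv/=; exact: F_bound.
Qed.

Let J_cvg B : measurable B -> J ^~ B @ U --> nur B.
Proof. by move=> mB; exact: (ultra_bounded_cvg (fun k => J_bound k mB)). Qed.

Let nur_bound B : measurable B -> `|nur B| <= C * mass B.
Proof.
move=> mB; have h1 := J_cvg mB; have h2 : `|J k B| @[k --> U] --> `|nur B| by exact: cvg_norm.
exact: (cvgr_to_le h2 (filterE _ (fun k => J_bound k mB))).
Qed.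

Let nurU B B' : measurable B -> measurable B' -> [disjoint B & B'] ->
  nur (B `|` B') = nur B + nur B'.
Proof.
move=> mB mB' dB; have mU : measurable (B `|` B') by exact: measurableU.
have h1 : (J ^~ B \+ J ^~ B') @ U --> nur B + nur B'.
  exact: cvgD (J_cvg mB) (J_cvg mB').
have -> : nur B + nur B' = lim (J ^~ B \+ J ^~ B' @ U) by exact/esym/cvg_lim.
congr (lim (_ @ U)); apply/funext => k; rewrite /J /= setIUl Rintegral_setU//.
- exact: measurableI.
- exact: measurableI.
- by rewrite -setIUl; exact: F_int.
- apply/disj_setPS => s [[Bs _] [B's _]]; move/disj_setPS : dB; exact.
Qed.

Let nu B : \bar R := (nur B)%:E.

Let mass0 : mass set0 = 0. Proof. by rewrite /mass set0I measure0. Qed.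

Let nur0 : nur set0 = 0.
Proof.
have := nur_bound measurable0; rewrite mass0 mulr0 normr_le0.
by move/eqP.
Qed.

(** Finite additivity passes to the limit. Countable additivity then follows because the mass of the
    tail unions tends to 0 and [C * mass] dominates [nur]. *)
Let nu_sigma_additive : semi_sigma_additive nu.
Proof.
move=> G mG tG mUG.
pose Tl N := \bigcup_(i in [set i | (N <= i)%N]) G i.
have mT N : measurable (Tl N) by exact: bigcup_measurable.
have Tl0 : Tl 0 = \bigcup_i G i by apply: eq_bigcupl; split.
have TlS N : Tl N = G N `|` Tl N.+1.
  apply/seteqP; split => [s [i /= Ni Gi]|s [GN|[i /= Ni Gi]]].
  - move: Ni; rewrite leq_eqVlt => /predU1P[->|Ni]; first by left.
    by right; exists i.
  - by exists N => /=.
  - by exists i => //=; exact: ltnW.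
have disj N : [disjoint G N & Tl N.+1].
  apply/disj_setPS => s [GN [i /= Ni Gi]].
  have /(_ (ex_intro _ s (conj GN Gi))) := tG N i I I.
  by move=> Ne; move: Ni; rewrite Ne ltnn.
have sumE N : nur (\bigcup_i G i) = \sum_(i < N) nur (G i) + nur (Tl N).
  elim: N => [|N IH]; first by rewrite big_ord0 add0r Tl0.
  by rewrite IH TlS nurU// big_ord_recr /= addrA.
have mass_cvg : mass (Tl N) @[N --> \oo] --> 0.
  have E0 : \bigcap_N (Tl N `&` Ih) = set0.
    rewrite -subset0 => s h1.
    have [[i /= _ Gi] _] := h1 0 I; have [[j /= ij Gj] _] := h1 i.+1 I.
    have /(_ (ex_intro _ s (conj Gi Gj))) := tG i j I I.
    by move=> E; move: ij; rewrite E ltnn.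
  have mTI N : measurable (Tl N `&` Ih) by exact: measurableI.
  have : mu (Tl N `&` Ih) @[N --> \oo] --> mu (\bigcap_N (Tl N `&` Ih)).
    apply: nonincreasing_cvg_mu => //.
    - exact: muI_fin.
    - by rewrite E0.
    - move=> N N' NN'; apply/subsetPset => s [[i /= Ni Gi] sI]; split => //.
      by exists i => //=; exact: leq_trans Ni.
  rewrite E0 measure0 => h1.
  exact: (fine_cvg h1).
have nur_cvg : (\sum_(i < N) nur (G i)) @[N --> \oo] --> nur (\bigcup_i G i).
  apply/cvgrPdist_le => e e0.
  have CT : C * mass (Tl N) @[N --> \oo] --> C * 0 by apply: cvgMr.
  rewrite mulr0 in CT.
  move/cvgrPdist_le : CT => /(_ e e0); apply: filterS => N.
  rewrite sub0r normrN [in X in _ -> X](sumE N) addrC addKr => h1.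
  by rewrite (le_trans (nur_bound (mT N)))// (le_trans _ h1)// ler_norm.
rewrite /nu; under eq_fun do rewrite sumEFin big_mkord.
by apply: cvg_EFin; [exact: nearW|exact: nur_cvg].
Qed.

(* The limit along [U] of the integrals of [F k] over a set is a charge, by the
   uniform bound; [v] is its density. *)
Lemma weak_limit : exists v : R -> R,
  [/\ forall t, 0 <= t -> mu.-integrable `[0, t] (EFin \o v),
      forall t, 0 <= t <= h -> RI (F k) 0 t @[k --> U] --> RI v 0 t,
      measurable_fun setT v &
      {ae mu, forall t, 0 < t -> derivable (RI v 0) t 1 /\ derive1 (RI v 0) t = v t}].
Proof.
pose nuc : {charge set (measurableTypeR R) -> \bar R} :=
  HB.pack nu (isCharge.Build _ _ _ nu (congr1 EFin nur0) (fun B _ => erefl : nu B \is a fin_num) nu_sigma_additive).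
have dom : nuc `<< mu.
  move=> N N0 B mB BN; rewrite /nuc /= /nu; congr EFin.
  have := nur_bound mB; rewrite (_ : mass B = 0) ?mulr0 ?normr_le0; first by move/eqP.
  rewrite /mass (_ : mu (B `&` Ih) = 0%E)//; apply: N0; first exact: measurableI.
  by move=> s [Bs _]; exact: BN.
pose v := fine \o Radon_Nikodym nuc mu.
have vE : EFin \o v = Radon_Nikodym nuc mu.
  by apply/funext => s /=; rewrite fineK// Radon_Nikodym_fin_num.
have vint : mu.-integrable setT (EFin \o v) by rewrite vE; exact: Radon_Nikodym_integrable.
have vintS B : measurable B -> mu.-integrable B (EFin \o v).
  by move=> mB; exact: integrableS vint.
exists v; split.
- by move=> t t0; apply: vintS.
- move=> t /andP[t0 th].
  have mt : measurable (`[0, t]%classic : set (measurableTypeR R)) by exact: measurable_itv.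
  have -> : RI v 0 t = nur `[0, t]%classic.
    rewrite /RI /Rintegral; have := Radon_Nikodym_integral dom mt.
    by rewrite -vE => <-.
  have tI : `[0, t]%classic `&` Ih = `[0, t]%classic.
    by apply/setIidPl; apply: subset_itvl; rewrite bnd_simp.
  have := J_cvg mt; rewrite /J tI; exact.
- by apply/measurable_EFinP; exact: measurable_int vint.
- apply: (@FTC1 _ v (BLeft 0)) => //.
    by move=> y; apply: vintS.
  apply: open_integrable_locally => //; exact: openT.
Qed.

End WeakLimit.

(** * Support inequalities and attained velocities *)

Section VelocitySets.
Context {R : realType} {n m : nat}.
Variables (A : set 'rV[R]_m)
  (f : 'rV[R]_n -> 'rV[R]_m -> 'rV[R]_n) (l : 'rV[R]_n -> 'rV[R]_m -> R).
Hypothesis cs : control_system A f l.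
Implicit Types (x y z p v : 'rV[R]_n) (a b : 'rV[R]_m).

Lemma section_continuous {V : topologicalType} (F : 'rV[R]_n * 'rV[R]_m -> V) x :
  {within [set: 'rV[R]_n] `*` A, continuous F} -> {within A, continuous (fun a => F (x, a))}.
Proof.
move=> /subspace_continuousP cF; apply/subspace_continuousP => a Aa.
have := cF (x, a) (conj I Aa); apply: cvg_comp => B /= [[B1 B2] /= [nB1 nB2] hB].
apply: filterS nB2 => b B2b Ab; apply: hB => //; split => //=.
exact: nbhs_singleton.
Qed.

Lemma compact_continuous_min (K : set 'rV[R]_m) (g : 'rV[R]_m -> R) : compact K -> K !=set0 ->
  (forall a, K a -> 0 <= g a) -> {within K, continuous g} ->
  exists2 a, K a & forall b, K b -> g a <= g b.
Proof.
move=> cK K0 g0 cg; apply: (lsc_min cK K0 g0) => a e Ka e0.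
apply: filterS (within_continuous_dist cg Ka e0) => b h Kb.
by have := h Kb; rewrite ltr_norml => /andP[_]; lra.
Qed.

(* The first-order condition at the point of the velocity-cost set nearest to
   [(v, lam)] contradicts the support inequality in the direction of the
   difference, unless the distance is 0. *)
Lemma velocity_attained x v (lam : R) : convex_set (velocity_cost_set A f l x) ->
  (forall p (q c : R), 0 <= q -> (forall a, A a -> c <= dotp p (f x a) + q * l x a) ->
     c <= dotp p v + q * lam) ->
  exists2 a, A a & f x a = v /\ l x a <= lam.
Proof.
move=> cvx supp.
(* The velocity-cost set is closed upwards in the cost, so only the excess over [lam] enters the
   squared distance [psi]. *)
pose q (a : 'rV[R]_m) : R := Num.max 0 (l x a - lam).
pose psi (a : 'rV[R]_m) : R := dotp (f x a - v) (f x a - v) + q a * q a.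
have q0 a : 0 <= q a by rewrite le_max lexx.
have psi0 a : A a -> 0 <= psi a by move=> _; rewrite addr_ge0 ?dotp_ge0// mulr_ge0.
have cf : {within A, continuous (f x)} := section_continuous (x := x) (cs_contf cs).
have cl : {within A, continuous (l x)} := section_continuous (x := x) (cs_contl cs).
have cpsi : {within A, continuous psi}.
  have -> : psi = (fun a => quad 1 v (f x a) + q a * q a).
    by apply/funext => a; rewrite /quad mul1r.
  have cq : {within A, continuous q}.
    move=> a; apply: (@continuous_comp (subspace A) R R (l x) (fun r : R => Num.max 0 (r - lam))); first exact: cl.
    by apply: continuous_max; [exact: cst_continuous|apply: continuousB; [move=> ? ?|exact: cst_continuous]].
  have cquad : {within A, continuous (fun a => quad 1 v (f x a))}.
    move=> a; apply: (@continuous_comp (subspace A) 'rV[R]_n R (f x) (quad 1 v)); first exact: cf.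
    exact: differentiable_continuous (quad_differentiable _ _ _).
  move/subspace_continuousP : cq => cq; move/subspace_continuousP : cquad => cquad.
  apply/subspace_continuousP => a Aa; apply: cvgD; first exact: cquad.
  by apply: cvgM; exact: cq.
have [a0 Aa0 hmin] := compact_continuous_min (cs_compact cs) (cs_nonempty cs) psi0 cpsi.
set w := f x a0 - v in hmin.
have key a : A a -> 0 <= dotp w (f x a - f x a0) + q a0 * (l x a - l x a0).
  move=> Aa.
  set u := f x a - f x a0; set d := l x a - l x a0.
  have quad s : 0 < s -> s <= 1 -> 0 <= 2 * (dotp w u + q a0 * d) + s * (dotp u u + d * d).
    move=> s0 s1.
    have [b [Ab fb lb]] : exists b, [/\ A b, f x b = f x a0 + s *: u & l x b <= l x a0 + s * d].
      have hin c : A c -> ((f x c, l x c) : convex_lmodType ('rV[R]_n * R^o)%type) \in velocity_cost_set A f l x.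
        by move=> Ac; rewrite inE; exists c.
      have := cvx _ _ (Itv01 (ltW s0) s1) (hin a Aa) (hin a0 Aa0).
      rewrite inE => -[b [Ab /= fb lb]]; exists b; split => //.
        rewrite -fb /u; apply/rowP => j; rewrite !mxE /unstable.onem; ring.
      by apply: (le_trans lb); rewrite /d /unstable.onem /GRing.scale/=; lra.
    have := hmin b Ab; rewrite /psi fb.
    have -> : f x a0 + s *: u - v = w + s *: u by rewrite /w addrAC.
    rewrite dotp_add_scale -/w => h.
    have qb : q b <= `|q a0 + s * d|.
      rewrite /q ge_max normr_ge0/=.
      apply: le_trans (ler_norm _).
      have h1 : l x a0 - lam <= Num.max 0 (l x a0 - lam) by rewrite le_max lexx orbT.
      by rewrite /q; lra.
    have qb2 : q b * q b <= (q a0 + s * d) * (q a0 + s * d).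
      by rewrite -!expr2 -[leRHS]real_normK ?num_real// lerXn2r ?nnegrE.
    have : 0 <= s * (2 * (dotp w u + q a0 * d) + s * (dotp u u + d * d)).
      by move: h qb2; lra.
    by rewrite pmulr_rge0.
  rewrite leNgt; apply/negP => neg.
  set X := dotp w u + q a0 * d in neg quad; set Y := dotp u u + d * d in quad.
  have Y0 : 0 <= Y by rewrite addr_ge0 ?dotp_ge0// -expr2 sqr_ge0.
  (* So short a step that the quadratic term [s * Y] cannot make up for the negative first-order
     term [2 * X]. *)
  pose s := Num.min 1 (- X / (Y + 1)).
  have Y1 : 0 < Y + 1 by lra.
  have s0 : 0 < s by rewrite lt_min ltr01 divr_gt0// oppr_gt0.
  have s1 : s <= 1 by rewrite ge_min lexx.
  have := quad s s0 s1.
  have : s * Y <= - X.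
    have : s * (Y + 1) <= - X by rewrite -ler_pdivlMr// ge_min lexx orbT.
    by lra.
  by lra.
have := supp w (q a0) (dotp w (f x a0) + q a0 * l x a0) (q0 a0).
have h a : A a -> dotp w (f x a0) + q a0 * l x a0 <= dotp w (f x a) + q a0 * l x a.
  by move=> /key; rewrite dotpBr; lra.
move=> /(_ h) h2.
have qq : q a0 * (l x a0 - lam) = q a0 * q a0.
  have [h3|h3] := leP (l x a0 - lam) 0.
    by have -> : q a0 = 0 by [rewrite /q; apply/max_idPl]; rewrite !mul0r.
  by congr (_ * _); rewrite /q; apply/esym/max_idPr/ltW.
have ww : dotp w w = dotp w (f x a0) - dotp w v by rewrite -dotpBr.
have w0 : 0 <= dotp w w by rewrite dotp_ge0.
have q20 : 0 <= q a0 * q a0 by rewrite mulr_ge0.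
have : dotp w w + q a0 * q a0 <= 0 by rewrite -qq ww; lra.
move=> h3.
exists a0 => //; split.
  apply/eqP; rewrite -subr_eq0 -/w -normr_eq0 -sqrf_eq0.
  by rewrite eq_le sqr_ge0 andbT (le_trans (norm_sqr_le_dotp w))//; lra.
have : q a0 == 0 by rewrite -sqrf_eq0 eq_le sqr_ge0 andbT expr2; lra.
move=> /eqP qa; have : l x a0 - lam <= 0 by rewrite -qa /q le_max lexx orbT.
by lra.
Qed.

End VelocitySets.

(** * Measurable selection of zeros *)

Section Selection.
Context {R : realType} {m : nat}.
Variable A : set 'rV[R]_m.
Hypothesis cA : compact A.
Implicit Types (a b : 'rV[R]_m) (K : set 'rV[R]_m).

Lemma rat_vector_dense a (e : R) : 0 < e ->
  exists q : 'rV[rat]_m, `|a - map_mx ratr q| < e.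
Proof.
move=> e0; have e20 : 0 < e / 2 by rewrite divr_gt0.
have h i : exists q : rat, `|a 0 i - ratr q| <= e / 2.
  have lt : a 0 i - e / 2 < a 0 i + e / 2 by lra.
  have [q] := rat_in_itvoo lt; rewrite in_itv/= => /andP[q1 q2].
  by exists q; rewrite ler_norml; apply/andP; split; lra.
have [q hq] := choice h.
exists (\row_i q i); apply: (@le_lt_trans _ _ (e / 2)); last by lra.
by apply: norm_rV_le => [|i]; [exact: ltW|rewrite !mxE].
Qed.

(** Each ball of radius [j.+1%:R^-1] around a rational vector that meets [K] contributes one point
    of [K]; there are countably many such balls. *)
Lemma dense_sequence K : K !=set0 -> exists d : nat -> 'rV[R]_m,
  (forall k, K (d k)) /\ forall a (e : R), K a -> 0 < e -> exists k, `|a - d k| < e.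
Proof.
move=> [a0 Ka0].
have h (k : nat) : exists b, K b /\ forall q j, unpickle k = Some (q : 'rV[rat]_m, j : nat) ->
    (exists2 a, K a & `|a - map_mx ratr q| < j.+1%:R^-1) -> `|b - map_mx ratr q| < j.+1%:R^-1.
  case E : (unpickle k) => [[q j]|]; last by exists a0.
  have [[b Kb hb]|hn] := pselect (exists2 a, K a & `|a - map_mx ratr q| < j.+1%:R^-1).
    by exists b; split => // q' j' [<- <-].
  by exists a0; split => // q' j' [<- <-].
have [d hd] := choice h; exists d; split => [k|a e Ka e0]; first by have [] := hd k.
pose j := Num.bound (2 / e).
have je : 2 / j.+1%:R < e.
  rewrite ltr_pdivrMr// mulrC -ltr_pdivrMr//.
  apply: (lt_trans (archi_boundP _)); first by rewrite divr_ge0// ltW.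
  by rewrite ltr_nat.
have j0 : (0 : R) < j.+1%:R^-1 by rewrite invr_gt0.
have [q hq] := rat_vector_dense a j0.
exists (pickle (q, j)); have [_ /(_ q j)] := hd (pickle (q, j)).
rewrite pickleK => /(_ erefl (ex_intro2 _ _ a Ka hq)) h1.
rewrite -(subrKA (map_mx ratr q)); apply: (le_lt_trans (ler_normD _ _)).
rewrite (distrC (map_mx ratr q)); apply: lt_trans je.
by rewrite [ltRHS]mulrC mulr_natr mulr2n ltrD.
Qed.

Variable E : set (measurableTypeR R).
Hypothesis mE : measurable E.

Definition solvable_integrand (phi : R -> 'rV[R]_m -> R) := [/\
  forall t a, E t -> A a -> 0 <= phi t a,
  forall a, A a -> measurable_fun E (fun t => phi t a),
  forall t, E t -> {within A, continuous (phi t)} &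
  forall t, E t -> exists2 a, A a & phi t a = 0].

(** On a compact set a nonnegative continuous function has a zero exactly when its infimum is 0, and
    the infimum can be taken over a dense sequence. *)
Lemma measurable_solvable phi K : solvable_integrand phi -> compact K -> K `<=` A ->
  measurable (E `&` [set t | exists2 a, K a & phi t a = 0]).
Proof.
move=> [phi0 mphi cphi _] cK KA.
have [K0|K0] := pselect (K !=set0); last first.
  rewrite (_ : _ `&` _ = set0)//; apply/seteqP; split => // t [_ [a]].
  by move=> Ka _; apply: K0; exists a.
have [d [Kd hd]] := dense_sequence K0.
have -> : E `&` [set t | exists2 a, K a & phi t a = 0] =
    \bigcap_N \bigcup_k (E `&` [set t | phi t (d k) < N.+1%:R^-1]).
  apply/seteqP; split => [t [Et [a Ka pa]] N _|t h].
    have N0 : (0 : R) < N.+1%:R^-1 by rewrite invr_gt0.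
    have /nbhs_ballP[r /= r0 hr] := within_continuous_dist (cphi t Et) (KA _ Ka) N0.
    have [k hk] := hd a r Ka r0; exists k => //; split => //=.
    have := hr (d k); rewrite -ball_normE => /(_ hk (KA _ (Kd k))).
    by rewrite pa sub0r normrN; apply: le_lt_trans; exact: ler_norm.
  have [k0 _ [Et _]] := h 0%N I; split => //.
  have pK0 a : K a -> 0 <= phi t a by move=> /KA; exact: phi0.
  have cKt : {within K, continuous (phi t)} := continuous_subspaceW KA (cphi t Et).
  have [a Ka hmin] := compact_continuous_min cK K0 pK0 cKt.
  exists a => //; apply/eqP; rewrite eq_le pK0// andbT.
  apply/ler_addgt0Pr => e e0; rewrite add0r.
  have [N hN] : exists N : nat, N.+1%:R^-1 < e.
    exists (Num.bound e^-1); rewrite invf_plt ?posrE//.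
    apply: (lt_trans (archi_boundP _)); first by rewrite invr_ge0 ltW.
    by rewrite ltr_nat.
  have [k _ [_ /= hk]] := h N I.
  by rewrite (le_trans (hmin _ (Kd k)))// ltW// (lt_trans hk).
apply: bigcap_measurable => // N _; apply: bigcup_measurable => k _.
have := mphi (d k) (KA _ (Kd k)) mE _ (measurable_itv `]-oo, N.+1%:R^-1[).
by congr measurable; apply/seteqP; split => t [Et] /=; rewrite in_itv.
Qed.

(* [c t] is the least [j]-th coordinate of a zero of [phi t]. *)
Lemma select_coordinate phi (j : 'I_m) : solvable_integrand phi ->
  exists c : R -> R, measurable_fun E c /\
    solvable_integrand (fun t a => phi t a + `|a 0 j - c t|).
Proof.
move=> sphi; have [phi0 mphi cphi ex0] := sphi.
pose S t := [set a 0 j | a in [set a | A a /\ phi t a = 0]].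
pose c t := inf (S t).
have cj : continuous (fun a : 'rV[R]_m => a 0 j) by move=> a; exact: coord_continuous.
have [B hB] : exists B : R, forall a, A a -> `|a| <= B.
  by have [B [_ hB]] := compact_bounded cA; exists (B + 1) => a Aa; apply: hB; rewrite ?ltrDl.
have Slb t : E t -> has_inf (S t).
  move=> Et; have [a Aa pa] := ex0 t Et; split; first by exists (a 0 j), a.
  exists (- B) => _ [b [Ab _] <-].
  by have := le_trans (coord_le_norm b j) (hB b Ab); rewrite ler_norml => /andP[].
have le_att t a : E t -> A a -> phi t a = 0 -> c t <= a 0 j.
  by move=> Et Aa pa; apply: ge_inf; [case: (Slb t Et)|exists a].
have att t : E t -> exists2 a, A a /\ phi t a = 0 & a 0 j = c t.
  move=> Et; pose g (a : 'rV[R]_m) : R := phi t a + Num.max 0 (a 0 j - c t).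
  have m0 a : 0 <= Num.max 0 (a 0 j - c t) by rewrite le_max lexx.
  have g0 a : A a -> 0 <= g a by move=> Aa; rewrite addr_ge0// phi0.
  have cg : {within A, continuous g}.
    have /subspace_continuousP ct := cphi t Et.
    apply/subspace_continuousP => a Aa; apply: cvgD; first exact: ct.
    apply: cvg_within_filter.
    apply: (@continuous_max R _ (fun=> 0) (fun a : 'rV[R]_m => a 0 j - c t) a); first exact: cst_continuous.
    by apply: continuousB; [exact: cj|exact: cst_continuous].
  have [b0 Ab0 _] := ex0 t Et.
  have [a Aa hmin] := compact_continuous_min cA (ex_intro _ b0 Ab0) g0 cg.
  have ga : g a <= 0.
    apply/ler_addgt0Pr => e e0; rewrite add0r.
    have [_ [b [Ab pb] <-] hb] := inf_adherent e0 (Slb t Et).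
    apply: (le_trans (hmin b Ab)); rewrite /g pb add0r ge_max (ltW e0) lerBlDl ltW//.
  have pa0 := phi0 t a Et Aa; have ma0 := m0 a.
  have pa : phi t a = 0 by apply/eqP; rewrite eq_le pa0 andbT; move: ga; rewrite /g; lra.
  exists a => //; apply/eqP; rewrite eq_le le_att// andbT -subr_le0.
  apply: le_trans ga; rewrite /g pa add0r le_max lexx orbT//.
have mc : measurable_fun E c.
  apply: (measurability _ (RGenOInfty.measurableE R)) => _ [_ [x ->] <-].
  (* [c t <= x] holds exactly when [phi t] has a zero in the compact part of [A] where [a 0 j <= x];
     the least coordinate is attained. *)
  have -> : E `&` c @^-1` `]x, +oo[ =
      E `\` (E `&` [set t | exists2 a, (A `&` [set a | a 0 j <= x]) a & phi t a = 0]).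
    apply/seteqP; split => [t [Et /=]|t [Et hn]].
      rewrite in_itv/= andbT => xc; split => // -[_ [a [Aa ax] pa]].
      by have := lt_le_trans xc (le_att t a Et Aa pa); rewrite ltNge ax.
    split => //=; rewrite in_itv/= andbT ltNge; apply/negP => cx.
    by have [a [Aa pa] ac] := att t Et; apply: hn; split => //; exists a => //; split => //=; rewrite ac.
  apply: measurableD => //; apply: measurable_solvable => //.
  apply: compact_closedI => //.
  by apply: (closed_comp (f := fun a : 'rV[R]_m => a 0 j) (D := [set r : R | r <= x])) => //; exact: closed_le.
exists c; split => //; split.
- by move=> t a Et Aa; rewrite addr_ge0// phi0.
- move=> a Aa; apply: measurable_funD; first exact: mphi.
  by apply: measurableT_comp => //; apply: measurable_funB.
- move=> t Et; have /subspace_continuousP ct := cphi t Et.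
  apply/subspace_continuousP => a Aa; apply: cvgD; first exact: ct.
  apply: cvg_within_filter; apply: cvg_norm.
  by apply: cvgB; [exact: cj|exact: cvg_cst].
- by move=> t Et; have [a [Aa pa] ac] := att t Et; exists a => //; rewrite pa ac subrr normr0 addr0.
Qed.

(** Each added term [|a 0 j - c t|] fixes one coordinate of the zeros and keeps the integrand
    solvable, so the step can be repeated until the zero is unique. *)
Lemma select_coordinates phi (s : seq 'I_m) : solvable_integrand phi ->
  exists psi, [/\ solvable_integrand psi,
    forall t a, E t -> A a -> psi t a = 0 -> phi t a = 0 &
    forall j, j \in s -> exists2 c : R -> R, measurable_fun E c &
      forall t a, E t -> A a -> psi t a = 0 -> a 0 j = c t].
Proof.
move=> sphi; elim: s => [|j s [psi [spsi psiphi hs]]]; first by exists phi.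
have [c [mc sc]] := select_coordinate j spsi; have [psi0 _ _ _] := spsi.
have z t a : E t -> A a -> psi t a + `|a 0 j - c t| = 0 -> psi t a = 0 /\ a 0 j = c t.
  move=> Et Aa /eqP; rewrite paddr_eq0 ?psi0// => /andP[/eqP -> ].
  by rewrite normr_eq0 subr_eq0 => /eqP.
exists (fun t a => psi t a + `|a 0 j - c t|); split => //.
- by move=> t a Et Aa /(z _ _ Et Aa)[+ _]; exact: psiphi.
- move=> i; rewrite inE => /predU1P[->|/hs[ci mci hci]].
    by exists c => // t a Et Aa /(z _ _ Et Aa)[].
  by exists ci => // t a Et Aa /(z _ _ Et Aa)[/hci + _]; exact.
Qed.

Lemma measurable_selection phi : solvable_integrand phi ->
  exists alpha : R -> 'rV[R]_m, (forall j, measurable_fun E (fun t => alpha t 0 j)) /\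
    forall t, E t -> A (alpha t) /\ phi t (alpha t) = 0.
Proof.
move=> sphi; have [psi [[_ _ _ ex0] psiphi hs]] := select_coordinates (enum 'I_m) sphi.
have h j : exists c : R -> R, measurable_fun E c /\
      forall t a, E t -> A a -> psi t a = 0 -> a 0 j = c t.
  by have [|c mc hc] := hs j; [rewrite mem_enum|exists c].
have [c hc] := choice h.
exists (fun t => \row_j c j t); split => [j|t Et].
  by apply: eq_measurable_fun (hc j).1 => t _; rewrite mxE.
have [a Aa pa] := ex0 t Et.
have -> : \row_j c j t = a by apply/rowP => j; rewrite mxE ((hc j).2 t a).
by split => //; exact: psiphi.
Qed.

End Selection.


Lemma cvg_sumr {R : realType} {S : Type} (F : set_system S) {FF : Filter F} (I : Type)
    (r : seq I) (u : I -> S -> R) (c : I -> R) :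
  (forall i, u i @ F --> c i) ->
  (fun x => \sum_(i <- r) u i x) @ F --> \sum_(i <- r) c i.
Proof.
move=> uc; elim: r => [|i r IH].
  by rewrite big_nil; under eq_fun do rewrite big_nil; exact: cvg_cst.
by rewrite big_cons; under eq_fun do rewrite big_cons; apply: cvgD => //; exact: uc.
Qed.

(** * Limits of trajectories in convex dynamics *)

Section RelaxedLimit.
Context {R : realType} {n m : nat}.
Variables (A : set 'rV[R]_m)
  (f : 'rV[R]_n -> 'rV[R]_m -> 'rV[R]_n) (l : 'rV[R]_n -> 'rV[R]_m -> R).
Hypothesis cs : control_system A f l.
Implicit Types (x y z p : 'rV[R]_n) (alpha beta gam : R -> 'rV[R]_m) (s t c e d : R).
Local Notation mu := (@lebesgue_measure R).
Local Notation half_line := (`[0%R, +oo[%classic : set R).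
Local Notation rcost := (run_cost f l).

Lemma right_quotient_cvg (g : R -> R) t v : derivable g t 1 -> derive1 g t = v ->
  (fun d : R => d^-1 * (g (t + d) - g t)) @ (0 : R)^'+ --> v.
Proof.
move=> dg <-; rewrite derive1E.
have : (fun d : R => d^-1 *: (g (d *: 1 + t) - g t)) @ (0 : R)^' --> 'D_1 g t by exact: dg.
move=> dgc; have right : (0 : R)^'+ --> (0 : R)^'.
  move=> B hB; have {}hB : nbhs (0 : R) [set u | u != 0 -> B u] := hB.
  by rewrite /at_right; apply: filterS hB => u hu u0; apply: hu; rewrite gt_eqF.
have := cvg_trans (cvg_app _ right) dgc.
have -> // : (fun d : R => d^-1 *: (g (d *: 1 + t) - g t)) = (fun d : R => d^-1 * (g (t + d) - g t)).
apply/funext => d; congr (_ * (g _ - _)); rewrite [RHS]addrC; congr (_ + _).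
exact: mulr1.
Qed.

(** Makes a support inequality at the limit position usable along the approximating trajectories
    nearby. *)
Lemma support_bound p (q c r : R) : 0 <= q ->
  exists2 C : R, 0 <= C & forall x y, `|x| <= r -> `|y| <= r ->
    (forall a, A a -> c <= dotp p (f x a) + q * l x a) ->
    forall a, A a -> c - C * `|y - x| <= dotp p (f y a) + q * l y a.
Proof.
move=> q0; have [L L0 hL] := cs_lipschitz cs r.
exists (n%:R * `|p| * L + q * L).
  by rewrite addr_ge0// !mulr_ge0// ltW.
move=> x y xr yr hc a Aa.
have [h1 h2] := hL y x a yr xr Aa.
have h3 : `|dotp p (f y a) - dotp p (f x a)| <= n%:R * `|p| * L * `|y - x|.
  rewrite -dotpBr (le_trans (dotp_bound _ _))// -!mulrA ler_wpM2l//.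
  by rewrite ler_wpM2l.
have h4 : `|q * l y a - q * l x a| <= q * L * `|y - x|.
  by rewrite -mulrBr normrM ger0_norm// -mulrA ler_wpM2l.
move: h3 h4; rewrite !ler_norml => /andP[h3 _] /andP[h4 _].
by have := hc a Aa; lra.
Qed.

Variables (z : 'rV[R]_n) (h : R) (gam : nat -> R -> 'rV[R]_m).
Hypothesis h_gt0 : 0 < h.
Hypothesis cgam : forall k, control A (gam k).
Hypothesis cvx : forall x, convex_set (velocity_cost_set A f l x).

Local Notation yk k := (trajectory f z (gam k)).

Let path_bound : exists B K : R, [/\ 0 <= K,
  forall k t, 0 <= t <= h -> `|yk k t| <= B,
  forall k s t, 0 <= s -> s <= t -> t <= h -> `|yk k t - yk k s| <= K * (t - s),
  forall k t, 0 <= t <= h -> `|f (yk k t) (gam k t)| <= K &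
  forall k t, 0 <= t <= h -> `|l (yk k t) (gam k t)| <= K].
Proof.
have [M M0 hM] := cs_growth cs.
pose B := `|z| + 2 * (M * (1 + `|z|) * h) * expR (2 * M * h).
have X0 : 0 < 1 + `|z| by rewrite ltr_pwDl.
have B0 : 0 <= B.
  by rewrite addr_ge0// mulr_ge0 ?expR_ge0// !mulr_ge0// ltW.
have hB k t : 0 <= t <= h -> `|yk k t| <= B.
  move=> /andP[t0 th].
  rewrite -[yk k t](subrK z) (le_trans (ler_normD _ _))// addrC lerD2l.
  rewrite (le_trans (trajectory_displacement cs z (cgam k) M0 hM t0))//.
  apply: ler_pM; rewrite ?expR_ge0// ?mulr_ge0// ?(ltW M0) ?(ltW X0)//.
    by rewrite ler_pM2l// ler_pM2l// mulr_gt0.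
  by rewrite ler_expR ler_pM2l// mulr_gt0.
have [C C0 hC] := running_cost_bounded cs B.
have K1 : 0 <= M * (1 + B) by rewrite mulr_ge0 ?(ltW M0)// addr_ge0.
exists B, (M * (1 + B) + C); split => //.
- by rewrite addr_ge0.
- move=> k s t s0 st th.
  rewrite (le_trans (trajectory_lipschitz cs (cgam k) M0 hM (hB k) s0 st th))//.
  by rewrite ler_wpM2r ?subr_ge0// lerDl.
- move=> k t /andP[t0 th]; rewrite (le_trans (hM _ _ ((cgam k).1 t t0)))//.
  rewrite (@le_trans _ _ (M * (1 + B)))// ?lerDl// ler_pM2l// lerD2l.
  by apply: hB; rewrite t0.
- move=> k t /andP[t0 th]; rewrite ger0_norm; last exact: (cs_cost_ge0 cs _ ((cgam k).1 t t0)).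
  by rewrite (le_trans (hC _ _ (hB k t _) ((cgam k).1 t t0))) ?t0// lerDr.
Qed.

(* The trajectories converge along an ultrafilter; the derivatives of the limits
   of the trajectories and of the costs satisfy all support inequalities of the
   velocity-cost set almost everywhere, hence are realized by a control. *)
Lemma relaxed_limit : exists2 alpha, control A alpha &
  forall e N, 0 < e -> exists k, [/\ (N <= k)%N,
    `|yk k h - trajectory f z alpha h| < e &
    rcost z alpha h <= rcost z (gam k) h + e].
Proof.
have [B [K [K0 yB yK fK lK]]] := path_bound.
have [U [ultraU ooU]] := @ultraFilterLemma nat \oo _.
have flb k := (locbm_field cs (cgam k) (trajectory_continuous cs z (cgam k))).1.
have llb k := (locbm_field cs (cgam k) (trajectory_continuous cs z (cgam k))).2.
have fKi i k t : 0 <= t <= h -> `|f (yk k t) (gam k t) 0 i| <= K.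
  by move=> th; rewrite (le_trans (coord_le_norm _ _))// fK.
have hv i := weak_limit (U := U) (fun k => flb k i) (fKi i).
have [v {}hv] := choice (hv ultraU).
have [lam [lamint lamcvg mlam laml]] := weak_limit (U := U) llb lK.
(* The weak limits describe the paths only up to [h]; freezing [y] afterwards makes it continuous on
   the whole half line. *)
pose y t : 'rV[R]_n := \row_i (z 0 i + RI (v i) 0 (Num.min t h)).
have ycvg t e : 0 <= t <= h -> 0 < e -> \forall k \near U, `|yk k t - y t| < e.
  move=> /andP[t0 th] e0; have e20 : 0 < e / 2 by rewrite divr_gt0.
  have hi : \forall k \near U, forall i, `|yk k t 0 i - y t 0 i| <= e / 2.
    apply: filter_forall => i; have [_ hc _ _] := hv i.
    have := hc t; rewrite t0 th => /(_ isT)/cvgrPdist_le/(_ _ e20); apply: filterS => k.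
    rewrite mxE (min_idPl th) distrC (trajectoryE cs _ (cgam k))// !mxE.
    by rewrite opprD addrACA subrr add0r.
  apply: filterS hi => k hk; apply: (@le_lt_trans _ _ (e / 2)); last by lra.
  by apply: norm_rV_le => [|i]; [exact: ltW|have := hk i; rewrite !mxE].
have ylip s t : 0 <= s -> s <= t -> t <= h -> `|y t - y s| <= K * (t - s).
  move=> s0 st th; apply/ler_addgt0Pr => e e0; have e20 : 0 < e / 2 by rewrite divr_gt0.
  have [||k [h1 h2]] := @filter_ex _ U _ _ (filterI (ycvg t (e / 2) _ e20) (ycvg s (e / 2) _ e20)).
  - by rewrite th (le_trans s0).
  - by rewrite s0 (le_trans st).
  have := yK k s t s0 st th => h3.
  have -> : y t - y s = - (yk k t - y t) + (yk k t - yk k s) + (yk k s - y s).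
    by rewrite opprB !addrA !subrK.
  rewrite (le_trans (ler_normD _ _))// (le_trans (lerD (ler_normD _ _) (lexx _)))// normrN.
  rewrite (_ : K * (t - s) + e = e / 2 + K * (t - s) + e / 2); last by field.
  exact: (lerD (lerD (ltW h1) h3) (ltW h2)).
have yB' t : 0 <= t <= h -> `|y t| <= B.
  move=> th; apply/ler_addgt0Pr => e e0.
  have [k hk] := @filter_ex _ U _ _ (ycvg t e th e0).
  have := yB k t th; have := ler_normB (yk k t) (yk k t - y t).
  by rewrite opprB addrC subrK; lra.
have cy : {within half_line, continuous y}.
  apply: loclip_continuous => b; exists K => s t s0 st tb.
  have yE u : y u = y (Num.min u h) by apply/rowP => i; rewrite !mxE -minA minxx.
  rewrite (yE t) (yE s) (@le_trans _ _ (K * (Num.min t h - Num.min s h)))//.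
    apply: ylip; first by rewrite le_min s0 ltW.
      by rewrite le_min !ge_min st lexx !orbT.
    by rewrite ge_min lexx orbT.
  apply: ler_wpM2l => //.
  have [th|/ltW th] := leP t h; first by rewrite !(min_idPl _)// (le_trans st).
  by have [sh|/ltW sh] := leP s h; lra.
pose good t := (forall i, derivable (RI (v i) 0) t 1 /\ derive1 (RI (v i) 0) t = v i t) /\
  (derivable (RI lam 0) t 1 /\ derive1 (RI lam 0) t = lam t).
(* The inequality is integrated along the approximating trajectories over [[t, t + d]]; the limit
   along [U] is taken first, then [d] tends to 0 in the difference quotient. *)
have supp t : 0 < t -> t < h -> good t ->
    forall p (q c : R), 0 <= q -> (forall a, A a -> c <= dotp p (f (y t) a) + q * l (y t) a) ->
     c <= dotp p (\row_i v i t) + q * lam t.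
  move=> t0 th [gv gl] p q c q0 hc.
  have [C C0 hC] := support_bound p c B q0.
  pose Q (d : R) := d^-1 * (dotp p (y (t + d) - y t) + q * (RI lam 0 (t + d) - RI lam 0 t)).
  (* On [[t, t + d]] the approximating positions differ from [y t] by at most [K * d] through the
     motion and [d] through the approximation, whence [K + 1]. *)
  have Qlow d : 0 < d -> t + d < h -> c - C * (K + 1) * d <= Q d.
    move=> d0 tdh.
    have th' : 0 <= t <= h by rewrite !ltW.
    have tdh' : 0 <= t + d <= h by rewrite addr_ge0 ?ltW.
    have mono : t <= t + d by rewrite lerDl ltW.
    rewrite /Q ler_pdivlMl//.
    pose S k := dotp p (yk k (t + d) - yk k t) + q * (rcost z (gam k) (t + d) - rcost z (gam k) t).
    have Scvg : S @ U --> dotp p (y (t + d) - y t) + q * (RI lam 0 (t + d) - RI lam 0 t).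
      apply: cvgD; last by apply: cvgMr; apply: cvgB; exact: lamcvg.
      rewrite dotpE; under eq_fun do rewrite dotpE.
      apply: cvg_sumr => i; apply: cvgMr; have [_ hi _ _] := hv i.
      have -> : (y (t + d) - y t) 0 i = RI (v i) 0 (t + d) - RI (v i) 0 t.
        by rewrite !mxE (min_idPl (ltW th)) (min_idPl (ltW tdh)) opprD addrACA subrr add0r.
      have : (fun k => RI (fun s => f (yk k s) (gam k s) 0 i) 0 (t + d) -
          RI (fun s => f (yk k s) (gam k s) 0 i) 0 t) @ U --> RI (v i) 0 (t + d) - RI (v i) 0 t.
        by apply: cvgB; exact: hi.
      apply: cvg_trans; apply: near_eq_cvg; apply: nearW => k /=.
      rewrite (trajectoryE cs _ (cgam k) (ltW t0)) (trajectoryE cs _ (cgam k) (addr_ge0 (ltW t0) (ltW d0))).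
      by rewrite !mxE opprD addrACA subrr add0r.
    apply: (cvgr_to_ge Scvg).
    apply: filterS (ycvg t d th' d0) => k hk.
    have [pl pE] := dotp_vRI p (t + d) (flb k) (ltW t0).
    have -> : S k = RI (fun s => dotp p (f (yk k s) (gam k s)) + q * l (yk k s) (gam k s)) t (t + d).
      rewrite RID// ?(ltW t0)//; last exact: locbmZ.
      rewrite -pE RIZ// ?(ltW t0)// /S; congr (dotp p _ + q * _).
        rewrite (trajectoryE cs _ (cgam k) (ltW t0)) (trajectoryE cs _ (cgam k) (addr_ge0 (ltW t0) (ltW d0))).
        rewrite (vRI_add (flb k) (lexx 0) (ltW t0) mono).
        by rewrite opprD addrACA subrr add0r addrC addKr.
      by rewrite !run_costE (RI_add (llb k) (lexx 0) (ltW t0) mono) addrC addKr.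
    have -> : d * (c - C * (K + 1) * d) = RI (fun=> c - C * (K + 1) * d) t (t + d).
      by rewrite RI_cst// [t + d]addrC addrK mulrC.
    apply: RI_le; rewrite ?(ltW t0)//; [exact: locbm_cst|exact: locbmD pl (locbmZ q (llb k))|].
    move=> s /andP[ts std].
    have s0 : 0 <= s by rewrite (le_trans (ltW t0)).
    have sh : 0 <= s <= h by rewrite s0 (le_trans std)// ltW.
    apply: le_trans (hC (y t) (yk k s) (yB' t th') (yB k s sh) hc (gam k s) ((cgam k).1 s s0)).
    rewrite lerD2l lerN2 -mulrA ler_wpM2l// mulrDl mul1r.
    rewrite -(subrKA (yk k t)) (le_trans (ler_normD _ _))// lerD//; last exact: ltW.
    rewrite (le_trans (yK k t s (ltW t0) ts (andP sh).2))// ler_wpM2l//.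
    by rewrite lerBlDl.
  have Qcvg : Q @ (0 : R)^'+ --> dotp p (\row_i v i t) + q * lam t.
    rewrite dotpE.
    have : (fun d : R => \sum_i p 0 i * (d^-1 * (RI (v i) 0 (t + d) - RI (v i) 0 t)) +
        q * (d^-1 * (RI lam 0 (t + d) - RI lam 0 t))) @ (0 : R)^'+ -->
      \sum_i p 0 i * (\row_i v i t) 0 i + q * lam t.
      apply: cvgD; last by apply: cvgMr; exact: (right_quotient_cvg gl.1 gl.2).
      apply: cvg_sumr => i; apply: cvgMr; rewrite mxE.
      exact: (right_quotient_cvg (gv i).1 (gv i).2).
    apply: cvg_trans; apply: near_eq_cvg; near=> d.
    have td : t + d <= h.
      by apply/ltW; rewrite -ltrBrDl; near: d; apply: nbhs_right_lt; rewrite subr_gt0.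
    rewrite /Q [RHS]mulrDr dotpE [in RHS]mulr_sumr; congr (_ + _); last by rewrite mulrCA.
    apply: eq_bigr => i _; rewrite [RHS]mulrCA !mxE (min_idPl td) (min_idPl (ltW th)).
    by rewrite opprD addrACA subrr add0r.
  have low : (fun d : R => c - C * (K + 1) * d) @ (0 : R)^'+ --> c - C * (K + 1) * 0.
    by apply: cvg_within_filter; apply: cvgB; [exact: cvg_cst|apply: cvgMr; exact: cvg_id].
  rewrite mulr0 subr0 in low.
  apply: (ler_cvg_to low Qcvg).
  near=> d; apply: Qlow => //; rewrite -ltrBrDl; near: d.
  by apply: nbhs_right_lt; rewrite subr_gt0.
have attain t : 0 < t -> t < h -> good t ->
    exists2 a, A a & f (y t) a = \row_i v i t /\ l (y t) a <= lam t.
  move=> t0 th gd; exact: (velocity_attained cs (@cvx (y t)) (supp t t0 th gd)).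
have [N0 [mN0 muN0 hN0]] : exists N0 : set (measurableTypeR R),
    [/\ measurable N0, mu N0 = 0%E & forall t, ~ N0 t -> 0 < t -> good t].
  have : \forall t \ae mu, forall i : 'I_n, 0 < t -> derivable (RI (v i) 0) t 1 /\ derive1 (RI (v i) 0) t = v i t.
    by apply: filter_forall => i; have [] := hv i.
  move=> aev; have [N [mN muN hN]] := @filterI _ _ (ae_filter_ringOfSetsType mu) _ _ aev laml.
  exists N; split => // t nNt t0.
  have [h1 h2] : (forall i : 'I_n, 0 < t -> derivable (RI (v i) 0) t 1 /\ derive1 (RI (v i) 0) t = v i t) /\
     (0 < t -> derivable (RI lam 0) t 1 /\ derive1 (RI lam 0) t = lam t).
    by apply: contrapT => hn; apply: nNt; apply: hN => -[h1 h2]; exact: hn.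
  by split => [i|]; [exact: h1|exact: h2].
pose N1 : set (measurableTypeR R) := N0 `|` [set 0; h].
have mN1 : measurable N1 by apply: measurableU => //; apply: measurableU => //; exact: measurable_set1.
have muN1 : mu N1 = 0%E.
  apply/negligibleP => //; apply: negligibleU; first exact/negligibleP.
  by apply/negligibleU; apply/negligibleP => //; exact: lebesgue_measure_set1.
pose E : set (measurableTypeR R) := `[0, h]%classic `\` N1.
have mE : measurable E by apply: measurableD => //; exact: measurable_itv.
have EP t : E t -> [/\ 0 < t, t < h & good t].
  move=> [/=]; rewrite in_itv/= => /andP[t0 th] nN1.
  have t0' : 0 < t by rewrite lt_neqAle t0 andbT eq_sym; apply/eqP => t0E; apply: nN1; right; left.
  split => //; last by apply: hN0 => // ?; apply: nN1; left.
  by rewrite lt_neqAle th andbT; apply/eqP => t0E; apply: nN1; right; right.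
(* The zeros of [phi t] in [A] are the points that realize the velocity [v t] at a cost of at most
   [lam t]. *)
pose phi t a := \sum_i `|f (y t) a 0 i - v i t| + Num.max 0 (l (y t) a - lam t).
have phi0 t a : E t -> A a -> f (y t) a = \row_i v i t -> l (y t) a <= lam t -> phi t a = 0.
  move=> _ _ fE lE; rewrite /phi fE big1 ?add0r => [|i _]; last by rewrite mxE subrr normr0.
  by apply/max_idPl; rewrite subr_le0.
have EH : E `<=` half_line by move=> t [+ _] /=; rewrite !in_itv/= andbT => /andP[].
have sphi : solvable_integrand A E phi.
  split.
  - by move=> t a _ _; rewrite addr_ge0 ?le_max ?lexx// sumr_ge0.
  - move=> a Aa; have ca : control A (fun=> a) by split => // j; exact: measurable_cst.
    have [fl ll] := locbm_field cs ca cy.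
    apply: measurable_funD.
      apply: measurable_sum => i; apply: measurableT_comp => //; apply: measurable_funB.
        exact: measurable_funS (fl i).1.
      by have [_ _ mv _] := hv i; exact: measurable_funS mv.
    apply: measurable_maxr => //; apply: measurable_funB; first exact: measurable_funS ll.1.
    exact: measurable_funS mlam.
  - move=> t Et.
    have /subspace_continuousP cf := section_continuous (x := y t) (cs_contf cs).
    have /subspace_continuousP cl := section_continuous (x := y t) (cs_contl cs).
    apply/subspace_continuousP => a Aa; apply: cvgD.
      apply: cvg_sumr => i; apply: cvg_norm; apply: cvgB; last exact: cvg_cst.
      apply: (cvg_comp (fun a => f (y t) a) (fun b : 'rV[R]_n => b 0 i)); first exact: cf.
      exact: coord_continuous.
    apply: (cvg_comp (fun a => l (y t) a) (fun r : R => Num.max 0 (r - lam t))); first exact: cl.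
    apply: (@continuous_max R _ (fun=> 0) (fun r : R => r - lam t)); first exact: cst_continuous.
    by apply: cvgB; [exact: cvg_id|exact: cvg_cst].
  - move=> t Et; have [t0 th gd] := EP t Et; have [a Aa [fE lE]] := attain t t0 th gd.
    by exists a => //; exact: phi0.
have [a0 Aa0] := cs_nonempty cs.
have [al [mal hal]] := measurable_selection (cs_compact cs) mE sphi.
pose alpha t := if t \in E then al t else a0.
have alphaE t : E t -> alpha t = al t by rewrite /alpha => /mem_set ->.
have ca : control A alpha.
  split => [t t0|j].
    by have [Et|nEt] := pselect (E t); [rewrite alphaE//; exact: (hal t Et).1|rewrite /alpha memNset].
  have -> : half_line = E `|` (half_line `\` E) by rewrite setDUK.
  apply/measurable_funU => //; first exact: measurableD.
  split; first by apply: eq_measurable_fun (mal j) => t /set_mem Et; rewrite alphaE.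
  apply: (eq_measurable_fun (fun=> a0 0 j)) => [t /set_mem [_ nEt]|]; last exact: measurable_cst.
  by rewrite /alpha memNset.
have alE t : E t -> f (y t) (alpha t) = \row_i v i t /\ l (y t) (alpha t) <= lam t.
  move=> Et; rewrite alphaE//; have [_ pz] := hal t Et.
  have s0 : 0 <= \sum_i `|f (y t) (al t) 0 i - v i t| by apply: sumr_ge0.
  have m0 : 0 <= Num.max 0 (l (y t) (al t) - lam t) by rewrite le_max lexx.
  move/eqP : pz; rewrite /phi paddr_eq0// => /andP[/eqP sz /eqP mz]; split.
    apply/rowP => i; rewrite mxE; apply/eqP; rewrite -subr_eq0 -normr_eq0.
    by move/eqP : sz; rewrite psumr_eq0// => /allP/(_ i); rewrite mem_index_enum; exact.
  by rewrite -subr_le0 -mz le_max lexx orbT.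
have [ylbm llbm] := locbm_field cs ca cy.
have aeE (u w : R -> R) t : t <= h -> measurable_fun half_line u -> measurable_fun half_line w ->
    (forall s, E s -> u s = w s) -> RI u 0 t = RI w 0 t.
  move=> th mu_ mw uw; rewrite /RI /Rintegral; congr fine.
  have sub : `[0, t]%classic `<=` half_line by move=> s /=; rewrite !in_itv/= andbT => /andP[].
  apply: ae_eq_integral => //.
  - by apply/measurable_EFinP; exact: measurable_funS mu_.
  - by apply/measurable_EFinP; exact: measurable_funS mw.
  exists N1; split => // s /= hs; apply: contrapT => nN1; apply: hs => /= st.
  congr EFin; apply: uw; split => //; move: st => /=; rewrite !in_itv/= => /andP[-> /=].
  by move=> /le_trans; exact.
have RIE i t : 0 <= t <= h -> RI (v i) 0 t = RI (fun s => f (y s) (alpha s) 0 i) 0 t.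
  move=> /andP[t0 th]; apply: aeE => //.
  - by have [_ _ mv _] := hv i; exact: measurable_funS mv.
  - exact: (ylbm i).1.
  - by move=> s /alE[-> _]; rewrite mxE.
have yE t : 0 <= t <= h -> y t = z + vRI (fun s => f (y s) (alpha s)) 0 t.
  by move=> /andP[t0 th]; apply/rowP => i; rewrite !mxE (min_idPl th) RIE// t0.
have agree t : 0 <= t <= h -> trajectory f z alpha t = y t.
  apply: (trajectory_local_uniqueness cs ca ca (trajectory_continuous cs z ca) cy (fun _ _ => erefl) _ yE).
  by move=> s /andP[s0 _]; rewrite (trajectoryE cs z ca s0).
have cost : rcost z alpha h <= RI lam 0 h.
  rewrite !run_costE (RI_eq (g' := fun s => l (y s) (alpha s))); last first.
    by move=> s sh; rewrite agree.
  rewrite -subr_ge0; have h0 := ltW h_gt0.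
  rewrite -RintegralB//; last 2 first.
  - exact: lamint.
  - exact: locbm_integrable.
  rewrite -/(RI (fun s => lam s - l (y s) (alpha s)) 0 h).
  (* The integrand is known to be nonnegative only on [E], which has full measure in [[0, h]]; its
     absolute value has the same integral and is nonnegative everywhere. *)
  rewrite (aeE _ (fun s => `|lam s - l (y s) (alpha s)|))//.
  - by apply: Rintegral_ge0.
  - by apply: measurable_funB; [exact: measurable_funS mlam|exact: llbm.1].
  - by apply: measurableT_comp => //; apply: measurable_funB; [exact: measurable_funS mlam|exact: llbm.1].
  - by move=> s /alE[_ ls]; rewrite ger0_norm// subr_ge0.
exists alpha => // e N e0.
have hh : 0 <= h <= h by rewrite lexx ltW.
have e20 : 0 < e / 2 by rewrite divr_gt0.
have NU : U [set k | (N <= k)%N] by apply: ooU; exists N.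
have costU : \forall k \near U, RI lam 0 h - rcost z (gam k) h <= e.
  move/cvgrPdist_le : (lamcvg h hh) => /(_ e e0); apply: filterS => k.
  by apply: le_trans; exact: ler_norm.
have [k [[Nk hk] ck]] := @filter_ex _ U _ _ (filterI (filterI NU (ycvg h e hh e0)) costU).
exists k; split => //; first by rewrite agree.
by rewrite (le_trans cost)// -lerBlDl.
Unshelve. all: by end_near. Qed.

End RelaxedLimit.

(** * Stages in convex dynamics *)

Section ConvexStage.
Context {R : realType} {n m : nat}.
Variables (A : set 'rV[R]_m) (T : set 'rV[R]_n)
  (f : 'rV[R]_n -> 'rV[R]_m -> 'rV[R]_n) (l : 'rV[R]_n -> 'rV[R]_m -> R).
Hypothesis cs : control_system A f l.
Hypothesis closedT : closed T.
Implicit Types (x y z : 'rV[R]_n) (alpha gam : R -> 'rV[R]_m) (e : R).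
Local Notation rcost := (run_cost f l).
Local Notation D := (ext_domain T).

Variable M : R.
Hypothesis M_gt0 : 0 < M.
Hypothesis hM : forall x a, A a -> `|f x a| <= M * (1 + `|x|).

Local Notation stage := (stage T M).

(** The end point [y] of the limit trajectory is fixed before the approximating index [k] is chosen,
    so lower semicontinuity at [y] alone handles the displacement. *)
Lemma convex_supersolution_stage (W : 'rV[R]_n -> R) :
  (forall x, D x -> 0 <= W x <= 1) ->
  (forall x, convex_set (velocity_cost_set A f l x)) ->
  viscosity_supersolution (~` T) (HamK A f l) (lsc_env D W) ->
  forall z e, ~ T z -> 0 < e -> exists2 gam, control A gam &
    expR (- rcost z gam (stage z)) * (lsc_env D W (trajectory f z gam (stage z)) - 1)
      <= lsc_env D W z - 1 + e.
Proof.
move=> W01 cvx sup z e nT e0.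
have Wb x : D x -> `|W x| <= 1.
  by move=> /W01/andP[h1 h2]; rewrite ler_norml h2 (le_trans _ h1).
have h0 := stage_gt0 closedT M_gt0 nT.
set h := stage z in h0 *.
have aim (k : nat) : exists gx : (R -> 'rV[R]_m) * 'rV[R]_n, [/\ control A gx.1,
    `|gx.2 - trajectory f z gx.1 h| <= k.+1%:R^-1 &
    expR (- rcost z gx.1 h) * (lsc_env D W gx.2 - 1) <= lsc_env D W z - 1 + k.+1%:R^-1].
  have k0 : (0 : R) < k.+1%:R^-1 by rewrite invr_gt0.
  have [gam [xh [cg _ h1 h2]]] := supersolution_aim cs closedT M_gt0 hM W01 sup nT k0.
  by exists (gam, xh).
have [gx hgx] := choice aim.
have cg k : control A (gx k).1 by have [] := hgx k.
have [alpha ca happ] := relaxed_limit cs z h0 cg cvx.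
exists alpha => //.
set y := trajectory f z alpha h in happ *.
have nTy : ~ T y.
  have hy : `|y - z| <= gap T z / 4.
    by apply: (stage_stay cs M_gt0 hM ca); rewrite lexx ltW.
  apply: (stage_ball closedT nT); apply: (le_trans hy).
  by have := gap_quarter_gt0 closedT nT; lra.
have nDy := outside_ext_domain closedT nTy; have Dy := nbhs_singleton nDy.
have e30 : 0 < e / 3 by rewrite divr_gt0.
have /nbhs_ballP[d /= d0 hd] := lsc_env_lsc Wb nDy e30.
have d20 : 0 < d / 2 by rewrite divr_gt0.
pose r := Num.min (d / 2) (e / 3).
have r0 : 0 < r by rewrite lt_min d20.
have rd : r <= d / 2 by rewrite ge_min lexx.
have re : r <= e / 3 by rewrite ge_min lexx orbT.
pose N := Num.bound r^-1.
have hN k : (N <= k)%N -> k.+1%:R^-1 <= r.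
  move=> Nk; rewrite invf_ple ?posrE//; apply: ltW.
  apply: (lt_le_trans (archi_boundP _)); first by rewrite invr_ge0 ltW.
  by rewrite ler_nat (leq_trans Nk).
have [k [Nk hyk ck]] := happ r N r0.
have [_ hxk hk] := hgx k.
have hkr := hN k Nk.
set yk := trajectory f z (gx k).1 h in hyk hxk.
have : lsc_env D W y - e / 3 < lsc_env D W (gx k).2.
  apply: hd; rewrite -ball_normE /ball_/= -(subrKA yk) (le_lt_trans (ler_normD _ _))//.
  rewrite (distrC y) (distrC yk (gx k).2) [ltRHS]splitr.
  exact: (ltr_leD (lt_le_trans hyk rd) (le_trans hxk (le_trans hkr rd))).
have [gy0 gy1 _ _] := envelopes01 W01 Dy.
move: hk ck; set g := lsc_env D W y in gy0 gy1 *; set gk := lsc_env D W (gx k).2.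
set gz := lsc_env D W z; set La := rcost z alpha h; set Lk := rcost z (gx k).1 h.
move=> hk ck ggk.
have Lk0 : 0 <= Lk by apply: (run_cost_ge0 cs).
have E1 : expR (- Lk) <= 1 by rewrite -expR0 ler_expR oppr_le0.
have E0 := expR_ge0 (- Lk).
have E2 : expR (- Lk) * (1 - r) <= expR (- La).
  apply: (@le_trans _ _ (expR (- Lk) * expR (- r))).
    by rewrite ler_wpM2l//; exact: expR_ge1Dx.
  by rewrite -expRD ler_expR; lra.
move: (expR (- Lk)) (expR (- La)) (k.+1%:R^-1) E0 E1 E2 hk hkr => a b u a0 a1 ab hk hu.
have F1 : b * (g - 1) <= a * (1 - r) * (g - 1) by rewrite ler_wnM2r//; lra.
have F2 : a * (g - 1) <= a * (gk - 1 + e / 3) by rewrite ler_wpM2l//; lra.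
have F3 : a * (e / 3) <= e / 3 by rewrite ler_piMl// ltW.
have F4 : a * (1 - g) <= 1 by rewrite mulr_ile1//; lra.
have F5 : r * (a * (1 - g)) <= r by rewrite ler_piMr// ltW.
by lra.
Qed.

End ConvexStage.

(** * Uniqueness and continuity *)

Section Target.
Context {R : realType} {n : nat}.
Variable T : set 'rV[R]_n.
Hypothesis closedT : closed T.
Implicit Types (x y z b : 'rV[R]_n).
Local Notation D := (ext_domain T).
Local Notation bd := (boundary setT T).

Lemma target_boundary x : T x -> D x -> bd x.
Proof.
move=> Tx Dx; split; first by split => //; exact: subset_closure.
move=> B Bx; apply: contrapT => hn; apply: Dx; apply: filterS Bx => z Bz.
by apply: contrapT => nTz; apply: hn; exists z.
Qed.

Lemma boundary_target b : bd b -> T b.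
Proof. by move=> [[_ clb] _]; exact: closedT. Qed.

Lemma boundary_ext_domain b : bd b -> D b.
Proof. by move=> [_ clb] Tb; have [z [[_ nTz] Tz]] := clb _ Tb. Qed.

(* the first point of T on the segment from x to z *)
Lemma boundary_between x z : ~ T x -> T z -> exists2 b, bd b & `|x - b| <= `|x - z|.
Proof.
move=> nTx Tz; pose p (t : R) := x + t *: (z - x).
have pz : p 1 = z by rewrite /p scale1r addrC subrK.
have plip s t : `|p s - p t| = `|s - t| * `|z - x|.
  by rewrite /p opprD addrACA subrr add0r -scalerBl normrZ.
pose S := [set t : R | 0 <= t <= 1 /\ T (p t)].
have S1 : S 1 by rewrite /S/= ler01 lexx pz.
have hS : has_inf S by split; [exists 1|exists 0 => t [/andP[]]].
pose t := inf S.
have t01 : 0 <= t <= 1.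
  by rewrite lb_le_inf ?ge_inf//; [case: hS|exists 1|move=> s [/andP[]]].
have zx0 : 0 < `|z - x| + 1 by rewrite ltr_wpDl.
(* [t] is only an infimum, but elements of [S] close to it put [p t] in the closure of [T]. *)
have close e : 0 < e -> exists2 s, S s & `|p t - p s| < e.
  move=> e0; have [s Ss st] := inf_adherent (divr_gt0 e0 zx0) hS; exists s => //.
  have ts : t <= s by apply: ge_inf => //; case: hS.
  rewrite plip distrC ger0_norm ?subr_ge0// (@le_lt_trans _ _ ((s - t) * (`|z - x| + 1)))//.
    by rewrite ler_wpM2l ?subr_ge0// lerDl.
  by rewrite -ltr_pdivlMr// ltrBlDl.
have Tp : T (p t).
  apply: closedT => B /nbhs_ballP[e /= e0 hB]; have [s [_ Ts] hs] := close e e0.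
  by exists (p s); split => //; apply: hB; rewrite -ball_normE.
have t0 : 0 < t.
  case/andP : t01 => t0 _; rewrite lt_neqAle t0 andbT; apply/eqP => tE.
  by move: Tp; rewrite /p -tE scale0r addr0.
exists (p t).
  split; first by split => //; exact: subset_closure.
  move=> B /nbhs_ballP[e /= e0 hB].
  pose r := Num.min t (e / (`|z - x| + 1)) / 2.
  have r0 : 0 < r by rewrite divr_gt0// lt_min t0 divr_gt0.
  have rt : r < t.
    have : Num.min t (e / (`|z - x| + 1)) <= t by rewrite ge_min lexx.
    by rewrite /r; lra.
  have re : r < e / (`|z - x| + 1).
    have : Num.min t (e / (`|z - x| + 1)) <= e / (`|z - x| + 1) by rewrite ge_min lexx orbT.
    by have := divr_gt0 e0 zx0; rewrite /r; lra.
  exists (p (t - r)); split.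
    split => // Tpr; have : t <= t - r.
      apply: ge_inf; first by case: hS.
      by split => //; case/andP : t01; lra.
    by lra.
  apply: hB; rewrite -ball_normE /ball_/= plip opprB addrC subrK gtr0_norm//.
  rewrite (@le_lt_trans _ _ (r * (`|z - x| + 1)))//; last by rewrite -ltr_pdivlMr.
  by rewrite ler_pM2l// lerDl.
have := plip 0 t; rewrite /p scale0r addr0 sub0r normrN ger0_norm ?(ltW t0)// => ->.
by rewrite (distrC x z) ler_piMl//; case/andP : t01.
Qed.

Lemma dist_lt_boundary x d : ~ T x -> (dist x T < d%:E)%E -> exists2 b, bd b & `|x - b| < d.
Proof.
move=> nTx /ereal_inf_lt[_ [z Tz <-]]; rewrite lte_fin => xz.
have [b hb xb] := boundary_between nTx Tz; exists b => //.
by rewrite (le_lt_trans xb)// (le_lt_trans (norm_le_enorm _)).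
Qed.

(** A reaching trajectory comes close to the target without having to converge to one of its points,
    so the boundary condition is needed uniformly; compactness of the boundary provides this. *)
Lemma usc_boundary_uniform (W : 'rV[R]_n -> R) e : compact bd ->
  (forall x, D x -> `|W x| <= 1) -> (forall b, bd b -> usc_env D W b <= 0) -> 0 < e ->
  exists2 d, 0 < d & forall x, ~ T x -> (dist x T < d%:E)%E -> usc_env D W x < e.
Proof.
move=> cbd Wb Wbd e0; have e20 : 0 < e / 2 by rewrite divr_gt0.
pose P (d : R) b := forall x, `|b - x| < d -> D x -> usc_env D W x < e.
have : \forall d \near (0 : R)^'+, bd `<=` P d.
  apply: ((compact_near_coveringP bd).1 cbd) => b hb.
  have /nbhs_ballP[d /= d0 hd] := usc_env_near Wb (boundary_ext_domain hb) e20.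
  have d20 : 0 < d / 2 by rewrite divr_gt0.
  exists (ball b (d / 2), [set r : R | r < d / 2]) => /=.
    by split; [exact: nbhsx_ballx|exact: nbhs_right_lt].
  move=> [b' r] [/= bb' rd] x b'x Dx.
  have bx : `|b - x| < d.
    move: bb'; rewrite -ball_normE /ball_/= => bb'.
    rewrite -(subrKA b') (le_lt_trans (ler_normD _ _))// (splitr d) ltrD//.
    exact: lt_trans rd.
  have nbx : nbhs x (ball b d).
    by apply: open_nbhs_nbhs; split; [exact: ball_open|rewrite -ball_normE].
  apply: (@le_lt_trans _ _ (e / 2)); last by lra.
  apply: (usc_env_le Wb Dx); apply: filterS nbx => w bw Dw.
  by have := hd w bw Dw; have := Wbd b hb; lra.
move=> hP; have [d [d0 hd]] : exists d : R, 0 < d /\ bd `<=` P d.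
  have : \forall d \near (0 : R)^'+, 0 < d /\ bd `<=` P d.
    by apply: filterI => //; exact: nbhs_right_gt.
  by move=> /filter_ex.
exists d => // x nTx /(dist_lt_boundary nTx)[b hb xb].
apply: (hd b hb); first by rewrite distrC.
exact: nbhs_singleton (outside_ext_domain closedT nTx).
Qed.

End Target.

(** * The Kruzkov transform on extended reals *)

Section ExpNe.
Context {R : realType}.
Implicit Types (u : \bar R) (c : R).

Lemma expNe_le u c : (c%:E <= u)%E -> expNe u <= expR (- c).
Proof. by case: u => [r| |]//=; rewrite ?lee_fin ?expR_ge0// ler_expR lerN2. Qed.

Lemma inverse_Kruzkov_expNe u : (0 <= u)%E -> inverse_Kruzkov (1 - expNe u) = u.
Proof.
rewrite /inverse_Kruzkov opprB addrC subrK.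
case: u => [r| |]//= _; last by rewrite lexx.
by rewrite leNgt expR_gt0/= expRK /= opprK.
Qed.

Lemma expNe_cvg {S : Type} (F : set_system S) {FF : Filter F} (V : S -> \bar R) u :
  (0 <= u)%E -> V @ F --> u -> (expNe \o V) @ F --> expNe u.
Proof.
case: u => [r| |]//= _ Vu.
  have /fine_cvgP[Vfin Vcvg] := Vu.
  have : (fun z => expR (- fine (V z))) @ F --> expR (- r).
    by apply: (cvg_comp (fun z => - fine (V z)) expR); [exact: (cvgN Vcvg)|exact: continuous_expR].
  apply: cvg_trans; apply: near_eq_cvg; apply: filterS Vfin => z.
  by rewrite /=; case: (V z).
apply/cvgrPdist_le => e e0.
move/cvgeyPge : Vu => /(_ (- ln e)); apply: filterS => z /expNe_le.
rewrite opprK lnK ?posrE// sub0r normrN ger0_norm//.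
by rewrite /=; case: (V z) => //= s; rewrite expR_ge0.
Qed.

End ExpNe.

(** * Comparison of solutions with the transformed value *)

Section Comparison.
Context {R : realType} {n m : nat}.
Variables (A : set 'rV[R]_m) (T : set 'rV[R]_n)
  (f : 'rV[R]_n -> 'rV[R]_m -> 'rV[R]_n) (l : 'rV[R]_n -> 'rV[R]_m -> R).
Hypothesis cs : control_system A f l.
Hypothesis closedT : closed T.
Hypothesis compact_bd : compact (boundary setT T).
Hypothesis VVm : forall x, value A T f l x = value_m A T f l x.
Implicit Types (x y z b : 'rV[R]_n) (e : R) (W : 'rV[R]_n -> R).
Local Notation D := (ext_domain T).
Local Notation bd := (boundary setT T).
Local Notation Z := (disc_value A T f l).
Local Notation Wv := (fun x => 1 - Z x).

Let outD x : ~ T x -> D x.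
Proof. by move=> nT; exact: nbhs_singleton (outside_ext_domain closedT nT). Qed.

Lemma solution01 W : nonneg_on D W -> BVPK_solution A T f l W ->
  forall x, D x -> 0 <= W x <= 1.
Proof. by move=> W0 [W1 _ _ _] x Dx; rewrite W0// W1. Qed.

Let bound1 W x : (forall x, D x -> 0 <= W x <= 1) -> D x -> `|W x| <= 1.
Proof. by move=> W01 /W01/andP[h1 h2]; rewrite ler_norml h2 (le_trans _ h1). Qed.

(** An almost optimal reaching control is stopped shortly before the exit, at a point near the
    boundary where [usc_env D W] is small; the exit time itself may be infinite. *)
Lemma subsolution_le_value W x : nonneg_on D W -> BVPK_solution A T f l W ->
  ~ T x -> usc_env D W x <= Wv x.
Proof.
move=> W0 sol nT; have W01 := solution01 W0 sol.
have [_ _ _ [Wbd sub]] := sol.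
have [M M0 hM] := cs_growth cs.
have [_ _ u0 u1] := envelopes01 W01 (outD nT).
have [Z0|Z0] := leP (Z x) 0; first lra.
rewrite lerBrDl -lerBrDr; apply/ler_addgt0Pr => e e0.
have e20 : 0 < e / 2 by rewrite divr_gt0.
have [alpha [c [reach hc Zc]]] := disc_value_approx cs nT Z0 e20.
have [d d0 hd] := usc_boundary_uniform closedT compact_bd (fun x => bound1 W01) Wbd e20.
have [ca hreach] := (reachingP cs closedT alpha nT).1 reach.
have ex0 := exit_gt0 cs closedT ca nT.
have [t [t0 tex dt]] := hreach d 0 d0 (lexx 0) ex0.
have := subsolution_along cs closedT M0 hM W01 sub ca (ltW t0) tex.
have nTy := before_exit (ltW t0) tex.
have uy := hd _ nTy dt.
have ct := hc t (ltW t0) (ltW tex).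
have := disc_value_le1 T cs x => Z1.
have E1 : expR (- c) <= expR (- run_cost f l x alpha t) by rewrite ler_expR lerN2.
have E2 : expR (- run_cost f l x alpha t) <= 1.
  by rewrite -expR0 ler_expR oppr_le0 (run_cost_ge0 cs).
move: (usc_env D W (trajectory f x alpha t)) (expR (- c)) (expR (- run_cost f l x alpha t)) uy Zc E1 E2
  (expR_ge0 (- run_cost f l x alpha t)).
move=> u a b uy Zc ab b1 b0 h.
have h1 : b * (e / 2) <= e / 2 by rewrite ler_piMl// ltW.
have h2 : b * u <= b * (e / 2) by rewrite ler_wpM2l// ltW.
by move: h; rewrite mulrBr mulr1; lra.
Qed.

Lemma solution_unique W : nonneg_on D W -> BVPK_solution A T f l W ->
  (forall x, ~ T x -> 1 - lsc_env D W x <= Z x) ->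
  forall x, D x -> W x = Wv x.
Proof.
move=> W0 sol sup x Dx; have W01 := solution01 W0 sol.
have Wb x' := @bound1 W x' W01.
have uW := usc_env_ge Wb Dx; have lW := lsc_env_le Wb Dx.
have [Tx|nT] := pselect (T x); last first.
  have h1 := subsolution_le_value W0 sol nT; have h2 := sup x nT.
  by apply/eqP; rewrite eq_le; apply/andP; split; lra.
have bx := target_boundary Tx Dx; have [_ _ _ [Wbd _]] := sol.
have h1 := Wbd x bx; have /andP[h2 _] := W01 x Dx.
rewrite (disc_value_target A f l Tx) subrr; apply/eqP; rewrite eq_le h2 andbT.
exact: le_trans uW h1.
Qed.

Lemma kruzkov_continuous_at x : continuous_at_in D (value A T f l) x ->
  continuous_at_in D Wv x.
Proof.
move=> cV; apply: cvgB; first exact: cvg_cst.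
exact: (expNe_cvg (value_ge0 T cs x) cV).
Qed.

Lemma kruzkov_solution : (forall b, bd b -> continuous_at_in D Wv b) ->
  BVPK_solution A T f l Wv.
Proof.
move=> cbd; have Wb := @kruzkov_bound _ _ _ A T f l cs.
split.
- by move=> x _; have := disc_value_ge0 A T f l x; lra.
- move=> x Dx; exists 1; split; first exact: num_real.
  move=> r r1; apply: filterS (withinT D _) => z Dz.
  exact: le_trans (Wb z Dz) (ltW r1).
- split; last exact: kruzkov_supersolution.
  by move=> b /(boundary_ext_domain) Db; have [] := kruzkov_envelope_bounds cs Db.
- split; last exact: kruzkov_subsolution.
  move=> b hb; have Db := boundary_ext_domain hb; have Tb := boundary_target closedT hb.
  apply/ler_addgt0Pr => e e0; rewrite add0r; apply: (usc_env_le Wb Db).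
  move/cvgrPdist_le : (cbd b hb) => /(_ e e0); rewrite near_withinE; apply: filterS => z h Dz.
  have := h Dz; rewrite (disc_value_target A f l Tb) subrr sub0r normrN.
  exact: le_trans (ler_norm _).
Qed.

Lemma value_inverse_Kruzkov x : value A T f l x = inverse_Kruzkov (Wv x).
Proof. by rewrite (inverse_Kruzkov_expNe (value_ge0 T cs x)). Qed.

Lemma Dom_kruzkov : Dom A T f l = [set x | D x /\ Wv x < 1].
Proof.
apply/seteqP; split => x [Dx]; rewrite /disc_value => h; split => //.
  have := value_ge0 T cs x; move: h; case: (value A T f l x) => [r| |]//= _ _.
  by rewrite ltrBlDr ltrDl expR_gt0.
move: h; case: (value A T f l x) => [r| |]//=; first by rewrite ltry.
by move=> h1; exfalso; lra.
Qed.


(** A point of infinite value either has a neighbourhood where the value is constantly [+oo], or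
    lies on the relative boundary of [Dom], where the assumed limit applies. *)
Lemma kruzkov_continuous_finite :
  (forall x, Dom A T f l x -> continuous_at_in D (value A T f l) x) ->
  (forall x, boundary D (Dom A T f l) x ->
    value A T f l y @[y --> within D x^'] --> +oo%E) ->
  continuous_on D Wv.
Proof.
move=> cDom cbd x Dx.
have [Vx|Vx] := pselect (Dom A T f l x); first exact/kruzkov_continuous_at/cDom.
have VE : value A T f l x = +oo%E.
  by apply/eqP; rewrite -leye_eq leNgt; apply/negP => h; apply: Vx.
apply: kruzkov_continuous_at; rewrite /continuous_at_in VE.
have [clx|nclx] := pselect (closure (Dom A T f l) x); last first.
  have [B [Bx hB]] : exists B, nbhs x B /\ forall z, B z -> ~ Dom A T f l z.
    apply: contrapT => /forallNP hn; apply: nclx => B Bx; apply: contrapT => hn2.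
    apply: (hn B); split; first exact: Bx.
    by move=> z Bz Vz; apply: hn2; exists z; split.
  apply: cvg_near_cst; rewrite near_withinE; apply: filterS Bx => z /hB nVz Dz.
  by apply/eqP; rewrite -leye_eq leNgt; apply/negP => h; apply: nVz.
have bx : boundary D (Dom A T f l) x.
  by split; [split|apply: subset_closure].
(* The assumed limit is over punctured neighbourhoods; at [x] itself the value is [+oo] already. *)
move=> B By; have := cbd x bx B By => hB.
have {}hB : nbhs x [set z | z != x -> D z -> B (value A T f l z)] := hB.
have : nbhs x [set z | D z -> B (value A T f l z)].
  apply: filterS hB => z hz Dz; have [->|zx] := eqVneq z x; last exact: hz.
  by rewrite VE; exact: nbhs_singleton By.
by [].
Qed.

(** Outside [T] both envelopes coincide with [Wv] at [x], and the values nearby lie between them up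
    to [e]. *)
Lemma kruzkov_continuous_sandwich :
  (forall b, bd b -> continuous_at_in D Wv b) ->
  (forall x, ~ T x -> 1 - lsc_env D Wv x <= Z x) ->
  continuous_on D Wv.
Proof.
move=> cbd sup x Dx; have sol := kruzkov_solution cbd.
have [Tx|nT] := pselect (T x); first exact/cbd/target_boundary.
have W0 : nonneg_on D Wv by move=> y _; have := disc_value_le1 T cs y; lra.
have h1 := subsolution_le_value W0 sol nT; have h2 := sup x nT.
have Wb := @kruzkov_bound _ _ _ A T f l cs.
apply/cvgrPdist_le => e e0; rewrite near_withinE.
apply: filterS2 (usc_env_near Wb Dx e0) (lsc_env_near Wb Dx e0) => z hu hl Dz.
move: h1 h2 (hu Dz) (hl Dz) => /=.
move: (usc_env D Wv x) (lsc_env D Wv x) (Z x) (Z z) => a b c d h1 h2 h3 h4.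
by rewrite ler_norml; apply/andP; split; lra.
Qed.

End Comparison.

Unset Implicit Arguments.

Theorem theorem2p2 (R : realType) (n m : nat)
    (A : set 'rV[R]_m) (T : set 'rV[R]_n)
    (f : 'rV[R]_n -> 'rV[R]_m -> 'rV[R]_n) (l : 'rV[R]_n -> 'rV[R]_m -> R) :
  standing_assumptions A T f l ->
  (forall x, value A T f l x = value_m A T f l x) ->
  ((forall x, Dom A T f l x ->
      continuous_at_in (ext_domain T) (value A T f l) x) ->
   (forall xbar, boundary (ext_domain T) (Dom A T f l) xbar ->
      value A T f l x @[x --> within (ext_domain T) xbar^'] --> +oo%E) ->
   exists W : 'rV[R]_n -> R,
     [/\ [/\ continuous_on (ext_domain T) W, nonneg_on (ext_domain T) W &
             BVPK_solution A T f l W],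
         forall W' : 'rV[R]_n -> R,
           continuous_on (ext_domain T) W' -> nonneg_on (ext_domain T) W' ->
           BVPK_solution A T f l W' ->
           forall x, ext_domain T x -> W' x = W x,
         forall x, ext_domain T x ->
           value A T f l x = inverse_Kruzkov (W x) &
         Dom A T f l = [set x | ext_domain T x /\ W x < 1]])
  /\
  ((forall x, convex_set (velocity_cost_set A f l x)) ->
   (forall x, boundary setT T x ->
      continuous_at_in (ext_domain T) (value A T f l) x) ->
   exists W : 'rV[R]_n -> R,
     [/\ nonneg_on (ext_domain T) W /\ BVPK_solution A T f l W,
         forall W' : 'rV[R]_n -> R,
           nonneg_on (ext_domain T) W' -> BVPK_solution A T f l W' ->
           forall x, ext_domain T x -> W' x = W x,
         continuous_on (ext_domain T) W,
         forall x, ext_domain T x ->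
           value A T f l x = inverse_Kruzkov (W x) &
         Dom A T f l = [set x | ext_domain T x /\ W x < 1]]).
Proof.
move=> std VVm.
have cs := standing_control_system std.
have [_ [closedT cbd] _ _ _] := std.
have [M M0 hM] := cs_growth cs.
pose W x := 1 - disc_value A T f l x.
have W0 : nonneg_on (ext_domain T) W.
  by move=> x _; have := disc_value_le1 T cs x; rewrite /W; lra.
split => [cDom cinf|cvx cV].
  have cW : continuous_on (ext_domain T) W by exact: kruzkov_continuous_finite.
  have sol : BVPK_solution A T f l W.
    apply: kruzkov_solution => // b hb; apply: cW; exact: boundary_ext_domain hb.
  exists W; split.
  - by split.
  - move=> W' cW' W'0 sol'; have W'01 := solution01 W'0 sol'.
    have [_ _ [_ sup'] _] := sol'.
    apply: (solution_unique cs closedT cbd W'0 sol').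
    apply: (supersolution_value cs closedT M0 hM W'01 VVm).
    exact: (continuous_supersolution_stage cs closedT M0 hM W'01 cW' sup').
  - by move=> x _; exact: value_inverse_Kruzkov.
  - exact: Dom_kruzkov.
have cWbd b : boundary setT T b -> continuous_at_in (ext_domain T) W b.
  by move=> hb; apply: kruzkov_continuous_at => //; exact: cV.
have sol : BVPK_solution A T f l W by exact: kruzkov_solution.
have super W' : nonneg_on (ext_domain T) W' -> BVPK_solution A T f l W' ->
    forall x, ~ T x -> 1 - lsc_env (ext_domain T) W' x <= disc_value A T f l x.
  move=> W'0 sol'; have W'01 := solution01 W'0 sol'; have [_ _ [_ sup'] _] := sol'.
  apply: (supersolution_value cs closedT M0 hM W'01 VVm).
  exact: (convex_supersolution_stage cs closedT M0 hM W'01 cvx sup').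
exists W; split => //.
- by move=> W' W'0 sol'; apply: (solution_unique cs closedT cbd W'0 sol'); exact: super.
- by apply: (kruzkov_continuous_sandwich cs closedT cbd cWbd); exact: super.
- by move=> x _; exact: value_inverse_Kruzkov.
- exact: Dom_kruzkov.
Qed.
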